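(* Let $g\in L^\infty(\mathbb T)\setminus\{0\}$ be such that $\ker T_g\neq\{0\}$. Then $g\neq0$ a.e., and a function $k$ is a maximal vector for $\ker T_g$ if and only if $k\in H^2$ and $k=g^{-1}\,\overline{z}\,\overline{p}$ for some outer function $p\in H^2$.
   Context: $\mathbb D$ is the unit disc and $\mathbb T$ the unit circle with normalized Lebesgue measure. $H^2$ is the Hardy space of $\mathbb D$, identified with a closed subspace of $L^2(\mathbb T)$ via boundary values. $\overline{H^2_0}=L^2(\mathbb T)\ominus H^2$, and $z$ is the identity function. For $g\in L^\infty(\mathbb T)$, $T_gf=P(gf)$ on $H^2$, where $P$ is the orthogonal projection onto $H^2$; thus $\ker T_g=\{f\in H^2:gf\in\overline{H^2_0}\}$. A Toeplitz kernel is a subspace of the form $\ker T_v$ with $v\in L^\infty(\mathbb T)$. For $k\in H^2\setminus\{0\}$, $K_{\min}(k)$ denotes the minimal Toeplitz kernel containing $k$. That is, $K_{\min}(k)=\ker T_v$ with $k\in\ker T_v$ and $\ker T_v\subseteq\ker T_w$ for every $w\in L^\infty(\mathbb T)$ with $k\in\ker T_w$; it always exists. A function $k$ is a maximal vector for $\ker T_g$ if $\ker T_g=K_{\min}(k)$. *)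

(* Defs.v *)
From HB Require Import structures.
From mathcomp Require Import all_boot all_order all_algebra.
From mathcomp Require Import all_classical all_reals all_analysis.
From mathcomp Require Import complex.
Set Implicit Arguments. Unset Strict Implicit. Unset Printing Implicit Defensive.
Import Order.TTheory GRing.Theory Num.Theory.
Local Open Scope classical_set_scope.
Local Open Scope ring_scope.

(* The unit circle T is parametrized by t in [0,1] via t |-> exp(2 pi i t);
   normalized Lebesgue measure on T corresponds to Lebesgue measure on [0,1]
   (the endpoints 0,1 both map to 1, a null set).  A "function on T" is a
   function  R -> R[i]  of which only the values on [0,1] matter. *)

Section Hardy.
Variable R : realType.

Definition I01 : set R := `[0%R, 1%R]%classic.
Definition leb := (@lebesgue_measure R).

Definition cnorm (z : R[i]) : R := Normc.normc z.

Definition cint (f : R -> R[i]) : R[i] :=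
  Complex (Rintegral leb I01 (fun t => complex.Re (f t)))
          (Rintegral leb I01 (fun t => complex.Im (f t))).

Definition ee (x : R) : R[i] := Complex (cos x) (sin x).

Definition zeta (t : R) : R[i] := ee (2 * pi * t).

Definition cexpC (w : R[i]) : R[i] := Complex (expR (complex.Re w)) 0 * ee (complex.Im w).

Definition fcoef (f : R -> R[i]) (n : int) : R[i] :=
  cint (fun t => f t * ee (- (2 * pi * n%:~R * t))).

Definition cip (f h : R -> R[i]) : R[i] := cint (fun t => f t * conjc (h t)).

Definition cmeas (f : R -> R[i]) : Prop :=
  measurable_fun I01 (fun t => complex.Re (f t)) /\ measurable_fun I01 (fun t => complex.Im (f t)).

Definition inL2 (f : R -> R[i]) : Prop :=
  cmeas f /\ (\int[leb]_(t in I01) ((cnorm (f t)) ^+ 2)%:E < +oo)%E.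

Definition inLinf (g : R -> R[i]) : Prop :=
  cmeas g /\ exists M : R, {ae leb, forall t, I01 t -> cnorm (g t) <= M}.

Definition aezero (f : R -> R[i]) : Prop := {ae leb, forall t, I01 t -> f t = 0}.

(* H^2, identified with the closed subspace of L^2(T) of boundary values:
   functions whose negative Fourier coefficients vanish *)
Definition inH2 (f : R -> R[i]) : Prop :=
  inL2 f /\ forall n : int, n < 0 -> fcoef f n = 0.

Definition inH20bar (h : R -> R[i]) : Prop :=
  inL2 h /\ forall f, inH2 f -> cip h f = 0.

Definition kerT (g : R -> R[i]) : set (R -> R[i]) :=
  [set f | inH2 f /\ inH20bar (fun t => g t * f t)].

Definition toeplitz_kernel (K : set (R -> R[i])) : Prop :=
  exists v, inLinf v /\ K = kerT v.

Definition is_Kmin (k : R -> R[i]) (K : set (R -> R[i])) : Prop :=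
  toeplitz_kernel K /\ K k /\
  forall w, inLinf w -> kerT w k -> K `<=` kerT w.

Definition maximal_vector (g k : R -> R[i]) : Prop := is_Kmin k (kerT g).

Definition csum_to (a : nat -> R[i]) (w : R[i]) : Prop :=
  forall eps : R, 0 < eps -> exists N : nat, forall m : nat, (N <= m)%N ->
    cnorm ((\sum_(i < m) a i) - w) < eps.

Definition herglotz (t : R) (z : R[i]) : R[i] := (zeta t + z) / (zeta t - z).

(* p in H^2 is outer: its analytic extension P(z) = sum_{n>=0} \hat p(n) z^n
   to the disc has the form
   P(z) = c exp( \int_T (e^{it}+z)/(e^{it}-z) log psi dm ),
   with |c| = 1, psi > 0 a.e. and log psi integrable. *)
Definition outer (p : R -> R[i]) : Prop :=
  inH2 p /\
  exists (c : R[i]) (psi : R -> R),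
    cnorm c = 1 /\ measurable_fun I01 psi /\
    {ae leb, forall t, I01 t -> 0 < psi t} /\
    leb.-integrable I01 (fun t => (ln (psi t))%:E) /\
    forall z : R[i], cnorm z < 1 ->
      csum_to (fun n => fcoef p n%:Z * z ^+ n)
              (c * cexpC (cint (fun t => herglotz t z * Complex (ln (psi t)) 0))).

End Hardy.

(* Main.v *)
(* Write [g * k] as the conjugate of [zeta * p] with [p] in H^2. If [p] is outer and
   [w * k], [g * f] are the conjugates of [zeta * q], [zeta * r] with [q], [r] in H^2,
   then [w * f] is the conjugate of [zeta * q * r / p], and the L^2 function
   [q * r / p] is in H^2 because [p] is cyclic for the shift. Conversely, let
   [p = tau * o] be the inner-outer factorization of [p] for a maximal vector [k]. As
   [k] lies in the kernel with symbol [g * tau], so does the whole kernel of [g]; by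
   induction all [tau ^+ n * k] lie in the kernel of [g], hence [tau ^+ n] divides [p]
   for every [n], which forces the inner function [tau] to be constant.

   Functions of H^2 extend to the disc by their Cauchy integrals, whose dilates converge
   back to them in L^2; this transfers bounds and products between the disc and the
   circle, and produces outer functions from exponentials of Herglotz integrals. *)

Require Import Defs.
From HB Require Import structures.
From mathcomp Require Import all_boot all_order all_algebra.
From mathcomp Require Import all_classical all_reals all_analysis.
From mathcomp Require Import complex.
From mathcomp Require Import measurable_realfun.
From mathcomp Require Import ring lra.
Set Implicit Arguments. Unset Strict Implicit. Unset Printing Implicit Defensive.
Import Order.TTheory GRing.Theory Num.Theory numFieldNormedType.Exports.
Local Open Scope classical_set_scope.
Local Open Scope ring_scope.

(** Holomorphy is taken as approximability by polynomials on smaller discs, so that Cauchy's formula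
    reduces to the orthogonality of the powers of [zeta]. The main obstacle is that [outer]
    prescribes the exponential of a Herglotz integral of a density that is merely integrable,
    whereas boundary values of Herglotz integrals are obtained here for square integrable densities
    only. Hence the detour through the regularized logarithms [ln (|p|^2 + d^2)]; letting [d] tend
    to 0 gives Jensen's inequality and the integrability of [ln |p|], on which the outer factor and
    the claim that [g] is nonzero a.e. both rest. A product of two H^2 functions may leave L^2, so
    it is handled as an L^1 function whose negative Fourier coefficients vanish. The constancy of
    [tau] is read off at the origin: if its extension has modulus less than 1 there, the same holds
    near 0, and the extension of [p], divisible by all powers of that of [tau] with quotients
    bounded uniformly, vanishes near 0. Norms stay squared throughout, and weighted forms of Young's
    inequality stand in for those of Cauchy-Schwarz and Minkowski. *)

Local Notation Re := complex.Re.
Local Notation Im := complex.Im.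
Local Notation "x %:C" := (Complex x 0).

(** * Real integrals over [0, 1] *)

Section RealIntegral.
Variable R : realType.
Implicit Types (f g h : R -> R).

Local Notation mu := (@leb R).
Local Notation D := (@I01 R).

Definition mea f : Prop := measurable_fun D f.
Definition integr f : Prop := mu.-integrable D (EFin \o f).
Definition ri f : R := Rintegral mu D f.

Lemma mI01 : measurable (D : set (measurableTypeR R)).
Proof. exact: measurable_itv. Qed.
Hint Resolve mI01 : core.

Lemma mu_I01 : mu D = 1%E.
Proof. by rewrite /I01 /leb lebesgue_measure_itv/= lte_fin ltr01 oppr0 adde0. Qed.

Lemma aeW (P : R -> Prop) : (forall t, D t -> P t) -> {ae mu, forall t, D t -> P t}.
Proof. by move=> h; apply: aeW => t; apply: h. Qed.

Lemma ae2 (P Q S : R -> Prop) : (forall t, D t -> P t -> Q t -> S t) ->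
  {ae mu, forall t, D t -> P t} -> {ae mu, forall t, D t -> Q t} ->
  {ae mu, forall t, D t -> S t}.
Proof.
move=> h hP hQ.
apply: (@filterS2 _ _ (ae_filter_ringOfSetsType mu) _ _ _ _ hP hQ).
by move=> t /[swap] hQt hPt Dt; exact: h (hPt Dt) (hQt Dt).
Qed.

Lemma ae1 (P S : R -> Prop) : (forall t, D t -> P t -> S t) ->
  {ae mu, forall t, D t -> P t} -> {ae mu, forall t, D t -> S t}.
Proof. by move=> h hP; apply: (ae2 (P := P) (Q := P)) => // t Dt Pt _; exact: h. Qed.

Lemma mea_integr f : integr f -> mea f.
Proof. by move=> /integrableP[/measurable_EFinP]. Qed.

Lemma mea_cst c : mea (fun=> c). Proof. exact: measurable_cst. Qed.
Lemma meaD f g : mea f -> mea g -> mea (fun t => f t + g t).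
Proof. exact: measurable_funD. Qed.
Lemma meaB f g : mea f -> mea g -> mea (fun t => f t - g t).
Proof. exact: measurable_funB. Qed.
Lemma meaM f g : mea f -> mea g -> mea (fun t => f t * g t).
Proof. exact: measurable_funM. Qed.
Lemma meaN f : mea f -> mea (fun t => - f t).
Proof. exact: measurable_funN. Qed.
Lemma meaX f n : mea f -> mea (fun t => f t ^+ n).
Proof. exact: measurable_funX. Qed.
Lemma mea_comp f (k : R -> R) : measurable_fun setT k -> mea f -> mea (fun t => k (f t)).
Proof. by move=> mk mf; exact: (measurableT_comp mk mf). Qed.
Lemma mea_cont f (k : R -> R) : continuous k -> mea f -> mea (fun t => k (f t)).
Proof. by move=> /continuous_measurable_fun; exact: mea_comp. Qed.
Lemma mea_id : mea id. Proof. exact: measurable_id. Qed.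
Lemma mea_abs f : mea f -> mea (fun t => `|f t|).
Proof. by apply: mea_comp; exact: normr_measurable. Qed.
Lemma mea_ln f : mea f -> mea (fun t => ln (f t)).
Proof. by apply: mea_comp; exact: measurable_ln. Qed.
Lemma mea_exp f : mea f -> mea (fun t => expR (f t)).
Proof. by apply: mea_comp; exact: measurable_expR. Qed.
Lemma mea_sqrt f : mea f -> mea (fun t => Num.sqrt (f t)).
Proof. by apply: mea_cont; exact: sqrt_continuous. Qed.
Lemma mea_max f g : mea f -> mea g -> mea (fun t => Num.max (f t) (g t)).
Proof. exact: measurable_maxr. Qed.
Lemma mea_min f g : mea f -> mea g -> mea (fun t => Num.min (f t) (g t)).
Proof. exact: measurable_minr. Qed.
Lemma eq_mea f g : (forall t, D t -> f t = g t) -> mea f -> mea g.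
Proof. by move=> fg; apply: eq_measurable_fun => t /set_mem /fg. Qed.
Lemma mea_inv f : (forall t, D t -> 0 < f t) -> mea f -> mea (fun t => (f t)^-1).
Proof.
move=> f0 mf; apply: (@eq_mea (fun t => powR (f t) (-1))).
  by move=> t /f0 ft; rewrite powRN powRr1 ?ltW.
by apply: (mea_comp (k := fun x => powR x (-1))) => //; exact: measurable_powR.
Qed.

Lemma integr_le f g : mea f -> integr g -> (forall t, D t -> `|f t| <= g t) -> integr f.
Proof.
move=> mf ig fg; apply: le_integrable ig => //; first exact/measurable_EFinP.
by move=> x Dx /=; rewrite lee_fin (le_trans (fg _ Dx))// ler_norm.
Qed.

Lemma integr_le_ae f g : mea f -> integr g ->
  {ae mu, forall t, D t -> `|f t| <= g t} -> integr f.
Proof.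
move=> mf ig fg; apply/integrableP; split; first exact/measurable_EFinP.
have /integrableP[mg] := ig; apply: le_lt_trans.
apply: (@ae_ge0_le_integral _ _ _ mu D mI01 (fun t => `|f t|%:E) (fun t => `|g t|%:E)).
- by move=> t _; rewrite lee_fin.
- by apply/measurable_EFinP; exact: mea_abs.
- by move=> t _; rewrite lee_fin.
- by apply/measurable_EFinP; apply: mea_abs; exact: mea_integr.
- by apply: ae1 fg => t Dt h /=; rewrite lee_fin (le_trans h)// ler_norm.
Qed.

Lemma integr_cst c : integr (fun=> c).
Proof.
apply/integrableP; split; first by apply/measurable_EFinP; exact: mea_cst.
rewrite -[X in (X < _)%E]/(integral mu D (cst `|c|%:E)) integral_cst//.
set m := (X in (_ * X < _)%E).
by rewrite (_ : m = 1%E) ?mule1 ?ltry//; exact: mu_I01.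
Qed.

Lemma integr_bdd f M : mea f -> (forall t, D t -> `|f t| <= M) -> integr f.
Proof. by move=> mf; apply: integr_le => //; exact: integr_cst. Qed.

Lemma integrD f g : integr f -> integr g -> integr (fun t => f t + g t).
Proof. by move=> ig ih; have h := integrableD mI01 ig ih; apply: eq_integrable h. Qed.
Lemma integrN f : integr f -> integr (fun t => - f t).
Proof. by move=> ig; have h := integrableN ig; apply: eq_integrable h. Qed.
Lemma integrB f g : integr f -> integr g -> integr (fun t => f t - g t).
Proof. by move=> ig ih; exact: (integrD ig (integrN ih)). Qed.
Lemma integrZ c f : integr f -> integr (fun t => c * f t).
Proof. by move=> ig; have h := integrableZl mI01 c ig; apply: eq_integrable h. Qed.
Lemma integr_abs f : integr f -> integr (fun t => `|f t|).
Proof. exact: integrable_norm. Qed.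
Lemma eq_integr f g : (forall t, D t -> f t = g t) -> integr f -> integr g.
Proof. by move=> fg; apply: eq_integrable => // t /set_mem Dt /=; rewrite fg. Qed.
Lemma integr_sum (I : Type) (s : seq I) (F : I -> R -> R) : (forall i, integr (F i)) ->
  integr (fun t => \sum_(i <- s) F i t).
Proof.
move=> iF; elim: s => [|i s ih].
  by apply: eq_integr (integr_cst 0) => t _; rewrite big_nil.
by apply: eq_integr (integrD (iF i) ih) => t _; rewrite big_cons.
Qed.
Lemma integrMb f g M : mea f -> (forall t, D t -> `|f t| <= M) -> integr g ->
  integr (fun t => f t * g t).
Proof.
move=> mf fM ig; apply: (integr_le (g := fun t => M * `|g t|)).
- by apply: meaM => //; exact: mea_integr.
- exact/integrZ/integr_abs.
- by move=> t Dt; rewrite normrM ler_wpM2r// fM.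
Qed.

Lemma eq_ri f g : (forall t, D t -> f t = g t) -> ri f = ri g.
Proof. by move=> fg; apply: eq_Rintegral => t /set_mem; exact: fg. Qed.
Lemma riD f g : integr f -> integr g -> ri (fun t => f t + g t) = ri f + ri g.
Proof. exact: RintegralD. Qed.
Lemma riB f g : integr f -> integr g -> ri (fun t => f t - g t) = ri f - ri g.
Proof. exact: RintegralB. Qed.
Lemma riZ c f : integr f -> ri (fun t => c * f t) = c * ri f.
Proof. exact: RintegralZl. Qed.
Lemma riN f : integr f -> ri (fun t => - f t) = - ri f.
Proof.
move=> ih; rewrite -mulN1r -riZ//; apply: eq_ri => t _; by rewrite mulN1r.
Qed.
Lemma ri_cst c : ri (fun=> c) = c.
Proof.
rewrite /ri Rintegral_cst//.
set m := (X in fine X).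
by rewrite (_ : m = 1%E) ?mulr1//; exact: mu_I01.
Qed.
Lemma ri_sum (I : Type) (s : seq I) (F : I -> R -> R) : (forall i, integr (F i)) ->
  ri (fun t => \sum_(i <- s) F i t) = \sum_(i <- s) ri (F i).
Proof.
move=> iF; elim: s => [|i s ih].
  by rewrite big_nil -[RHS](ri_cst 0); apply: eq_ri => t _; rewrite big_nil.
rewrite big_cons -ih -riD//; last exact: integr_sum.
by apply: eq_ri => t _; rewrite big_cons.
Qed.
Lemma ri_ge0 f : (forall t, D t -> 0 <= f t) -> 0 <= ri f.
Proof. by move=> f0; rewrite /ri; apply: Rintegral_ge0 => t /f0. Qed.
Lemma ri_le f g : integr f -> integr g -> (forall t, D t -> f t <= g t) -> ri f <= ri g.
Proof. by move=> ? ? ?; rewrite /ri; apply: le_Rintegral. Qed.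
Lemma ri_abs f : integr f -> `|ri f| <= ri (fun t => `|f t|).
Proof. by move=> ?; rewrite /ri; apply: le_normr_Rintegral. Qed.
Lemma ae_ri f g : mea f -> mea g -> {ae mu, forall t, D t -> f t = g t} -> ri f = ri g.
Proof.
move=> mf mg fg; congr fine; apply: ae_eq_integral => //.
- exact/measurable_EFinP.
- exact/measurable_EFinP.
- by apply: ae1 fg => t Dt ->.
Qed.
Lemma ri_EFin f : integr f -> (ri f)%:E = (\int[mu]_(t in D) (f t)%:E)%E.
Proof. by move=> ig; rewrite /ri /Rintegral fineK//; exact: integrable_fin_num. Qed.
Lemma ri_le_ae f g : integr f -> integr g ->
  {ae mu, forall t, D t -> f t <= g t} -> ri f <= ri g.
Proof.
move=> ig ih fg.
(* The maximum dominates [f] everywhere and equals [g] almost everywhere, which reduces the claim to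
   the pointwise comparison. *)
have im : integr (fun t => Num.max (f t) (g t)).
  apply: (integr_le (g := fun t => `|f t| + `|g t|)).
  - by apply: mea_max; exact: mea_integr.
  - by apply: integrD; exact: integr_abs.
  - by move=> t _; case: (leP (f t) (g t)) => _; rewrite ?lerDl ?lerDr.
apply: (@le_trans _ _ (ri (fun t => Num.max (f t) (g t)))).
  by apply: ri_le => // t _; rewrite le_max lexx.
rewrite (@ae_ri _ g)//; try exact: mea_integr.
by apply: ae1 fg => t _ fg; apply/max_idPr.
Qed.
Lemma ri_eq0 f : integr f -> {ae mu, forall t, D t -> 0 <= f t} -> ri f <= 0 ->
  {ae mu, forall t, D t -> f t = 0}.
Proof.
move=> ig f0 rf.
have mf := mea_integr ig.
have : (\int[mu]_(t in D) `|(EFin \o f) t| = 0)%E.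
  rewrite -[LHS]/(\int[mu]_(t in D) `|f t|%:E)%E.
  rewrite -(ri_EFin (integr_abs ig)) (@ae_ri _ f) //; last 2 first.
    exact: mea_abs.
    by apply: ae1 f0 => t _; exact: ger0_norm.
  congr EFin; apply/eqP; rewrite eq_le rf/= -(ri_cst 0).
  by apply: ri_le_ae => //; exact: integr_cst.
move/(ae_eq_integral_abs mu mI01 _).1 => /(_ _)[]; first exact/measurable_EFinP.
move=> N [mN N0 sN]; exists N; split => //.
apply: subset_trans sN => t /= h h2; apply: h => Dt.
by have := h2 Dt => /= -[].
Qed.

Lemma integr_lty f : mea f -> (forall t, D t -> 0 <= f t) ->
  (\int[mu]_(t in D) (f t)%:E < +oo)%E -> integr f.
Proof.
move=> mf f0 fo; apply/integrableP; split; first exact/measurable_EFinP.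
rewrite (@eq_integral _ _ _ mu D (fun t => (f t)%:E))// => t /set_mem Dt /=.
by rewrite ger0_norm// f0.
Qed.

Lemma ri_dct (F : nat -> R -> R) f g :
  (forall n, mea (F n)) -> mea f -> integr g ->
  {ae mu, forall t, D t -> F ^~ t @ \oo --> f t} ->
  {ae mu, forall t, D t -> forall n, `|F n t| <= g t} ->
  integr f /\ ri (F n) @[n --> \oo] --> ri f.
Proof.
move=> mF mf ig Ff Fg.
have [] := @dominated_convergence _ _ _ mu D mI01 (fun n t => (F n t)%:E)
   (EFin \o f) (EFin \o g) _ _ _ ig _.
- by move=> n; apply/measurable_EFinP; exact: mF.
- by apply/measurable_EFinP; exact: mf.
- by apply: ae1 Ff => t Dt h; apply/fine_cvgP; split; [exact: nearW|].
- apply: (@filterS _ _ (ae_filter_ringOfSetsType mu) _ _ _ Fg) => t h n Dt.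
  by rewrite lee_fin; exact: h.
move=> i1 _ h; split => //.
have e : (\int[mu]_(t in D) (EFin \o f) t = (ri f)%:E)%E by rewrite (ri_EFin i1).
by rewrite e in h; have [_] := (fine_cvgP (fun n => \int[mu]_(t in D) (F n t)%:E)%E (ri f)).1 h.
Qed.

(** Fatou's lemma, with integrability of the limit as part of the conclusion: this is how the limit
    in Riesz-Fischer is seen to be in L^2 and how [ln |p|] is seen to be integrable. *)
Lemma ri_fatou (F : nat -> R -> R) f (M : R) :
  (forall n, integr (F n)) -> mea f ->
  (forall n t, D t -> 0 <= F n t) -> (forall t, D t -> 0 <= f t) ->
  {ae mu, forall t, D t -> F ^~ t @ \oo --> f t} ->
  (\forall n \near \oo, ri (F n) <= M) -> integr f /\ ri f <= M.
Proof.
move=> iF mf F0 f0 Ff FM.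
have fat := @fatou _ _ _ mu D mI01 (fun n t => (F n t)%:E) _ _.
have h : (\int[mu]_(t in D) (f t)%:E <= M%:E)%E.
  have -> : (\int[mu]_(t in D) (f t)%:E =
      \int[mu]_(t in D) limn_einf (fun n => (F n t)%:E))%E.
    apply: ae_eq_integral => //.
    - by apply/measurable_EFinP; exact: mf.
    - apply: measurableT_comp => //; apply: measurable_fun_limn_esup => n.
      by apply: measurableT_comp => //; apply/measurable_EFinP; exact: mea_integr.
    - apply: ae1 Ff => t Dt h /=; apply/esym.
      have h' : (F n t)%:E @[n --> \oo] --> (f t)%:E by apply/fine_cvgP; split; [exact: nearW|].
      exact: (cvg_limn_einf_sup h').1.
  apply: le_trans (fat _ _) _.
  - by move=> n; apply/measurable_EFinP; exact: mea_integr.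
  - by move=> n t Dt; rewrite lee_fin F0.
  have -> : (fun n => \int[mu]_(t in D) (F n t)%:E)%E = (fun n => (ri (F n))%:E).
    by apply/funext => n; rewrite ri_EFin.
  (* The lower limit of the integrals is the limit of the infima over tails, each at most the first
     term of its tail. *)
  rewrite limn_einf_lim; apply: lime_le.
    exact: is_cvg_einfs.
  near=> n.
  apply: le_trans (_ : (ri (F n))%:E <= _)%E.
    apply: ereal_inf_lbound; exists n => //=.
  rewrite lee_fin; near: n; exact: FM.
have i1 : integr f by apply: integr_lty => //; rewrite (le_lt_trans h)// ltry.
by split => //; rewrite -lee_fin ri_EFin.
Unshelve. all: by end_near. Qed.

End RealIntegral.

(** * Complex integrals and L^2 *)

Section ComplexIntegral.
Variable R : realType.
Local Notation C := R[i].
Implicit Types (f g h : R -> C) (z w : C).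

Local Notation mu := (@leb R).
Local Notation D := (@I01 R).

Lemma ReD z w : Re (z + w) = Re z + Re w. Proof. by case: z; case: w. Qed.
Lemma ImD z w : Im (z + w) = Im z + Im w. Proof. by case: z; case: w. Qed.
Lemma ReN z : Re (- z) = - Re z. Proof. by case: z. Qed.
Lemma ImN z : Im (- z) = - Im z. Proof. by case: z. Qed.
Lemma ReM z w : Re (z * w) = Re z * Re w - Im z * Im w.
Proof. by case: z; case: w. Qed.
Lemma ImM z w : Im (z * w) = Re z * Im w + Im z * Re w.
Proof. by case: z; case: w. Qed.
Lemma ReJ z : Re (conjc z) = Re z. Proof. by case: z. Qed.
Lemma ImJ z : Im (conjc z) = - Im z. Proof. by case: z. Qed.
Definition cE := (ReD, ImD, ReN, ImN, ReM, ImM, ReJ, ImJ).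
Lemma eqC z w : Re z = Re w -> Im z = Im w -> z = w.
Proof. by case: z; case: w => a b c d /= -> ->. Qed.
Lemma cplxM (a b : R) : (a * b)%:C = a%:C * b%:C.
Proof. by apply: eqC; rewrite !cE /=; ring. Qed.
Lemma cplxD (a b : R) : (a + b)%:C = a%:C + b%:C.
Proof. by apply: eqC; rewrite !cE /=; ring. Qed.
Lemma cplxN (a : R) : (- a)%:C = - a%:C.
Proof. by apply: eqC; rewrite !cE /=; ring. Qed.
Lemma cplx0 : 0%:C = 0 :> C. Proof. by []. Qed.
Lemma cplx1 : 1%:C = 1 :> C. Proof. by []. Qed.
Lemma cplxX (a : R) n : (a ^+ n)%:C = a%:C ^+ n.
Proof. by elim: n => [|n ih]; rewrite ?expr0// !exprS cplxM ih. Qed.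

(** The squared modulus is polynomial in the coordinates, so its measurability and its inequalities
    are matters of real algebra. *)
Definition csq z : R := Re z ^+ 2 + Im z ^+ 2.
Lemma cnormE z : cnorm z = Num.sqrt (csq z). Proof. by case: z. Qed.
Lemma csq_ge0 z : 0 <= csq z. Proof. by rewrite addr_ge0// sqr_ge0. Qed.
Lemma cnorm_sq z : cnorm z ^+ 2 = csq z.
Proof. by rewrite cnormE sqr_sqrtr// csq_ge0. Qed.
Lemma cnorm_ge0 z : 0 <= cnorm z. Proof. by rewrite cnormE sqrtr_ge0. Qed.
Hint Resolve cnorm_ge0 csq_ge0 : core.
Lemma cnormM z w : cnorm (z * w) = cnorm z * cnorm w.
Proof. exact: Normc.normcM. Qed.
Lemma cnormV z : cnorm z^-1 = (cnorm z)^-1.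
Proof. exact: Normc.normcV. Qed.
Lemma cnormD z w : cnorm (z + w) <= cnorm z + cnorm w.
Proof. exact: le_normcD. Qed.
Lemma cnormN z : cnorm (- z) = cnorm z. Proof. exact: normcN. Qed.
Lemma cnormJ z : cnorm (conjc z) = cnorm z.
Proof. by rewrite !cnormE /csq !cE sqrrN. Qed.
Lemma cnorm0 : cnorm (0 : C) = 0. Proof. exact: Normc.normc0. Qed.
Lemma cnorm1 : cnorm (1 : C) = 1. Proof. exact: Normc.normc1. Qed.
Lemma cnorm_eq0 z : cnorm z = 0 -> z = 0. Proof. exact: Normc.eq0_normc. Qed.
Lemma cnorm_gt0 z : z != 0 -> 0 < cnorm z.
Proof. by move=> z0; rewrite lt_def cnorm_ge0 andbT; apply: contra_neq z0 => /cnorm_eq0. Qed.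
Lemma cnormB z w : cnorm (z - w) <= cnorm z + cnorm w.
Proof. by rewrite (le_trans (cnormD _ _))// cnormN. Qed.
Lemma cnormBC z w : cnorm (z - w) = cnorm (w - z).
Proof. by rewrite -cnormN opprB. Qed.
Lemma cnormBD z w : cnorm z <= cnorm w + cnorm (z - w).
Proof. by rewrite -{1}(subrK w z) addrC cnormD. Qed.
Lemma cnormX z n : cnorm (z ^+ n) = cnorm z ^+ n.
Proof. by elim: n => [|n ih]; rewrite ?expr0 ?cnorm1// !exprS cnormM ih. Qed.
Lemma cnorm_real (a : R) : cnorm a%:C = `|a|.
Proof. by rewrite cnormE /csq /= expr0n addr0 sqrtr_sqr. Qed.
Lemma Re_le z : `|Re z| <= cnorm z.
Proof. by rewrite cnormE -sqrtr_sqr ler_sqrt ?csq_ge0// lerDl sqr_ge0. Qed.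
Lemma Im_le z : `|Im z| <= cnorm z.
Proof. by rewrite cnormE -sqrtr_sqr ler_sqrt ?csq_ge0// lerDr sqr_ge0. Qed.
Lemma cnorm_le z : cnorm z <= `|Re z| + `|Im z|.
Proof.
rewrite -(@ler_pXn2r _ 2)// ?nnegrE ?addr_ge0// cnorm_sq /csq sqrrD.
have h1 := real_normK (num_real (Re z)); have h2 := real_normK (num_real (Im z)).
rewrite -h1 -h2.
by have := mulr_ge0 (normr_ge0 (Re z)) (normr_ge0 (Im z)); lra.
Qed.
Lemma mulJ z : z * conjc z = (csq z)%:C.
Proof. by apply: eqC; rewrite !cE /csq/=; ring. Qed.
Lemma csqM z w : csq (z * w) = csq z * csq w.
Proof. by rewrite -!cnorm_sq cnormM exprMn. Qed.
Lemma csqJ z : csq (conjc z) = csq z.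
Proof. by rewrite -!cnorm_sq cnormJ. Qed.
Lemma csqN z : csq (- z) = csq z.
Proof. by rewrite -!cnorm_sq cnormN. Qed.
Lemma csq_eq0 z : csq z = 0 -> z = 0.
Proof. by rewrite -cnorm_sq => /eqP; rewrite sqrf_eq0 => /eqP /cnorm_eq0. Qed.
Lemma cnorm_sum (I : Type) (s : seq I) (F : I -> C) :
  cnorm (\sum_(i <- s) F i) <= \sum_(i <- s) cnorm (F i).
Proof.
elim: s => [|i s ih]; first by rewrite !big_nil cnorm0.
by rewrite !big_cons (le_trans (cnormD _ _))// lerD2l.
Qed.
Lemma csqD_le z w : csq (z + w) <= 2 * csq z + 2 * csq w.
Proof.
rewrite /csq !cE; have := sqr_ge0 (Re z - Re w); have := sqr_ge0 (Im z - Im w).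
by rewrite !sqrrB !sqrrD; lra.
Qed.
(** In each coordinate the difference of the two sides is [e^-1 * (e * a - b) ^+ 2]. The free weight
    [e] makes this a substitute for Minkowski's inequality. *)
Lemma csqD_eps z w (e : R) : 0 < e -> csq (z + w) <= (1 + e) * csq z + (1 + e^-1) * csq w.
Proof.
move=> e0; rewrite /csq !cE.
have h (a b : R) : (a + b) ^+ 2 <= (1 + e) * a ^+ 2 + (1 + e^-1) * b ^+ 2.
  rewrite -subr_ge0.
  have -> : (1 + e) * a ^+ 2 + (1 + e^-1) * b ^+ 2 - (a + b) ^+ 2 = e^-1 * (e * a - b) ^+ 2.
    by field; rewrite gt_eqF.
  by rewrite mulr_ge0 ?sqr_ge0// invr_ge0 ltW.
by have := h (Re z) (Re w); have := h (Im z) (Im w); lra.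
Qed.
(** A weighted substitute for the Cauchy-Schwarz inequality, from the same completed square; the
    constant is not optimal. *)
Lemma cnormM_le z w (e : R) : 0 < e -> cnorm (z * w) <= e * csq z + e^-1 * csq w.
Proof.
move=> e0; rewrite cnormM -!cnorm_sq.
have := cnorm_ge0 z; have := cnorm_ge0 w; set x := cnorm z; set y := cnorm w => y0 x0.
have h : 0 <= e^-1 * (e * x - y) ^+ 2 by rewrite mulr_ge0 ?sqr_ge0// invr_ge0 ltW.
have e1 : e^-1 * (e * x - y) ^+ 2 = e * x ^+ 2 + e^-1 * y ^+ 2 - 2 * (x * y).
  by field; rewrite gt_eqF.
by rewrite e1 in h; have := mulr_ge0 x0 y0; lra.
Qed.

(** * Characters of the circle, and Fourier coefficients as integrals against powers of [zeta] *)

Lemma ee0 : ee (0 : R) = 1. Proof. by rewrite /ee cos0 sin0. Qed.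
Lemma eeD (x y : R) : ee (x + y) = ee x * ee y.
Proof. by apply: eqC; rewrite !cE /= ?cosD ?sinD; ring. Qed.
Lemma eeN (x : R) : ee (- x) = conjc (ee x).
Proof. by apply: eqC; rewrite !cE /= ?cosN ?sinN. Qed.
Lemma csq_ee (x : R) : csq (ee x) = 1. Proof. by rewrite /csq /= cos2Dsin2. Qed.
Lemma cnorm_ee (x : R) : cnorm (ee x) = 1. Proof. by rewrite cnormE csq_ee sqrtr1. Qed.
Lemma ee_conj (x : R) : ee x * conjc (ee x) = 1. Proof. by rewrite mulJ csq_ee. Qed.
Lemma eeX (x : R) n : ee (x *+ n) = ee x ^+ n.
Proof. by elim: n => [|n ih]; rewrite ?mulr0n ?ee0// mulrS exprS eeD ih. Qed.
Lemma ee_neq0 (x : R) : ee x != 0.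
Proof. by apply/eqP => h; have := cnorm_ee x; rewrite h cnorm0 => /eqP; rewrite eq_sym oner_eq0. Qed.
Lemma cnorm_zeta (t : R) : cnorm (zeta t) = 1. Proof. exact: cnorm_ee. Qed.
Lemma zetaJ (t : R) : zeta t * conjc (zeta t) = 1. Proof. exact: ee_conj. Qed.
Lemma fcoef_nat f (n : nat) : fcoef f n%:Z = cint (fun t => f t * conjc (zeta t) ^+ n).
Proof.
rewrite /fcoef; congr cint; apply/funext => t; congr (_ * _).
by rewrite -rmorphXn /= /zeta -eeX -eeN; congr (ee (- _)); rewrite -mulr_natl; ring.
Qed.
Lemma fcoef_neg f (n : nat) : fcoef f (- n%:Z) = cint (fun t => f t * zeta t ^+ n).
Proof.
rewrite /fcoef; congr cint; apply/funext => t; congr (_ * _).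
by rewrite /zeta -eeX; congr ee; rewrite -mulr_natl mulrNz; ring.
Qed.

Lemma cmeasD f g : cmeas f -> cmeas g -> cmeas (fun t => f t + g t).
Proof.
move=> [a b] [c d]; split.
  by apply: (eq_mea _ (meaD a c)) => t _; rewrite cE.
by apply: (eq_mea _ (meaD b d)) => t _; rewrite cE.
Qed.
Lemma cmeasN f : cmeas f -> cmeas (fun t => - f t).
Proof.
move=> [a b]; split.
  by apply: (eq_mea _ (meaN a)) => t _; rewrite cE.
by apply: (eq_mea _ (meaN b)) => t _; rewrite cE.
Qed.
Lemma cmeasB f g : cmeas f -> cmeas g -> cmeas (fun t => f t - g t).
Proof. by move=> hf hg; exact: (cmeasD hf (cmeasN hg)). Qed.
Lemma cmeasM f g : cmeas f -> cmeas g -> cmeas (fun t => f t * g t).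
Proof.
move=> [a b] [c d]; split.
  by apply: (eq_mea _ (meaB (meaM a c) (meaM b d))) => t _; rewrite cE.
by apply: (eq_mea _ (meaD (meaM a d) (meaM b c))) => t _; rewrite cE.
Qed.
Lemma cmeasJ f : cmeas f -> cmeas (fun t => conjc (f t)).
Proof.
move=> [a b]; split.
  by apply: (eq_mea _ a) => t _; rewrite cE.
by apply: (eq_mea _ (meaN b)) => t _; rewrite cE.
Qed.
Lemma cmeas_cst (c : C) : cmeas (fun=> c).
Proof. by split; exact: mea_cst. Qed.
Lemma cmeas_real (u : R -> R) : mea u -> cmeas (fun t => (u t)%:C).
Proof. by split => //; exact: mea_cst. Qed.
Lemma cmeasX f n : cmeas f -> cmeas (fun t => f t ^+ n).
Proof.
move=> mf; elim: n => [|n ih].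
  by rewrite (_ : (fun t => _) = fun=> 1)//; exact: cmeas_cst.
by rewrite (_ : (fun t => _) = fun t => f t * f t ^+ n) => [|]; [exact: cmeasM|apply/funext => t; rewrite exprS].
Qed.
Lemma mea_csq f : cmeas f -> mea (fun t => csq (f t)).
Proof. by move=> [a b]; apply: meaD; exact: meaX. Qed.
Lemma mea_cnorm f : cmeas f -> mea (fun t => cnorm (f t)).
Proof.
by move=> mf; apply: (eq_mea _ (mea_sqrt (mea_csq mf))) => t _; rewrite cnormE.
Qed.
Lemma cmeas_zeta : cmeas (@zeta R).
Proof.
have h : mea (fun t : R => 2 * pi * t) by apply: meaM; [exact: mea_cst|exact: mea_id].
split; rewrite /zeta /=.
  by apply: (mea_cont _ h); exact: continuous_cos.
by apply: (mea_cont _ h); exact: continuous_sin.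
Qed.
Lemma eq_cmeas f g : (forall t, D t -> f t = g t) -> cmeas f -> cmeas g.
Proof.
by move=> fg [a b]; split; [apply: eq_mea a|apply: eq_mea b] => t Dt; rewrite fg.
Qed.
Lemma cmeasV f : (forall t, D t -> f t != 0) -> cmeas f -> cmeas (fun t => (f t)^-1).
Proof.
move=> f0 mf.
have h : mea (fun t => (csq (f t))^-1).
  apply: mea_inv (mea_csq mf) => t Dt; rewrite lt_def csq_ge0 andbT.
  by apply: contra_neq (f0 _ Dt) => /csq_eq0.
apply: (eq_cmeas _ (cmeasM (cmeasJ mf) (cmeas_real h))) => t Dt.
apply: (mulfI (f0 _ Dt)); rewrite mulrA mulJ divff ?f0// -cplxM divff//.
by apply: contra_neq (f0 _ Dt) => /csq_eq0.
Qed.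

Definition cL1 f : Prop := cmeas f /\ integr (fun t => cnorm (f t)).

Lemma cL1_Re f : cL1 f -> integr (fun t => Re (f t)).
Proof. by move=> [[a b] c]; apply: (integr_le _ c) => // t _; exact: Re_le. Qed.
Lemma cL1_Im f : cL1 f -> integr (fun t => Im (f t)).
Proof. by move=> [[a b] c]; apply: (integr_le _ c) => // t _; exact: Im_le. Qed.
Lemma cL1_le f (u : R -> R) : cmeas f -> integr u -> (forall t, D t -> cnorm (f t) <= u t) -> cL1 f.
Proof.
move=> mf iu fu; split => //; apply: (integr_le _ iu); first exact: mea_cnorm.
by move=> t Dt; rewrite ger0_norm// fu.
Qed.
Lemma cL1_real (u : R -> R) : integr u -> cL1 (fun t => (u t)%:C).
Proof.
move=> iu; apply: (cL1_le _ (integr_abs iu)); first by apply: cmeas_real; exact: mea_integr.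
by move=> t _; rewrite cnorm_real.
Qed.
Lemma cL1_bdd f M : cmeas f -> (forall t, D t -> cnorm (f t) <= M) -> cL1 f.
Proof. by move=> mf; apply: cL1_le => //; exact: integr_cst. Qed.
Lemma cL1_cst (c : C) : cL1 (fun=> c).
Proof. by apply: (@cL1_bdd _ (cnorm c)) => //; exact: cmeas_cst. Qed.
Lemma cL1D f g : cL1 f -> cL1 g -> cL1 (fun t => f t + g t).
Proof.
move=> [a b] [c d]; apply: (cL1_le _ (integrD b d)); first exact: cmeasD.
by move=> t _; exact: cnormD.
Qed.
Lemma cL1N f : cL1 f -> cL1 (fun t => - f t).
Proof. by move=> [a b]; apply: (cL1_le _ b) => [|t _]; [exact: cmeasN|rewrite cnormN]. Qed.
Lemma cL1B f g : cL1 f -> cL1 g -> cL1 (fun t => f t - g t).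
Proof. by move=> hf hg; exact: (cL1D hf (cL1N hg)). Qed.
Lemma cL1J f : cL1 f -> cL1 (fun t => conjc (f t)).
Proof. by move=> [a b]; apply: (cL1_le _ b) => [|t _]; [exact: cmeasJ|rewrite cnormJ]. Qed.
Lemma cL1Mb f g M : cmeas f -> (forall t, D t -> cnorm (f t) <= M) -> cL1 g ->
  cL1 (fun t => f t * g t).
Proof.
move=> mf fM [a b]; apply: (cL1_le _ (integrZ M b)); first exact: cmeasM.
by move=> t Dt; rewrite cnormM ler_wpM2r// fM.
Qed.
Lemma cL1Z c f : cL1 f -> cL1 (fun t => c * f t).
Proof. by apply: (@cL1Mb _ _ (cnorm c)) => //; exact: cmeas_cst. Qed.
Lemma eq_cL1 f g : (forall t, D t -> f t = g t) -> cL1 f -> cL1 g.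
Proof.
move=> fg [a b]; split; first exact: eq_cmeas a.
by apply: eq_integr b => t Dt; rewrite fg.
Qed.
Lemma cL1_sum (I : Type) (s : seq I) (F : I -> R -> C) : (forall i, cL1 (F i)) ->
  cL1 (fun t => \sum_(i <- s) F i t).
Proof.
move=> iF; elim: s => [|i s ih].
  by apply: eq_cL1 (cL1_cst 0) => t _; rewrite big_nil.
by apply: eq_cL1 (cL1D (iF i) ih) => t _; rewrite big_cons.
Qed.

Lemma eq_cint f g : (forall t, D t -> f t = g t) -> cint f = cint g.
Proof. by move=> fg; apply: eqC; apply: eq_ri => t Dt; rewrite fg. Qed.
Lemma cintD f g : cL1 f -> cL1 g -> cint (fun t => f t + g t) = cint f + cint g.
Proof.
move=> hf hg; apply: eqC; rewrite cE /=.
  rewrite -!/(ri _) -riD; try exact: cL1_Re.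
  by apply: eq_ri => t _; rewrite cE.
rewrite -!/(ri _) -riD; try exact: cL1_Im.
by apply: eq_ri => t _; rewrite cE.
Qed.
Lemma cintZ c f : cL1 f -> cint (fun t => c * f t) = c * cint f.
Proof.
move=> hf; have hr := cL1_Re hf; have hi := cL1_Im hf; apply: eqC; rewrite cE /=.
  rewrite -!/(ri _) -!riZ// -riB//; try exact: integrZ.
  by apply: eq_ri => t _; rewrite cE.
rewrite -!/(ri _) -!riZ// -riD//; try exact: integrZ.
by apply: eq_ri => t _; rewrite cE.
Qed.
Lemma cintN f : cL1 f -> cint (fun t => - f t) = - cint f.
Proof.
by move=> hf; rewrite -mulN1r -cintZ//; apply: eq_cint => t _; rewrite mulN1r.
Qed.
Lemma cintB f g : cL1 f -> cL1 g -> cint (fun t => f t - g t) = cint f - cint g.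
Proof. by move=> hf hg; rewrite (cintD hf (cL1N hg)) cintN. Qed.
Lemma cintJ f : cL1 f -> cint (fun t => conjc (f t)) = conjc (cint f).
Proof.
move=> hf; have hr := cL1_Re hf; have hi := cL1_Im hf; apply: eqC; rewrite cE /=.
  by apply: eq_ri => t _; rewrite cE.
by rewrite -!/(ri _) -riN//; apply: eq_ri => t _; rewrite cE.
Qed.
Lemma cint_cst (c : C) : cint (fun=> c) = c.
Proof. by apply: eqC; rewrite /= -/(ri _) ri_cst. Qed.
Lemma cint_real (u : R -> R) : cint (fun t => (u t)%:C) = (ri u)%:C.
Proof. by apply: eqC => //=; rewrite -/(ri _) ri_cst. Qed.
Lemma cint_sum (I : Type) (s : seq I) (F : I -> R -> C) : (forall i, cL1 (F i)) ->
  cint (fun t => \sum_(i <- s) F i t) = \sum_(i <- s) cint (F i).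
Proof.
move=> iF; elim: s => [|i s ih].
  by rewrite big_nil -[RHS](cint_cst 0); apply: eq_cint => t _; rewrite big_nil.
rewrite big_cons -ih -cintD//; last exact: cL1_sum.
by apply: eq_cint => t _; rewrite big_cons.
Qed.
(** With [w] the integral, [csq w] is the integral of the real part of [conjc w * f], hence at most
    [cnorm w] times the integral of [cnorm f]; it remains to cancel [cnorm w]. *)
Lemma cint_norm f : cL1 f -> cnorm (cint f) <= ri (fun t => cnorm (f t)).
Proof.
move=> hf; have [w ew] : exists w, cint f = w by exists (cint f).
rewrite ew; have [->|w0] := eqVneq w 0; first by rewrite cnorm0; exact: ri_ge0.
have c0 := cnorm_gt0 w0.
rewrite -(ler_pM2l c0) -expr2 cnorm_sq.
have -> : csq w = ri (fun t => Re (conjc w * f t)).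
  rewrite -[RHS]/(Re (cint (fun t => conjc w * f t))).
  by rewrite cintZ// ew mulrC mulJ.
rewrite -riZ; last exact: hf.2.
apply: ri_le.
- by apply: cL1_Re; exact: cL1Z.
- by apply: integrZ; exact: hf.2.
- move=> t _; rewrite (le_trans (ler_norm _))// (le_trans (Re_le _))//.
  by rewrite cnormM cnormJ.
Qed.
Lemma ae_cint f g : cmeas f -> cmeas g -> {ae mu, forall t, D t -> f t = g t} -> cint f = cint g.
Proof.
move=> [a b] [c d] fg.
by apply: eqC; apply: ae_ri => //; apply: ae1 fg => t _ ->.
Qed.

(** * The space L^2 and its squared norm *)

Lemma inL2P f : inL2 f <-> cmeas f /\ integr (fun t => csq (f t)).
Proof.
split => [[mf h]|[mf h]]; split => //.
  apply: integr_lty => //; first exact: mea_csq.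
  by under eq_fun do rewrite -cnorm_sq.
under eq_fun do rewrite cnorm_sq.
by rewrite -(ri_EFin h) ltry.
Qed.

Definition nsq f : R := ri (fun t => csq (f t)).

Lemma L2_cmeas f : inL2 f -> cmeas f. Proof. by case. Qed.
Lemma L2_csq f : inL2 f -> integr (fun t => csq (f t)). Proof. by case/inL2P. Qed.
Lemma nsq_ge0 f : 0 <= nsq f. Proof. exact: ri_ge0. Qed.
Lemma L2_le f (u : R -> R) : cmeas f -> integr u -> (forall t, D t -> csq (f t) <= u t) -> inL2 f.
Proof.
move=> mf iu fu; apply/inL2P; split => //; apply: (integr_le _ iu); first exact: mea_csq.
by move=> t Dt; rewrite ger0_norm// fu.
Qed.
Lemma L2_le_ae f (u : R -> R) : cmeas f -> integr u ->
  {ae mu, forall t, D t -> csq (f t) <= u t} -> inL2 f.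
Proof.
move=> mf iu fu; apply/inL2P; split => //; apply: (integr_le_ae _ iu); first exact: mea_csq.
by apply: ae1 fu => t Dt; rewrite ger0_norm.
Qed.
Lemma eq_L2 f g : (forall t, D t -> f t = g t) -> inL2 f -> inL2 g.
Proof.
move=> fg /inL2P[a b]; apply/inL2P; split; first exact: eq_cmeas a.
by apply: eq_integr b => t Dt; rewrite fg.
Qed.
Lemma L2_bdd f M : cmeas f -> (forall t, D t -> csq (f t) <= M) -> inL2 f.
Proof. by move=> mf; apply: L2_le => //; exact: integr_cst. Qed.
Lemma L2_cst (c : C) : inL2 (fun=> c).
Proof. by apply: (@L2_bdd _ (csq c)) => //; exact: cmeas_cst. Qed.
Lemma L2D f g : inL2 f -> inL2 g -> inL2 (fun t => f t + g t).
Proof.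
move=> hf hg; apply: (L2_le _ (integrD (integrZ 2 (L2_csq hf)) (integrZ 2 (L2_csq hg)))).
  by apply: cmeasD; exact: L2_cmeas.
by move=> t _; exact: csqD_le.
Qed.
Lemma L2N f : inL2 f -> inL2 (fun t => - f t).
Proof.
move=> hf; apply: (L2_le _ (L2_csq hf)); first by apply: cmeasN; exact: L2_cmeas.
by move=> t _; rewrite csqN.
Qed.
Lemma L2B f g : inL2 f -> inL2 g -> inL2 (fun t => f t - g t).
Proof. by move=> hf hg; exact: (L2D hf (L2N hg)). Qed.
Lemma L2J f : inL2 f -> inL2 (fun t => conjc (f t)).
Proof.
move=> hf; apply: (L2_le _ (L2_csq hf)); first by apply: cmeasJ; exact: L2_cmeas.
by move=> t _; rewrite csqJ.
Qed.
Lemma L2Mb f g M : cmeas f -> {ae mu, forall t, D t -> cnorm (f t) <= M} -> inL2 g ->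
  inL2 (fun t => f t * g t).
Proof.
move=> mf fM hg; apply: (L2_le_ae _ (integrZ (M ^+ 2) (L2_csq hg))).
  by apply: cmeasM => //; exact: L2_cmeas.
apply: ae1 fM => t _ fM; rewrite csqM ler_wpM2r// -cnorm_sq ler_pXn2r// nnegrE//.
exact: le_trans fM.
Qed.
Lemma L2Z c f : inL2 f -> inL2 (fun t => c * f t).
Proof. by apply: (@L2Mb _ _ (cnorm c)); [exact: cmeas_cst|exact: aeW]. Qed.
Lemma L2_sum (I : Type) (s : seq I) (F : I -> R -> C) : (forall i, inL2 (F i)) ->
  inL2 (fun t => \sum_(i <- s) F i t).
Proof.
move=> iF; elim: s => [|i s ih].
  by apply: eq_L2 (L2_cst 0) => t _; rewrite big_nil.
by apply: eq_L2 (L2D (iF i) ih) => t _; rewrite big_cons.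
Qed.
Lemma L2M_L1 f g : inL2 f -> inL2 g -> cL1 (fun t => f t * g t).
Proof.
move=> hf hg; apply: (cL1_le _ (integrD (integrZ 1 (L2_csq hf)) (integrZ 1^-1 (L2_csq hg)))).
  by apply: cmeasM; exact: L2_cmeas.
by move=> t _; exact: cnormM_le.
Qed.
Lemma L2_L1 f : inL2 f -> cL1 f.
Proof. by move=> hf; apply: eq_cL1 (L2M_L1 hf (L2_cst 1)) => t _; rewrite mulr1. Qed.
Lemma ri_cnormM_le f g e : 0 < e -> inL2 f -> inL2 g ->
  ri (fun t => cnorm (f t * g t)) <= e * nsq f + e^-1 * nsq g.
Proof.
move=> e0 hf hg; rewrite /nsq -!riZ; try exact: L2_csq.
rewrite -riD; try by apply: integrZ; exact: L2_csq.
apply: ri_le.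
- exact: (L2M_L1 hf hg).2.
- by apply: integrD; apply: integrZ; exact: L2_csq.
- by move=> t _; exact: cnormM_le.
Qed.
Lemma nsqD_eps f g e : 0 < e -> inL2 f -> inL2 g ->
  nsq (fun t => f t + g t) <= (1 + e) * nsq f + (1 + e^-1) * nsq g.
Proof.
move=> e0 hf hg; rewrite /nsq -!riZ; try exact: L2_csq.
rewrite -riD; try by apply: integrZ; exact: L2_csq.
apply: ri_le.
- exact: (L2_csq (L2D hf hg)).
- by apply: integrD; apply: integrZ; exact: L2_csq.
- by move=> t _; exact: csqD_eps.
Qed.
Lemma nsqD_le f g : inL2 f -> inL2 g -> nsq (fun t => f t + g t) <= 2 * nsq f + 2 * nsq g.
Proof. by move=> hf hg; have := nsqD_eps ltr01 hf hg; rewrite invr1. Qed.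
Lemma nsqN f : nsq (fun t => - f t) = nsq f.
Proof. by apply: eq_ri => t _; rewrite csqN. Qed.
Lemma eq_nsq f g : (forall t, D t -> f t = g t) -> nsq f = nsq g.
Proof. by move=> fg; apply: eq_ri => t Dt; rewrite fg. Qed.
Lemma nsqB_le f g : inL2 f -> inL2 g -> nsq (fun t => f t - g t) <= 2 * nsq f + 2 * nsq g.
Proof. by move=> hf hg; have := nsqD_le hf (L2N hg); rewrite nsqN. Qed.
Lemma nsq_eq0 f : inL2 f -> nsq f <= 0 -> aezero f.
Proof.
move=> hf h; have := ri_eq0 (L2_csq hf) _ h.
move=> /(_ (aeW _)) => /(_ (fun t _ => csq_ge0 (f t))).
by apply: ae1 => t _ /csq_eq0.
Qed.
Lemma L2_zeta n f : inL2 f -> inL2 (fun t => f t * zeta t ^+ n).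
Proof.
move=> hf; have h : forall t, cnorm (zeta t ^+ n : C) = 1.
  by move=> t; rewrite cnormX cnorm_zeta expr1n.
apply: eq_L2 (L2Mb (M := 1) (cmeasX n cmeas_zeta) (aeW _) hf).
  by move=> t _; rewrite mulrC.
by move=> t _; rewrite h.
Qed.

End ComplexIntegral.
#[global] Hint Resolve cnorm_ge0 csq_ge0 : core.
#[global] Hint Extern 0 (is_true (0 <= cnorm _)) => exact: cnorm_ge0 : core.
#[global] Hint Extern 0 (is_true (0 <= csq _)) => exact: csq_ge0 : core.

(** * Holomorphic functions on the disc *)

Section Analytic.
Variable R : realType.
Local Notation C := R[i].
Implicit Types (f g h : R -> C) (z w : C).

Local Notation mu := (@leb R).
Local Notation D := (@I01 R).

Lemma cnorm_small z (K : R) : (forall e : R, 0 < e -> cnorm z <= K * e) -> z = 0.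
Proof.
move=> h; apply: cnorm_eq0; apply/eqP; rewrite eq_le cnorm_ge0 andbT.
apply/ler_addgt0Pr => e e0; rewrite add0r.
have K1 : 0 < `|K| + 1 by rewrite ltr_wpDl.
apply: le_trans (h (e / (`|K| + 1)) _) _; first by rewrite divr_gt0.
rewrite mulrA ler_pdivrMr// [K * e]mulrC ler_pM2l//.
by rewrite (le_trans (ler_norm _))// lerDl.
Qed.

(** Fundamental theorem of calculus: with [c = 2 pi n], the antiderivatives [c^-1 * sin (c * t)] and
    [- c^-1 * cos (c * t)] take equal values at 0 and 1. *)
Lemma ri_sin_cos (n : nat) : (0 < n)%N ->
  ri (fun t : R => cos (2 * pi * t *+ n)) = 0 /\ ri (fun t : R => sin (2 * pi * t *+ n)) = 0.
Proof.
move=> n0; pose c : R := 2 * pi *+ n.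
have c0 : c != 0 by rewrite /c mulrn_eq0 negb_or -lt0n n0/= mulf_neq0// gt_eqF// pi_gt0.
have ec (t : R) : 2 * pi * t *+ n = c * t by rewrite /c [RHS]mulrnAl.
have dc (t : R) : is_derive t 1 (fun t : R => c * t) c.
  by apply: is_derive_eq; rewrite [_ *: _]mulr1.
have contc : continuous (fun t : R => c * t) by exact: mulrl_continuous.
have sc : sin c = 0 /\ cos c = 1.
  rewrite /c; elim: (n) => [|m [ih1 ih2]]; first by rewrite mulr0n sin0 cos0.
  by rewrite mulrS sinD cosD ih1 ih2 mulr_natl sin2pi cos2pi !mulr0 !mulr1 addr0 subr0.
clearbody c.
split.
  pose F := fun t : R => c^-1 * sin (c * t).
  have dF (t : R) : is_derive t 1 F (cos (c * t)).
    apply: is_derive_eq; rewrite /GRing.scale/=.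
    by field.
  rewrite /ri /Rintegral.
  rewrite (@eq_integral _ _ _ mu D (fun t => (cos (c * t))%:E)); last by move=> t _; rewrite ec.
  rewrite (@continuous_FTC2 _ _ F)//=.
  - by rewrite /F mulr1 mulr0 sin0 sc.1 mulr0 subrr.
  - apply: continuous_subspaceT => t; apply: continuous_comp; first exact: contc.
    exact: continuous_cos.
  - have cF : continuous F.
      by move=> t; apply/differentiable_continuous/derivable1_diffP; exact: ex_derive.
    split.
    + by move=> t _; exact: ex_derive.
    + exact/cvg_at_right_filter/cF.
    + exact/cvg_at_left_filter/cF.
  - by move=> t _; rewrite derive1E; apply: derive_val.
pose F := fun t : R => - c^-1 * cos (c * t).
have dF (t : R) : is_derive t 1 F (sin (c * t)).
  apply: is_derive_eq; rewrite /GRing.scale/=.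
  by field.
rewrite /ri /Rintegral.
rewrite (@eq_integral _ _ _ mu D (fun t => (sin (c * t))%:E)); last by move=> t _; rewrite ec.
rewrite (@continuous_FTC2 _ _ F)//=.
- by rewrite /F mulr1 mulr0 cos0 sc.2 subrr.
- apply: continuous_subspaceT => t; apply: continuous_comp; first exact: contc.
  exact: continuous_sin.
- have cF : continuous F.
    by move=> t; apply/differentiable_continuous/derivable1_diffP; exact: ex_derive.
  split.
  + by move=> t _; exact: ex_derive.
  + exact/cvg_at_right_filter/cF.
  + exact/cvg_at_left_filter/cF.
- by move=> t _; rewrite derive1E; apply: derive_val.
Qed.

Lemma cint_zeta (n : nat) : cint (fun t : R => zeta t ^+ n) = (n == 0%N)%:R.
Proof.
case: n => [|n].
  by rewrite eqxx -[RHS](cint_cst 1); apply: eq_cint => t _; rewrite expr0.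
have [h1 h2] := ri_sin_cos (ltn0Sn n).
have -> : cint (fun t : R => zeta t ^+ n.+1) = Complex (ri (fun t : R => cos (2 * pi * t *+ n.+1)))
    (ri (fun t : R => sin (2 * pi * t *+ n.+1))).
  apply: eqC; apply: eq_ri => t _; by rewrite /zeta -eeX.
by rewrite h1 h2.
Qed.

Lemma zetaMJ (t : R) (i n : nat) : zeta t ^+ i * conjc (zeta t) ^+ n =
  if (n <= i)%N then zeta t ^+ (i - n) else conjc (zeta t) ^+ (n - i).
Proof.
case: leqP => h.
  by rewrite -{1}(subnK h) exprD -mulrA -exprMn zetaJ expr1n mulr1.
by rewrite -[in LHS](subnK (ltnW h)) exprD mulrCA -exprMn zetaJ expr1n mulr1.
Qed.

Lemma cnorm_zetaX (t : R) n : cnorm (zeta t ^+ n) = 1.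
Proof. by rewrite cnormX cnorm_zeta expr1n. Qed.
Lemma cnorm_zetaJX (t : R) n : cnorm (conjc (zeta t) ^+ n) = 1.
Proof. by rewrite cnormX cnormJ cnorm_zeta expr1n. Qed.
Lemma cmeas_zetaX n : cmeas (fun t : R => zeta t ^+ n).
Proof. by apply: cmeasX; exact: cmeas_zeta. Qed.
Lemma cmeas_zetaJX n : cmeas (fun t : R => conjc (zeta t) ^+ n).
Proof. by apply: cmeasX; apply: cmeasJ; exact: cmeas_zeta. Qed.

Lemma cL1_zeta n : cL1 (fun t : R => zeta t ^+ n).
Proof. by apply: (@cL1_bdd _ _ 1) => [|t _]; [exact: cmeas_zetaX|rewrite cnorm_zetaX]. Qed.

Lemma cint_zetaMJ (i n : nat) :
  cint (fun t : R => zeta t ^+ i * conjc (zeta t) ^+ n) = (i == n)%:R.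
Proof.
rewrite (eq_cint (fun t _ => zetaMJ t i n)); case: leqP => h.
  by rewrite cint_zeta subn_eq0 eqn_leq h andbT.
rewrite -(eq_cint (f := fun t => conjc (zeta t ^+ (n - i)))); last first.
  by move=> t _; rewrite rmorphXn.
rewrite cintJ; last exact: cL1_zeta.
rewrite cint_zeta subn_eq0 leqNgt h (ltn_eqF h).
exact: conjc0.
Qed.

Lemma cL1MX f n : cL1 f -> cL1 (fun t => f t * zeta t ^+ n).
Proof.
move=> hf; apply: (eq_cL1 (f := fun t => zeta t ^+ n * f t)) => [t _|]; first by rewrite mulrC.
by apply: (@cL1Mb _ _ _ 1) => // [|t _]; [exact: cmeas_zetaX|rewrite cnorm_zetaX].
Qed.
Lemma cL1MJX f n : cL1 f -> cL1 (fun t => f t * conjc (zeta t) ^+ n).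
Proof.
move=> hf; apply: (eq_cL1 (f := fun t => conjc (zeta t) ^+ n * f t)) => [t _|]; first by rewrite mulrC.
by apply: (@cL1Mb _ _ _ 1) => // [|t _]; [exact: cmeas_zetaJX|rewrite cnorm_zetaJX].
Qed.

Definition circ (F : C -> C) (r : R) : R -> C := fun t => F (r%:C * zeta t).

Lemma circ_poly (q : {poly C}) r t :
  circ (horner q) r t = \sum_(i < size q) (q`_i * r%:C ^+ i) * zeta t ^+ i.
Proof. by rewrite /circ horner_coef; apply: eq_bigr => i _; rewrite exprMn mulrA. Qed.

Lemma cL1_poly (q : {poly C}) r : cL1 (circ (horner q) r).
Proof.
apply: eq_cL1 (cL1_sum _ _); first by move=> t _; rewrite circ_poly; reflexivity.
by move=> i; apply: cL1Z; exact: cL1_zeta.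
Qed.

Lemma poly_coef (q : {poly C}) r n :
  cint (fun t => circ (horner q) r t * conjc (zeta t) ^+ n) = q`_n * r%:C ^+ n.
Proof.
transitivity (\sum_(i < size q) (q`_i * r%:C ^+ i) * (i == n :> nat)%:R).
  rewrite (eq_cint (g := fun t => \sum_(i < size q) (q`_i * r%:C ^+ i) * (zeta t ^+ i * conjc (zeta t) ^+ n))).
    rewrite cint_sum; last by move=> i; apply: cL1Z; apply: cL1MJX; exact: cL1_zeta.
    apply: eq_bigr => i _; rewrite cintZ ?cint_zetaMJ//.
    by apply: cL1MJX; exact: cL1_zeta.
  move=> t _; rewrite circ_poly mulr_suml; apply: eq_bigr => i _; by rewrite mulrA.
case: (ltnP n (size q)) => h.
  rewrite (bigD1 (Ordinal h))//= eqxx mulr1 big1 ?addr0// => i.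
  by rewrite -val_eqE /= => /negbTE ->; rewrite mulr0.
rewrite (nth_default _ h) mul0r big1// => i _.
by rewrite ltn_eqF ?mulr0// (leq_trans (ltn_ord i)).
Qed.

Lemma poly_neg (q : {poly C}) r n : (0 < n)%N ->
  cint (fun t => circ (horner q) r t * zeta t ^+ n) = 0.
Proof.
move=> n0.
rewrite (eq_cint (g := fun t => \sum_(i < size q) (q`_i * r%:C ^+ i) * (zeta t ^+ (i + n)))).
  rewrite cint_sum; last by move=> i; apply: cL1Z; exact: cL1_zeta.
  apply: big1 => i _; rewrite cintZ; last exact: cL1_zeta.
  by rewrite cint_zeta addn_eq0 (gtn_eqF n0) andbF mulr0.
by move=> t _; rewrite circ_poly mulr_suml; apply: eq_bigr => i _; rewrite exprD mulrA.
Qed.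

(* The holomorphic functions on the unit disc, as locally uniform limits of polynomials. *)
Definition inA (F : C -> C) : Prop := forall rho : R, 0 <= rho -> rho < 1 ->
  forall e : R, 0 < e -> exists q : {poly C},
    forall z, cnorm z <= rho -> cnorm (F z - q.[z]) <= e.

Lemma poly_bdd (q : {poly C}) z : cnorm z <= 1 -> cnorm q.[z] <= \sum_(i < size q) cnorm q`_i.
Proof.
move=> z1; rewrite horner_coef (le_trans (cnorm_sum _ _))// ler_sum// => i _.
by rewrite cnormM cnormX ler_piMr// exprn_ile1.
Qed.

Lemma inA_bdd F (rho : R) : inA F -> 0 <= rho -> rho < 1 ->
  exists2 M : R, 0 < M & forall z, cnorm z <= rho -> cnorm (F z) <= M.
Proof.
move=> hF r0 r1; have [q hq] := hF _ r0 r1 _ ltr01.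
exists (1 + \sum_(i < size q) cnorm q`_i).
  by rewrite ltr_wpDr// sumr_ge0.
move=> z hz; rewrite -[F z](subrK q.[z]) (le_trans (cnormD _ _))// lerD ?hq//.
by rewrite poly_bdd// (le_trans hz)// ltW.
Qed.

Lemma cnorm_circ (r t : R) : 0 <= r -> cnorm (r%:C * zeta t) = r.
Proof. by move=> r0; rewrite cnormM cnorm_zeta mulr1 cnorm_real ger0_norm. Qed.

(** Approximation within [1 / (n + 1)] on the disc of radius [r] exhibits the trace on the circle as
    a pointwise limit of trigonometric polynomials. *)
Lemma inA_meas F r : inA F -> 0 <= r -> r < 1 -> cmeas (circ F r).
Proof.
move=> hF r0 r1.
have /choice[q hq] : forall n, exists q : {poly C}, forall z, cnorm z <= r ->
    cnorm (F z - q.[z]) <= n.+1%:R^-1.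
  by move=> n; apply: hF => //; rewrite invr_gt0.
have cv (k : C -> R) : (forall x y, k (x - y) = k x - k y) -> (forall x, `|k x| <= cnorm x) ->
    forall t, (fun n => k (circ (horner (q n)) r t)) @ \oo --> k (circ F r t).
  move=> kB kle t; apply/cvgrPdist_le => e e0.
  near=> n; rewrite -kB (le_trans (kle _))// (le_trans (hq n _ _))//.
    by rewrite cnorm_circ.
  by rewrite ltW//; near: n; exact: near_infty_natSinv_lt (PosNum e0).
have mq n := (cL1_poly (q n) r).1.
split.
  apply: (measurable_fun_cvg (h := fun n t => Re (circ (horner (q n)) r t))).
    by move=> n; have [] := mq n.
  by move=> t _; apply: cv => [x y|x]; [rewrite !cE|exact: Re_le].
apply: (measurable_fun_cvg (h := fun n t => Im (circ (horner (q n)) r t))).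
  by move=> n; have [] := mq n.
by move=> t _; apply: cv => [x y|x]; [rewrite !cE|exact: Im_le].
Unshelve. all: by end_near. Qed.

Lemma inA_L1 F r : inA F -> 0 <= r -> r < 1 -> cL1 (circ F r).
Proof.
move=> hF r0 r1; have [M M0 hM] := inA_bdd hF r0 r1.
by apply: (@cL1_bdd _ _ M) => [|t _]; [exact: inA_meas|apply: hM; rewrite cnorm_circ].
Qed.

Lemma inA_L2 F r : inA F -> 0 <= r -> r < 1 -> inL2 (circ F r).
Proof.
move=> hF r0 r1; have [M M0 hM] := inA_bdd hF r0 r1.
apply: (@L2_bdd _ _ (M ^+ 2)) => [|t _]; first exact: inA_meas.
have h : cnorm (circ F r t) <= M by apply: hM; rewrite cnorm_circ.
by rewrite -cnorm_sq ler_pXn2r ?nnegrE ?(ltW M0).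
Qed.

Lemma inA_poly (q : {poly C}) : inA (horner q).
Proof. by move=> rho _ _ e e0; exists q => z _; rewrite subrr cnorm0 ltW. Qed.

Lemma inA_cst c : inA (fun=> c).
Proof. by move=> rho _ _ e e0; exists c%:P => z _; rewrite hornerC subrr cnorm0 ltW. Qed.

Lemma inAD F G : inA F -> inA G -> inA (fun z => F z + G z).
Proof.
move=> hF hG rho r0 r1 e e0; have e2 : 0 < e / 2 by rewrite divr_gt0.
have [p hp] := hF _ r0 r1 _ e2; have [q hq] := hG _ r0 r1 _ e2.
exists (p + q) => z hz; rewrite hornerD.
rewrite (_ : _ - _ = (F z - p.[z]) + (G z - q.[z])); last by ring.
by rewrite (le_trans (cnormD _ _))// (splitr e) lerD ?hp ?hq.
Qed.

Lemma inAM F G : inA F -> inA G -> inA (fun z => F z * G z).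
Proof.
move=> hF hG rho r0 r1 e e0.
have [M M0 hM] := inA_bdd hF r0 r1.
pose e3 := e / (2 * M).
have e30 : 0 < e3 by rewrite divr_gt0// mulr_gt0.
(* [q] is chosen before [p], because the accuracy required of [p] depends on the bound [K] of [q] on
   the unit disc; [K + 1] keeps the divisor positive. *)
have [q hq] := hG _ r0 r1 _ e30.
pose K := \sum_(i < size q) cnorm q`_i.
have K0 : 0 <= K by rewrite sumr_ge0.
have e40 : 0 < e / (2 * (K + 1)) by rewrite divr_gt0// mulr_gt0// ltr_wpDl.
have [p hp] := hF _ r0 r1 _ e40.
exists (p * q) => z hz; rewrite hornerM.
rewrite (_ : _ - _ = F z * (G z - q.[z]) + (F z - p.[z]) * q.[z]); last by ring.
rewrite (le_trans (cnormD _ _))// (splitr e) !cnormM lerD//.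
  rewrite (le_trans (ler_pM _ _ (hM _ hz) (hq _ hz)))// /e3.
  by rewrite (_ : M * _ = e / 2)//; field; rewrite gt_eqF.
have z1 : cnorm z <= 1 by rewrite (le_trans hz)// ltW.
rewrite (le_trans (ler_pM _ _ (hp _ hz) (poly_bdd q z1)))// -/K.
rewrite (@le_trans _ _ (e / (2 * (K + 1)) * (K + 1)))//.
  by rewrite ler_wpM2l ?lerDl// ltW.
by rewrite (_ : _ * _ = e / 2)//; field; rewrite gt_eqF// ltr_wpDl.
Qed.

Lemma inAZ c F : inA F -> inA (fun z => c * F z).
Proof. exact/inAM/inA_cst. Qed.
Lemma inAX F n : inA F -> inA (fun z => F z ^+ n).
Proof.
move=> hF; elim: n => [|n ih].
  by rewrite (_ : (fun=> _) = fun=> 1)//; exact: inA_cst.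
rewrite (_ : (fun z => _) = fun z => F z * F z ^+ n); first exact: inAM.
by apply/funext => z; rewrite exprS.
Qed.
Lemma inA_lim F : (forall rho : R, 0 <= rho -> rho < 1 -> forall e : R, 0 < e ->
  exists2 G, inA G & forall z, cnorm z <= rho -> cnorm (F z - G z) <= e) -> inA F.
Proof.
move=> h rho r0 r1 e e0; have e2 : 0 < e / 2 by rewrite divr_gt0.
have [G hG FG] := h _ r0 r1 _ e2; have [q hq] := hG _ r0 r1 _ e2.
exists q => z hz; rewrite (_ : _ - _ = (F z - G z) + (G z - q.[z])); last by ring.
by rewrite (le_trans (cnormD _ _))// (splitr e) lerD ?FG ?hq.
Qed.
Lemma eq_inA F G : (forall z, cnorm z < 1 -> F z = G z) -> inA F -> inA G.
Proof.
move=> FG hF rho r0 r1 e e0; have [q hq] := hF _ r0 r1 _ e0.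
by exists q => z hz; rewrite -FG ?hq// (le_lt_trans hz).
Qed.

(* The n-th Taylor coefficient of F, read off on the circle of radius 1/2. *)
Definition tc (F : C -> C) (n : nat) : C :=
  2%:C ^+ n * cint (fun t => circ F (2^-1) t * conjc (zeta t) ^+ n).

Lemma half01 : 0 <= (2^-1 : R) /\ (2^-1 : R) < 1. Proof. by split; lra. Qed.

Lemma coef_approx F (q : {poly C}) (r e : R) n : inA F -> 0 <= r -> r < 1 ->
  (forall z, cnorm z <= r -> cnorm (F z - q.[z]) <= e) ->
  cnorm (cint (fun t => circ F r t * conjc (zeta t) ^+ n) - q`_n * r%:C ^+ n) <= e.
Proof.
move=> hF r0 r1 hq; rewrite -poly_coef -cintB; try by apply: cL1MJX; [exact: inA_L1|exact: cL1_poly].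
- have hL : cL1 (fun t => circ F r t * conjc (zeta t) ^+ n - circ (horner q) r t * conjc (zeta t) ^+ n).
    by apply: cL1B; apply: cL1MJX; [exact: inA_L1|exact: cL1_poly].
  apply: le_trans (cint_norm hL) _; rewrite -[leRHS]ri_cst; apply: ri_le.
  + exact: hL.2.
  + exact: integr_cst.
  + by move=> t _; rewrite -mulrBl cnormM cnorm_zetaJX mulr1 hq// cnorm_circ.
- by apply: cL1MJX; exact: inA_L1.
- by apply: cL1MJX; exact: cL1_poly.
Qed.

Lemma tc_approx F (q : {poly C}) (e : R) n : inA F ->
  (forall z, cnorm z <= 2^-1 -> cnorm (F z - q.[z]) <= e) ->
  cnorm (tc F n - q`_n) <= 2 ^+ n * e.
Proof.
move=> hF hq; have [h0 h1] := half01; have := coef_approx n hF h0 h1 hq.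
have e1 : 2%:C ^+ n * (2^-1)%:C ^+ n = 1 :> C.
  by rewrite -exprMn -cplxM divff// expr1n.
rewrite /tc; set a := cint _ => h.
rewrite (_ : _ - _ = 2%:C ^+ n * (a - q`_n * (2^-1)%:C ^+ n)).
  by rewrite cnormM cnormX cnorm_real ger0_norm// ler_wpM2l// exprn_ge0.
by rewrite mulrBr mulrCA e1 mulr1.
Qed.

(** Plays the part of Cauchy's theorem: the coefficient does not depend on the radius. For
    polynomials this is orthogonality; in general one polynomial approximates [F] on the disc of
    radius [rho], which contains both the circle of radius [r] and the circle of radius 1/2 that
    defines [tc]. *)
Lemma inA_coef F (r : R) n : inA F -> 0 <= r -> r < 1 ->
  cint (fun t => circ F r t * conjc (zeta t) ^+ n) = tc F n * r%:C ^+ n.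
Proof.
move=> hF r0 r1; apply/eqP; rewrite -subr_eq0; apply/eqP.
apply: (@cnorm_small _ (1 + 2 ^+ n * r ^+ n)) => e e0.
pose rho := Num.max r (2^-1).
have rho0 : 0 <= rho by rewrite le_max r0.
have rho1 : rho < 1 by rewrite gt_max r1; have [] := half01.
have [q hq] := hF _ rho0 rho1 _ e0.
have h1 : cnorm (cint (fun t => circ F r t * conjc (zeta t) ^+ n) - q`_n * r%:C ^+ n) <= e.
  by apply: coef_approx => // z hz; apply: hq; rewrite le_max hz.
have h2 : cnorm (tc F n - q`_n) <= 2 ^+ n * e.
  by apply: tc_approx => // z hz; apply: hq; rewrite le_max hz orbT.
rewrite (_ : _ - _ = (cint (fun t => circ F r t * conjc (zeta t) ^+ n) - q`_n * r%:C ^+ n)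
    - (tc F n - q`_n) * r%:C ^+ n); last by ring.
rewrite (le_trans (cnormB _ _))// [leRHS]mulrDl mul1r lerD// cnormM cnormX cnorm_real ger0_norm//.
by rewrite mulrAC ler_wpM2r// exprn_ge0.
Qed.

Lemma inA_neg F (r : R) n : inA F -> 0 <= r -> r < 1 -> (0 < n)%N ->
  cint (fun t => circ F r t * zeta t ^+ n) = 0.
Proof.
move=> hF r0 r1 n0; apply: (@cnorm_small _ 1) => e e0; rewrite mul1r.
have [q hq] := hF _ r0 r1 _ e0.
rewrite -[cint _]subr0 -(poly_neg q r n0) -cintB.
- have hL : cL1 (fun t => circ F r t * zeta t ^+ n - circ (horner q) r t * zeta t ^+ n).
    by apply: cL1B; apply: cL1MX; [exact: inA_L1|exact: cL1_poly].
  apply: le_trans (cint_norm hL) _; rewrite -[leRHS]ri_cst; apply: ri_le.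
  + exact: hL.2.
  + exact: integr_cst.
  + by move=> t _; rewrite -mulrBl cnormM cnorm_zetaX mulr1 hq// cnorm_circ.
- by apply: cL1MX; exact: inA_L1.
- by apply: cL1MX; exact: cL1_poly.
Qed.

Lemma geo_le (x : R) m : 0 <= x -> x < 1 -> \sum_(i < m) x ^+ i <= (1 - x)^-1.
Proof.
move=> x0 x1; have x2 : 0 < 1 - x by rewrite subr_gt0.
have h : (1 - x) * \sum_(i < m) x ^+ i = 1 - x ^+ m.
  by rewrite -opprB mulNr -subrX1 opprB.
by rewrite -(ler_pM2l x2) h divff ?gt_eqF// gerBl exprn_ge0.
Qed.

Lemma inA_csum F z : inA F -> cnorm z < 1 -> csum_to (fun n => tc F n * z ^+ n) (F z).
Proof.
move=> hF z1 eps eps0.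
(* A radius strictly between [cnorm z] and 1. An error [e] on the circle of radius [rho] bounds the
   error of the i-th coefficient by [e / rho ^+ i], so the errors at [z] sum geometrically with
   ratio [x]. *)
pose rho := (1 + cnorm z) / 2.
have zr : cnorm z < rho by rewrite /rho; lra.
have r1 : rho < 1 by rewrite /rho; lra.
have r0 : 0 < rho by rewrite (le_lt_trans _ zr).
pose x := cnorm z / rho.
have x0 : 0 <= x by rewrite divr_ge0// ltW.
have x1 : x < 1 by rewrite ltr_pdivrMr// mul1r.
have K0 : 0 < 2 + (1 - x)^-1 by rewrite ltr_wpDr// invr_ge0 subr_ge0 ltW.
(* The total error is at most [e * (1 - x)^-1 + e]; the 2 in place of 1 makes the final inequality
   strict. *)
pose e := eps / (2 + (1 - x)^-1).
have e0 : 0 < e by rewrite divr_gt0.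
have [q hq] := hF _ (ltW r0) r1 _ e0.
exists (size q) => m hm.
have hz : q.[z] = \sum_(i < m) q`_i * z ^+ i.
  rewrite horner_coef (big_ord_widen_cond _ xpredT (fun i => q`_i * z ^+ i) hm).
  rewrite [RHS](bigID (fun i : 'I_m => (i < size q)%N))/= [X in _ = _ + X]big1 ?addr0// => i.
  by rewrite -leqNgt => hi; rewrite nth_default ?mul0r.
have -> : \sum_(i < m) tc F i * z ^+ i - F z =
   \sum_(i < m) (tc F i - q`_i) * z ^+ i - (F z - q.[z]).
  rewrite hz; under [X in _ = X - _]eq_bigr do rewrite mulrBl.
  by rewrite sumrB; ring.
apply: le_lt_trans (cnormB _ _) _.
apply: (@le_lt_trans _ _ (e * (1 - x)^-1 + e)).
  apply: lerD; last by apply: hq; exact: ltW.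
  rewrite (le_trans (cnorm_sum _ _))//.
  apply: (@le_trans _ _ (\sum_(i < m) e * x ^+ i)); last first.
    by rewrite -mulr_sumr; apply: ler_wpM2l; [exact: ltW|exact: geo_le].
  apply: ler_sum => i _; rewrite cnormM cnormX /x expr_div_n mulrA ler_pdivlMr ?exprn_gt0//.
  rewrite mulrAC ler_wpM2r// ?exprn_ge0//.
  have := coef_approx i hF (ltW r0) r1 hq; rewrite (inA_coef i hF (ltW r0) r1).
  by rewrite -mulrBl cnormM cnormX cnorm_real (ger0_norm (ltW r0)).
have -> : eps = e * (2 + (1 - x)^-1) by rewrite /e divfK// gt_eqF.
by rewrite mulrDr; lra.
Qed.

Lemma csum_unique (a : nat -> C) z w : csum_to a z -> csum_to a w -> z = w.
Proof.
move=> h1 h2; apply/eqP; rewrite -subr_eq0; apply/eqP; apply: (@cnorm_small _ 2) => e e0.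
have [N hN] := h1 _ e0; have [M hM] := h2 _ e0.
have := hN _ (leq_maxl N M); have := hM _ (leq_maxr N M).
set s := \sum_(i < _) _ => a1 a2.
rewrite (_ : z - w = (s - w) - (s - z)); last by ring.
by rewrite (le_trans (cnormB _ _))//; lra.
Qed.

Lemma inA_eq F G : inA F -> inA G -> (forall n, tc F n = tc G n) ->
  forall z, cnorm z < 1 -> F z = G z.
Proof.
move=> hF hG FG z z1; apply: (csum_unique (inA_csum hF z1)).
by have := inA_csum hG z1; under eq_fun do rewrite -FG.
Qed.

Lemma tc0 F : inA F -> tc F 0 = F 0.
Proof.
move=> hF; have c0 : cnorm (0 : C) < 1 by rewrite cnorm0.
apply: (csum_unique _ (inA_csum hF c0)) => e e0; exists 1%N => -[//|m] _.
rewrite big_ord_recl big1 ?addr0 ?expr0 ?mulr1 ?subrr ?cnorm0// => i _.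
by rewrite exprS mul0r mulr0.
Qed.

End Analytic.

(** * Exponential, Cauchy, Herglotz and Poisson integrals *)

Section CauchyKernel.
Variable R : realType.
Local Notation C := R[i].
Implicit Types (f g h : R -> C) (z w : C).

Local Notation mu := (@leb R).
Local Notation D := (@I01 R).

(** * Elementary estimates and the complex exponential *)

Lemma mvt_bound (f df : R -> R) (y B : R) : (forall x : R, is_derive x (1 : R) f (df x)) -> f 0 = 0 ->
  (forall x, `|x| <= `|y| -> `|df x| <= B) -> `|f y| <= B * `|y|.
Proof.
move=> hd f0 hB.
have cf (a b : R) : {within `[a, b], continuous f}.
  apply: continuous_subspaceT => x.
  by apply/differentiable_continuous/derivable1_diffP; exact: ex_derive.
case: (lerP 0 y) => hy.
  have [c] := MVT_segment hy (fun x _ => hd x) (cf _ _).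
  rewrite in_itv/= => /andP[c0 cy]; rewrite f0 !subr0 => ->.
  by rewrite normrM ler_wpM2r// ?hB// !ger0_norm.
have [c] := MVT_segment (ltW hy) (fun x _ => hd x) (cf _ _).
rewrite in_itv/= => /andP[c0 cy]; rewrite f0 !sub0r => h.
rewrite -normrN h normrM normrN ler_wpM2r// hB//.
by rewrite (ler0_norm cy) (ler0_norm (ltW hy)) lerN2.
Qed.

Lemma abs_sin_le (y : R) : `|sin y| <= `|y|.
Proof.
rewrite -[leRHS]mul1r; apply: (@mvt_bound sin cos _ _ (fun x => is_derive_sin x) (sin0 R)).
by move=> x _; exact: cos_max.
Qed.

Lemma cos_ge (y : R) : `|1 - cos y| <= y ^+ 2.
Proof.
rewrite -real_normK ?num_real// expr2.
have hd (x : R) : is_derive x (1 : R) (fun y : R => 1 - cos y) (sin x).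
  by apply: is_derive_eq; ring.
apply: (mvt_bound hd).
- by rewrite cos0 subrr.
- by move=> x hx; rewrite (le_trans (abs_sin_le _)).
Qed.

Lemma sin_ge (y : R) : `|y| <= 1 -> `|sin y - y| <= y ^+ 2.
Proof.
move=> y1; rewrite -real_normK ?num_real// expr2.
have hd (x : R) : is_derive x (1 : R) (fun y : R => sin y - y) (cos x - 1).
  by apply: is_derive_eq; ring.
apply: (mvt_bound hd).
- by rewrite sin0 subrr.
- move=> x hx; rewrite -normrN opprB (le_trans (cos_ge _))//.
  rewrite -real_normK ?num_real// expr2 (le_trans _ hx)// ler_piMr//.
  exact: le_trans y1.
Qed.

(** Everything follows from [1 + x <= expR x] and from its instance at [- x], rewritten as
    [expR x * (1 - x) <= 1]. *)
Lemma expR_lin (x : R) : `|x| <= 2^-1 -> `|expR x - 1 - x| <= 2 * x ^+ 2 /\ expR x <= 2 /\ `|expR x - 1| <= 2 * `|x|.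
Proof.
move=> hx; have := hx; rewrite ler_norml => /andP[x1 x2].
have h1 := expR_ge1Dx x; have h2 := expR_ge1Dx (- x).
have e0 := expR_gt0 x.
have h3 : expR x * (1 - x) <= 1.
  by have := ler_wpM2l (ltW e0) h2; rewrite expRxMexpNx_1.
have h4 : expR x <= 2 by nra.
split; first by rewrite ler_norml; apply/andP; split; nra.
split => //; rewrite ler_norml; case: (lerP 0 x) => hx0.
  by rewrite ger0_norm//; apply/andP; split; nra.
by rewrite ltr0_norm//; apply/andP; split; nra.
Qed.

Lemma cexpCD z w : cexpC (z + w) = cexpC z * cexpC w.
Proof.
rewrite /cexpC !cE expRD eeD cplxM; ring.
Qed.
Lemma cexpC0 : cexpC (0 : C) = 1.
Proof. by rewrite /cexpC /= expR0 ee0 mulr1. Qed.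
Lemma cnorm_cexpC w : cnorm (cexpC w) = expR (Re w).
Proof. by rewrite /cexpC cnormM cnorm_ee mulr1 cnorm_real ger0_norm// expR_ge0. Qed.
Lemma cexpC_real (x : R) : cexpC x%:C = (expR x)%:C.
Proof. by rewrite /cexpC /= ee0 mulr1. Qed.
Lemma cexpCMn w n : cexpC (w *+ n) = cexpC w ^+ n.
Proof. by elim: n => [|n ih]; rewrite ?mulr0n ?cexpC0// mulrS exprS cexpCD ih. Qed.

(* The second order estimate behind [cexpC w = lim (1 + w / N) ^+ N]. *)
Lemma cexpC_lin w : cnorm w <= 2^-1 -> cnorm (cexpC w - 1 - w) <= 6 * csq w.
Proof.
move=> hw; have hx := le_trans (Re_le w) hw; have hy := le_trans (Im_le w) hw.
apply: le_trans (cnorm_le _) _; rewrite /cexpC /csq !cE /=.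
move: hx hy; set x := Re w; set y := Im w => hx hy.
have [e1 [e2 e3]] := expR_lin hx.
have c1 := cos_ge y.
have y1 : `|y| <= 1 by lra.
have s1 := sin_ge y1.
have e0 := expR_gt0 x.
rewrite (_ : _ - 1 - x = expR x * (cos y - 1) + (expR x - 1 - x)); last by ring.
rewrite (_ : _ - 0 - y = expR x * (sin y - y) + (expR x - 1) * y); last by ring.
have t1 : `|expR x * (cos y - 1)| <= 2 * y ^+ 2.
  by rewrite normrM gtr0_norm// -normrN opprB; apply: ler_pM => //; exact: ltW.
have t2 : `|expR x * (sin y - y)| <= 2 * y ^+ 2.
  by rewrite normrM gtr0_norm//; apply: ler_pM => //; exact: ltW.
have t3 : `|(expR x - 1) * y| <= x ^+ 2 + y ^+ 2.
  rewrite normrM (le_trans (ler_wpM2r _ e3))//.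
  rewrite -(real_normK (num_real x)) -(real_normK (num_real y)) -subr_ge0.
  rewrite (_ : _ - _ = (`|x| - `|y|) ^+ 2) ?sqr_ge0//; ring.
have := ler_normD (expR x * (cos y - 1)) (expR x - 1 - x).
have := ler_normD (expR x * (sin y - y)) ((expR x - 1) * y).
have := sqr_ge0 x; have := sqr_ge0 y; lra.
Qed.

Lemma cnorm_pow_sub z w (B : R) n : 1 <= B -> cnorm z <= B -> cnorm w <= B ->
  cnorm (z ^+ n - w ^+ n) <= n%:R * cnorm (z - w) * B ^+ n.
Proof.
move=> B1 hz hw; have B0 : 0 <= B by rewrite (le_trans _ hz).
elim: n => [|n ih]; first by rewrite !expr0 subrr cnorm0 !mul0r.
rewrite (_ : _ - _ = z * (z ^+ n - w ^+ n) + (z - w) * w ^+ n); last by rewrite !exprS; ring.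
apply: le_trans (cnormD _ _) _; rewrite !cnormM cnormX -natr1 !mulrDl mul1r.
apply: lerD.
  by rewrite exprS mulrCA; apply: ler_pM.
apply: ler_wpM2l => //; apply: (@le_trans _ _ (B ^+ n)).
  by rewrite lerXn2r ?nnegrE.
by rewrite exprS ler_peMl// exprn_ge0.
Qed.

(** The powers [(1 + F / N) ^+ N] converge locally uniformly. Where [F] is bounded by [M], the
    factors [cexpC (F / N)] and [1 + F / N] are both bounded by [expR (M / N)] and differ by at most
    [6 * (M / N) ^+ 2], so their N-th powers differ by at most [K / N]. *)
Lemma inA_exp F : inA F -> inA (fun z => cexpC (F z)).
Proof.
move=> hF; apply: inA_lim => rho r0 r1 e e0.
have [M M0 hM] := inA_bdd hF r0 r1.
pose K := 6 * M ^+ 2 * expR M.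
have K0 : 0 <= K by rewrite /K mulr_ge0 ?expR_ge0// mulr_ge0// sqr_ge0.
(* The first condition brings [F / N] into the disc of radius 1/2 where [cexpC_lin] applies, the
   second makes the error at most [e]. *)
have [n hn] : exists n : nat, 2 * M <= n.+1%:R /\ K / n.+1%:R <= e.
  pose x := Num.max (2 * M) (K / e).
  have x0 : 0 <= x by rewrite le_max mulr_ge0//= ltW.
  exists (Num.truncn x); have := truncnS_gt x; rewrite gt_max => /andP[h1 h2].
  split; first exact: ltW.
  by rewrite ler_pdivrMr// mulrC -ler_pdivrMr// ltW.
have N0 : 0 < n.+1%:R :> R by [].
set N : R := n.+1%:R in hn N0.
exists (fun z => (1 + (N^-1)%:C * F z) ^+ n.+1).
  by apply: inAX; apply: inAD; [exact: inA_cst|exact: inAZ].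
move=> z hz; have FM := hM z hz.
pose w := (N^-1)%:C * F z.
have wM : cnorm w <= M / N.
  rewrite cnormM cnorm_real ger0_norm ?invr_ge0 ?(ltW N0)// mulrC.
  by rewrite ler_wpM2r// invr_ge0 ltW.
have w2 : cnorm w <= 2^-1.
  rewrite (le_trans wM)// ler_pdivrMr//; case: hn; lra.
have Fw : F z = w *+ n.+1.
  rewrite /w -mulr_natr mulrAC (_ : n.+1%:R = N%:C :> C).
    by rewrite -cplxM mulVf ?gt_eqF// cplx1 mul1r.
  rewrite /N; elim: (n.+1) => [//|m ih]; rewrite -natr1 -[in RHS]natr1 cplxD ih.
  by rewrite cplx1.
rewrite {1}Fw cexpCMn -/w.
pose B := expR (M / N).
have B1 : 1 <= B by rewrite /B -expR0 ler_expR divr_ge0// ltW.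
apply: le_trans (cnorm_pow_sub n.+1 B1 _ _) _.
- rewrite cnorm_cexpC ler_expR (le_trans (ler_norm _))// (le_trans (Re_le _))//.
- rewrite (le_trans (cnormD _ _))// cnorm1 (le_trans _ (expR_ge1Dx _))// lerD2l//.
have BN : B ^+ n.+1 = expR M.
  by rewrite /B -expRM_natl -/N mulrCA divff ?gt_eqF// mulr1.
rewrite BN opprD addrA.
apply: (@le_trans _ _ (N * (6 * (M / N) ^+ 2) * expR M)).
  apply: ler_wpM2r; first exact: expR_ge0.
  apply: ler_wpM2l; first exact: ltW.
  apply: le_trans (cexpC_lin w2) _; apply: ler_wpM2l => //.
  by rewrite -cnorm_sq lerXn2r ?nnegrE// divr_ge0// ltW.
case: hn => _ hn; apply: le_trans _ hn.
rewrite (_ : _ * expR M = K / N)// /K.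
by field; rewrite gt_eqF.
Qed.

(** * The Cauchy kernel and Cauchy integrals *)

Definition ck z (t : R) : C := (1 - z * conjc (zeta t))^-1.

Lemma cnorm_zJ z (t : R) : cnorm (z * conjc (zeta t)) = cnorm z.
Proof. by rewrite cnormM cnormJ cnorm_zeta mulr1. Qed.

Lemma cnorm_1B w : 1 - cnorm w <= cnorm (1 - w).
Proof. by have := cnormD (1 - w) w; rewrite subrK cnorm1 lerBlDr. Qed.

Lemma ck_neq0 z t : cnorm z < 1 -> 1 - z * conjc (zeta t) != 0.
Proof.
move=> z1; apply/eqP => h; have := cnorm_1B (z * conjc (zeta t)).
by rewrite h cnorm0 cnorm_zJ; lra.
Qed.

Lemma cnorm_ck z t : cnorm z < 1 -> cnorm (ck z t) <= (1 - cnorm z)^-1.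
Proof.
move=> z1; rewrite /ck cnormV lef_pV2 ?posrE ?subr_gt0//.
  by have := cnorm_1B (z * conjc (zeta t)); rewrite cnorm_zJ.
by apply: cnorm_gt0; exact: ck_neq0.
Qed.

Lemma cmeas_ck z : cnorm z < 1 -> cmeas (ck z).
Proof.
move=> z1; apply: cmeasV; first by move=> t _; exact: ck_neq0.
apply: cmeasB; first exact: cmeas_cst.
by apply: cmeasM; [exact: cmeas_cst|apply: cmeasJ; exact: cmeas_zeta].
Qed.

Lemma cL1_ck z f : cnorm z < 1 -> cL1 f -> cL1 (fun t => f t * ck z t).
Proof.
move=> z1 hf; apply: (eq_cL1 (f := fun t => ck z t * f t)) => [t _|]; first by rewrite mulrC.
by apply: (@cL1Mb _ _ _ (1 - cnorm z)^-1) => [|t _|//]; [exact: cmeas_ck|exact: cnorm_ck].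
Qed.

Definition Cau f z : C := cint (fun t => f t * ck z t).

Lemma ck_geo z t N : cnorm z < 1 ->
  ck z t - \sum_(n < N) (z * conjc (zeta t)) ^+ n = (z * conjc (zeta t)) ^+ N * ck z t.
Proof.
move=> z1; have h := ck_neq0 t z1; rewrite /ck; set x := z * _ in h *.
have e : (1 - x) * \sum_(i < N) x ^+ i = 1 - x ^+ N.
  by rewrite -opprB mulNr -subrX1 opprB.
apply: (mulfI h); rewrite mulrBr e divff// mulrCA divff// mulr1.
by rewrite opprB addrC subrK.
Qed.

(** By [ck_geo], the remainder of the geometric series of the kernel after [N] terms is the N-th
    power times the kernel itself. Besides analyticity, [N = 0] gives a bound on the Cauchy integral
    and [N = 1] a bound on its distance to the value at the origin. *)
Lemma Cau_approx f (rho : R) z N : cL1 f -> rho < 1 -> cnorm z <= rho ->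
  cnorm (Cau f z - (\poly_(n < N) fcoef f n%:Z).[z]) <=
    rho ^+ N * (1 - rho)^-1 * ri (fun t => cnorm (f t)).
Proof.
move=> hf r1 zr; have z1 := le_lt_trans zr r1.
have -> : (\poly_(n < N) fcoef f n%:Z).[z] =
    cint (fun t => \sum_(n < N) z ^+ n * (f t * conjc (zeta t) ^+ n)).
  rewrite horner_poly cint_sum; last by move=> i; apply: cL1Z; exact: cL1MJX.
  by apply: eq_bigr => i _; rewrite cintZ ?fcoef_nat 1?mulrC//; exact: cL1MJX.
rewrite /Cau -cintB; last 2 first.
- exact: cL1_ck.
- by apply: cL1_sum => i; apply: cL1Z; exact: cL1MJX.
rewrite (eq_cint (g := fun t => (z ^+ N * conjc (zeta t) ^+ N) * (f t * ck z t))); last first.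
  move=> t _; rewrite -exprMn mulrCA -ck_geo// mulrBr mulr_sumr; congr (_ - _).
  by apply: eq_bigr => i _; rewrite exprMn mulrCA.
have hL : cL1 (fun t => (z ^+ N * conjc (zeta t) ^+ N) * (f t * ck z t)).
  apply: (@cL1Mb _ _ _ (cnorm z ^+ N)).
  - by apply: cmeasM; [exact: cmeas_cst|exact: cmeas_zetaJX].
  - by move=> t _; rewrite cnormM cnorm_zetaJX mulr1 cnormX.
  - exact: cL1_ck.
apply: le_trans (cint_norm hL) _; rewrite -riZ; last exact: hf.2.
apply: ri_le; first exact: hL.2.
  by apply: integrZ; exact: hf.2.
move=> t _; rewrite !cnormM cnorm_zetaJX mulr1 mulrCA [leRHS]mulrC.
apply: ler_wpM2l => //; rewrite cnormX; apply: ler_pM => //.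
- exact: exprn_ge0.
- by rewrite lerXn2r ?nnegrE// (le_trans _ zr).
- apply: le_trans (cnorm_ck t z1) _; rewrite lef_pV2 ?posrE ?subr_gt0//.
  by rewrite lerD2l lerN2.
Qed.

Lemma pow_small (rho K e : R) : 0 <= rho -> rho < 1 -> 0 < e ->
  exists N : nat, forall m, (N <= m)%N -> rho ^+ m * K <= e.
Proof.
move=> r0 r1 e0.
have h : (fun n => rho ^+ n * K) @ \oo --> (0 : R).
  rewrite -[X in _ --> X](mul0r K); apply: cvgMl.
  by apply: cvg_expr; rewrite ger0_norm.
move/cvgrPdist_le : h => /(_ _ e0)[N _ hN]; exists N => m Nm.
have := hN m Nm; rewrite sub0r normrN; exact: le_trans (ler_norm _).
Qed.

Lemma inA_Cau f : cL1 f -> inA (Cau f).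
Proof.
move=> hf rho r0 r1 e e0.
have [N hN] := pow_small ((1 - rho)^-1 * ri (fun t => cnorm (f t))) r0 r1 e0.
exists (\poly_(n < N) fcoef f n%:Z) => z hz.
by apply: le_trans (Cau_approx N hf r1 hz) _; rewrite -mulrA hN.
Qed.

Lemma tc_Cau f n : cL1 f -> tc (Cau f) n = fcoef f n%:Z.
Proof.
move=> hf; apply/eqP; rewrite -subr_eq0; apply/eqP.
apply: (@cnorm_small _ _ (2 ^+ n)) => e e0.
have [h0 h1] := half01 R.
have [N hN] := pow_small ((1 - 2^-1)^-1 * ri (fun t => cnorm (f t))) h0 h1 e0.
pose m := maxn N n.+1.
rewrite (_ : fcoef f n%:Z = (\poly_(n < m) fcoef f n%:Z)`_n); last first.
  by rewrite coef_poly leq_max leqnn orbT.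
apply: tc_approx; first exact: inA_Cau.
move=> z hz; apply: le_trans (Cau_approx m hf h1 hz) _.
by rewrite -mulrA hN// leq_maxl.
Qed.

Lemma Cau_csum f z : cL1 f -> cnorm z < 1 ->
  csum_to (fun n => fcoef f n%:Z * z ^+ n) (Cau f z).
Proof.
move=> hf z1; have := inA_csum (inA_Cau hf) z1.
by under eq_fun do rewrite tc_Cau//.
Qed.

Lemma Cau_bound f z : cL1 f -> cnorm z < 1 ->
  cnorm (Cau f z) <= (1 - cnorm z)^-1 * ri (fun t => cnorm (f t)).
Proof.
move=> hf z1; have := Cau_approx 0 hf z1 (lexx _).
by rewrite horner_poly big_ord0 subr0 expr0 mul1r.
Qed.

Lemma Cau_cst c z : cnorm z < 1 -> Cau (fun=> c) z = c.
Proof.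
move=> z1; apply: (inA_eq (inA_Cau (cL1_cst c)) (inA_cst c) _ z1) => n.
rewrite /tc (inA_coef n (inA_Cau (cL1_cst c))) ?(half01 R).1 ?(half01 R).2//.
rewrite tc_Cau; last exact: cL1_cst.
rewrite fcoef_nat /circ mulrCA -exprMn -cplxM divff// expr1n mulr1.
have h : cint (fun t : R => conjc (zeta t) ^+ n) = (n == 0%N)%:R.
  rewrite (eq_cint (g := fun t => zeta t ^+ 0 * conjc (zeta t) ^+ n)).
    by rewrite cint_zetaMJ eq_sym.
  by move=> t _; rewrite expr0 mul1r.
have e : cint (fun t : R => c * conjc (zeta t) ^+ n) = c * (n == 0%N)%:R.
  rewrite cintZ ?h//; apply: (@cL1_bdd _ _ 1); first exact: cmeas_zetaJX.
  by move=> t _; rewrite cnorm_zetaJX.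
by rewrite e; case: n {h e} => [|n]; rewrite /= ?expr0 ?mul1r// !mulr0.
Qed.

Definition Her (u : R -> R) z : C := cint (fun t => herglotz t z * (u t)%:C).

(** Reduces Herglotz integrals to Cauchy integrals, from which they inherit analyticity. *)
Lemma herglotzE z t : cnorm z < 1 -> herglotz t z = 2 * ck z t - 1.
Proof.
move=> z1; have h := ck_neq0 t z1; have z0 : zeta t != 0 := ee_neq0 _.
have zt : zeta t - z = zeta t * (1 - z * conjc (zeta t)).
  by rewrite mulrBr mulr1 mulrCA zetaJ mulr1.
have hz : zeta t - z != 0 by rewrite zt mulf_neq0.
rewrite /herglotz /ck; apply: (mulIf hz); rewrite divfK// mulrBl mul1r zt.
rewrite [zeta t * _]mulrC mulrA [2 * _ * _]mulrAC -[2 * _ * _]mulrA mulfV// mulr1 mulrC -zt.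
by ring.
Qed.

Lemma cplx2 : 2%:C = 2 :> C.
Proof. by rewrite (mulr2n (1 : R)) cplxD cplx1. Qed.

Lemma cnorm_herglotz z t : cnorm z < 1 -> cnorm (herglotz t z) <= 2 * (1 - cnorm z)^-1 + 1.
Proof.
move=> z1; rewrite herglotzE// (le_trans (cnormB _ _))// cnorm1 lerD2r cnormM.
have -> : cnorm (2 : C) = 2 by rewrite -cplx2 cnorm_real ger0_norm.
by apply: ler_wpM2l => //; exact: cnorm_ck.
Qed.

Lemma cmeas_herglotz z : cnorm z < 1 -> cmeas (fun t => herglotz t z).
Proof.
move=> z1; apply: (@eq_cmeas _ (fun t => 2 * ck z t - 1)).
  by move=> t _; rewrite herglotzE.
apply: cmeasB; last exact: cmeas_cst.
by apply: cmeasM; [exact: cmeas_cst|exact: cmeas_ck].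
Qed.

Lemma cL1_her u z : cnorm z < 1 -> integr u -> cL1 (fun t => herglotz t z * (u t)%:C).
Proof.
move=> z1 iu; apply: cL1Mb (cL1_real iu); first exact: cmeas_herglotz.
by move=> t _; exact: cnorm_herglotz.
Qed.

Lemma HerE u z : cnorm z < 1 -> integr u ->
  Her u z = 2 * Cau (fun t => (u t)%:C) z - (ri u)%:C.
Proof.
move=> z1 iu; have hu := cL1_real iu.
rewrite /Her /Cau -cintZ; last exact: cL1_ck.
rewrite -cint_real -cintB//; last by apply: cL1Z; exact: cL1_ck.
by apply: eq_cint => t _; rewrite herglotzE//; ring.
Qed.

Lemma inA_Her u : integr u -> inA (Her u).
Proof.
move=> iu; apply: (@eq_inA _ (fun z => 2 * Cau (fun t => (u t)%:C) z + - (ri u)%:C)).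
  by move=> z z1; rewrite HerE.
by apply: inAD; [apply: inAZ; apply: inA_Cau; exact: cL1_real|exact: inA_cst].
Qed.

Lemma cnorm0_lt1 : cnorm (0 : C) < 1. Proof. by rewrite cnorm0. Qed.
Lemma ck0 t : ck 0 t = 1. Proof. by rewrite /ck mul0r subr0 invr1. Qed.
Lemma Her0 u : integr u -> Her u 0 = (ri u)%:C.
Proof.
move=> iu; rewrite (HerE cnorm0_lt1 iu).
have -> : Cau (fun t => (u t)%:C) 0 = (ri u)%:C.
  by rewrite /Cau -cint_real; apply: eq_cint => t _; rewrite ck0 mulr1.
by ring.
Qed.
Lemma HerD u v z : cnorm z < 1 -> integr u -> integr v -> Her (fun t => u t + v t) z = Her u z + Her v z.
Proof.
move=> z1 iu iv; rewrite /Her -cintD; try exact: cL1_her.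
by apply: eq_cint => t _; rewrite cplxD mulrDr.
Qed.

(** * The Poisson kernel and the maximum principle *)

Definition pk z (t : R) : R := Re (herglotz t z).

Lemma pkE z t : cnorm z < 1 -> pk z t = (1 - csq z) / csq (1 - z * conjc (zeta t)).
Proof.
move=> z1; have h := ck_neq0 t z1; rewrite /pk herglotzE// /ck.
set w := 1 - _ in h *.
have cw : csq w != 0 by apply: contra_neq h => /csq_eq0.
have -> : w^-1 = (csq w)^-1%:C * conjc w.
  by apply: (mulfI h); rewrite mulrCA mulJ divff// -cplxM mulVf.
have -> : csq z = csq (1 - w) by rewrite /w opprB addrC subrK csqM csqJ csq_ee mulr1.
rewrite -cplx2; clearbody w; case: w h cw => a b _; rewrite /csq /= => cw.
by field.
Qed.

Lemma csq_lt1 z : cnorm z < 1 -> csq z < 1.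
Proof. by move=> z1; rewrite -cnorm_sq expr_lt1. Qed.

(** The denominator in [pkE] is at most 4. Being uniform in [t], this lower bound turns a bound on
    the Poisson average of a nonnegative function into one on its integral. *)
Lemma pk_gt0 z t : cnorm z < 1 -> (1 - csq z) / 4 <= pk z t.
Proof.
move=> z1; rewrite pkE//; have c1 := csq_lt1 z1.
apply: ler_wpM2l; first by rewrite subr_ge0 ltW.
have h := cnorm_gt0 (ck_neq0 t z1).
rewrite lef_pV2 ?posrE// -?cnorm_sq ?exprn_gt0//.
rewrite (_ : 4 = 2 ^+ 2 :> R); last by rewrite -natrX.
rewrite lerXn2r ?nnegrE// (le_trans (cnormB _ _))// cnorm1 cnorm_zJ; lra.
Qed.

Lemma pk_ge0 z t : cnorm z < 1 -> 0 <= pk z t.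
Proof.
move=> z1; apply: le_trans (pk_gt0 t z1); rewrite divr_ge0// subr_ge0 ltW//.
exact: csq_lt1.
Qed.

Lemma pk_le z t : cnorm z < 1 -> `|pk z t| <= 2 * (1 - cnorm z)^-1 + 1.
Proof. by move=> z1; apply: le_trans (Re_le _) (cnorm_herglotz t z1). Qed.

Lemma mea_pk z : cnorm z < 1 -> mea (pk z).
Proof. by move=> /cmeas_herglotz[]. Qed.

Lemma integr_pk z u : cnorm z < 1 -> integr u -> integr (fun t => pk z t * u t).
Proof.
move=> z1 iu; apply: (integrMb _ _ iu); first exact: mea_pk.
by move=> t _; exact: pk_le.
Qed.

Lemma Re_Her u z : Re (Her u z) = ri (fun t => pk z t * u t).
Proof. by apply: eq_ri => t _; rewrite cE /= mulr0 subr0. Qed.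

Lemma ri_pk z : cnorm z < 1 -> ri (pk z) = 1.
Proof.
move=> z1; transitivity (Re (Her (fun=> 1) z)).
  by rewrite Re_Her; apply: eq_ri => t _; rewrite mulr1.
rewrite (HerE z1 (integr_cst 1)) ri_cst Cau_cst//.
by rewrite -cplx2 !cE /=; ring.
Qed.

Lemma pk_ck z t : cnorm z < 1 -> (pk z t)%:C = ck z t + conjc (ck z t) - 1.
Proof.
move=> z1; rewrite /pk herglotzE// -cplx2.
by apply: eqC; rewrite !cE /=; ring.
Qed.

Lemma fcoefJ f (n : nat) : cL1 f -> fcoef (fun t => conjc (f t)) n%:Z = conjc (fcoef f (- n%:Z)).
Proof.
move=> hf; rewrite fcoef_nat fcoef_neg -cintJ; last exact: cL1MX.
by apply: eq_cint => t _; rewrite rmorphM rmorphXn.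
Qed.

(** The Poisson kernel is the Cauchy kernel plus [conjc (ck z t) - 1], and [f] integrates to 0
    against the latter: the integral of [f * conjc (ck z t)] is the conjugate of the Cauchy integral
    of [conjc f], whose series stops at the constant term. *)
Lemma Cau_pk f z : cL1 f -> (forall n : nat, (0 < n)%N -> fcoef f (- n%:Z) = 0) ->
  cnorm z < 1 -> Cau f z = cint (fun t => f t * (pk z t)%:C).
Proof.
move=> hf fneg z1.
have hJ := cL1J hf.
have h : Cau (fun t => conjc (f t)) z = conjc (fcoef f 0).
  apply: (csum_unique (Cau_csum hJ z1)) => e e0; exists 1%N => -[//|m] _.
  rewrite big_ord_recl big1; last first.
    move=> i _; rewrite fcoefJ// fneg// (_ : conjc 0 = 0) ?mul0r//; exact: conjc0.
  by rewrite fcoefJ// oppr0 expr0 mulr1 addr0 subrr cnorm0.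
have h2 : cint (fun t => f t * conjc (ck z t)) = fcoef f 0.
  rewrite -[RHS]conjcK -h /Cau -cintJ; last exact: cL1_ck.
  by apply: eq_cint => t _; rewrite rmorphM /= conjcK.
have hck : cL1 (fun t => f t * conjc (ck z t)).
  apply: eq_cL1 (cL1J (cL1_ck z1 hJ)) => t _.
  by rewrite rmorphM /= conjcK.
have f0 : cint f = fcoef f 0.
  by rewrite (fcoef_nat f 0); apply: eq_cint => t _; rewrite expr0 mulr1.
rewrite (eq_cint (g := fun t => f t * ck z t + f t * conjc (ck z t) - f t)); last first.
  by move=> t _; rewrite pk_ck//; ring.
rewrite cintB//; last by apply: cL1D => //; exact: cL1_ck.
by rewrite cintD ?h2 ?f0 ?addrK//; exact: cL1_ck.
Qed.

(** Maximum principle: by [Cau_pk] the value is an average of [f] against a nonnegative kernel of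
    integral 1. *)
Lemma Cau_le f z (M : R) : cL1 f -> (forall n : nat, (0 < n)%N -> fcoef f (- n%:Z) = 0) ->
  {ae mu, forall t, D t -> cnorm (f t) <= M} -> cnorm z < 1 -> cnorm (Cau f z) <= M.
Proof.
move=> hf fneg fM z1; rewrite Cau_pk//.
have hL : cL1 (fun t => f t * (pk z t)%:C).
  apply: (@eq_cL1 _ (fun t => (pk z t)%:C * f t)) => [t _|]; first by rewrite mulrC.
  apply: cL1Mb hf; first by apply: cmeas_real; exact: mea_pk.
  by move=> t _; rewrite cnorm_real; exact: pk_le.
apply: le_trans (cint_norm hL) _.
have -> : M = ri (fun t => pk z t * M).
  have := riZ M (integr_pk z1 (integr_cst 1)).
  rewrite (eq_ri (g := fun t => pk z t * M)) => [->|t _]; last by rewrite mulr1 mulrC.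
  by rewrite (eq_ri (g := pk z)) ?ri_pk ?mulr1// => t _; rewrite mulr1.
apply: ri_le_ae.
- exact: hL.2.
- by apply: integr_pk => //; exact: integr_cst.
- apply: ae1 fM => t _ fM; rewrite cnormM cnorm_real ger0_norm ?pk_ge0// mulrC.
  by apply: ler_wpM2l => //; exact: pk_ge0.
Qed.

Lemma ri_circ_Her u r : integr u -> 0 <= r -> r < 1 ->
  ri (fun t => Re (circ (Her u) r t)) = ri u.
Proof.
move=> iu r0 r1; have := inA_coef 0 (inA_Her iu) r0 r1.
rewrite expr0 mulr1 tc0; last exact: inA_Her.
rewrite Her0// => e; rewrite -[RHS]/(Re (ri u)%:C) -e; apply: eq_ri => t _.
by rewrite expr0 mulr1.
Qed.

End CauchyKernel.

(** * Uniqueness of Fourier coefficients *)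

Section Uniqueness.
Variable R : realType.
Local Notation C := R[i].
Implicit Types (f g h : R -> C) (z w : C).

Local Notation mu := (@leb R).
Local Notation D := (@I01 R).

Lemma cJM z w : conjc (z * w) = conjc z * conjc w. Proof. exact: rmorphM. Qed.
Lemma cJX z n : conjc (z ^+ n) = conjc z ^+ n. Proof. exact: rmorphXn. Qed.
Lemma cJD z w : conjc (z + w) = conjc z + conjc w. Proof. exact: rmorphD. Qed.
Lemma cJN z : conjc (- z) = - conjc z. Proof. exact: rmorphN. Qed.
Lemma cJ0 : conjc (0 : C) = 0. Proof. exact: conjc0. Qed.

(** Fixing one sequence of radii tending to 1 makes radial limits limits of sequences, to which
    dominated convergence applies. *)
Definition rj (j : nat) : R := 1 - j.+1%:R^-1.
Lemma rj_ge0 j : 0 <= rj j.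
Proof. by rewrite subr_ge0 invf_le1// ler1n. Qed.
Lemma rj_lt1 j : rj j < 1. Proof. by rewrite gtrBl invr_gt0. Qed.
Lemma cvg_rj : rj j @[j --> \oo] --> (1 : R).
Proof.
rewrite -[X in _ --> X]subr0; apply: cvgB; first exact: cvg_cst.
exact: cvg_harmonic.
Qed.
Lemma circ_lt1 j (t : R) : cnorm ((rj j)%:C * zeta t) < 1.
Proof. by rewrite cnorm_circ ?rj_ge0// rj_lt1. Qed.

(** For a polynomial the pairing is a combination of coefficients of [f] of index at most 0; uniform
    approximation on the circle of radius [r] gives the rest. *)
Lemma cint_inA0 f F r : cL1 f -> inA F -> (forall n : nat, fcoef f (- n%:Z) = 0) ->
  0 <= r -> r < 1 -> cint (fun t => f t * circ F r t) = 0.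
Proof.
move=> hf hF fn r0 r1.
apply: (@cnorm_small _ _ (ri (fun t => cnorm (f t)))) => e e0.
have [q hq] := hF _ r0 r1 _ e0.
have h0 : cint (fun t => f t * circ (horner q) r t) = 0.
  rewrite (eq_cint (g := fun t => \sum_(i < size q) (q`_i * r%:C ^+ i) * (f t * zeta t ^+ i))).
    rewrite cint_sum; last by move=> i; apply: cL1Z; exact: cL1MX.
    apply: big1 => i _; rewrite cintZ; last exact: cL1MX.
    by rewrite -fcoef_neg fn mulr0.
  by move=> t _; rewrite circ_poly mulr_sumr; apply: eq_bigr => i _; ring.
have bddM G : inA G -> cL1 (fun t => f t * circ G r t).
  move=> hG; have [M M0 hM] := inA_bdd hG r0 r1.
  apply: (@eq_cL1 _ (fun t => circ G r t * f t)) => [t _|]; first by rewrite mulrC.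
  apply: (@cL1Mb _ _ _ M) hf; first exact: inA_meas.
  by move=> t _; apply: hM; rewrite cnorm_circ.
rewrite -[cint _]subr0 -h0 -cintB; [|exact: bddM|exact/bddM/inA_poly].
have hL := cL1B (bddM _ hF) (bddM _ (inA_poly q)).
apply: le_trans (cint_norm hL) _; rewrite mulrC -riZ; last exact: hf.2.
apply: ri_le; first exact: hL.2.
  by apply: integrZ; exact: hf.2.
move=> t _; rewrite -mulrBr cnormM mulrC ler_wpM2r//.
by apply: hq; rewrite cnorm_circ.
Qed.

Definition step (b : R) (t : R) : R := (t <= b)%R%:R.

Lemma mea_step b : mea (step b).
Proof.
rewrite /mea (_ : step b = \1_(`]-oo, b]%classic : set R)).
  exact: measurable_indic.
by apply/funext => t; rewrite /step indicE mem_setE in_itv.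
Qed.
Lemma step01 b t : 0 <= step b t <= 1.
Proof. by rewrite /step; case: (t <= b); rewrite ?mulr0n ?mulr1n ?lexx ?ler01. Qed.
Lemma integr_step b : integr (step b).
Proof.
apply: (@integr_bdd _ _ 1); first exact: mea_step.
by move=> t _; have /andP[h1 h2] := step01 b t; rewrite ger0_norm.
Qed.

(** Since [t] stays at distance [d] from both ends, [|t - s|] lies between [d] and [1 - d], so the
    two points remain apart on the circle as well. The cosine decreases on the first half period,
    and [u -> 1 - u] reflects the second half onto it. *)
Lemma cos_far (d t s : R) : 0 < d -> d <= t -> t <= 1 - d -> 0 <= s -> s <= 1 -> d <= `|t - s| ->
  cos (2 * pi * (t - s)) <= cos (2 * pi * d).
Proof.
move=> d0 dt t1 s0 s1 ds.
have pi0 := pi_gt0 R.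
have d2 : d <= 1 / 2 by lra.
have e : cos (2 * pi * (t - s)) = cos (2 * pi * `|t - s|).
  have [h|h] := leP 0 (t - s); first by rewrite ger0_norm.
  by rewrite ltr0_norm// mulrN cosN.
rewrite e; have u1 : `|t - s| <= 1 - d by rewrite ler_norml; apply/andP; split; lra.
move: (`|t - s|) ds u1 => u du u1.
have inI (x : R) : 0 <= x -> x <= 1 / 2 -> 2 * pi * x \in `[0, pi].
  by move=> x0 x1; rewrite in_itv/=; apply/andP; split; nra.
have dec (x y : R) : 0 <= x -> x <= y -> y <= 1 / 2 -> cos (2 * pi * y) <= cos (2 * pi * x).
  move=> x0 xy y1; have mx := inI x x0 (le_trans xy y1).
  have my := inI y (le_trans x0 xy) y1.
  by rewrite leNgt (ltr_cos my mx) -leNgt ler_wpM2l// mulr_ge0// ltW.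
case: (leP u (1 / 2)) => hu; first by apply: dec => //; lra.
have -> : cos (2 * pi * u) = cos (2 * pi * (1 - u)).
  rewrite -cosN -[in LHS]cosD2pi; congr cos; rewrite -mulr_natl; ring.
by apply: dec => //; lra.
Qed.

Lemma csq_1B (r : R) w : csq w = 1 -> csq (1 - r%:C * w) = (1 - r) ^+ 2 + 2 * r * (1 - Re w).
Proof.
case: w => a b; rewrite /csq /= => h.
rewrite !mul0r !subr0 addr0 sub0r.
have -> : b ^+ 2 = 1 - a ^+ 2 -> (1 - r * a) ^+ 2 + (- (r * b)) ^+ 2 = (1 - r) ^+ 2 + 2 * r * (1 - a).
  move=> hb; rewrite sqrrN exprMn hb; ring.
  by [].
by rewrite -h; ring.
Qed.

(** As [2 * r >= 1], the denominator is at least [1 - cos (2 pi d)]; away from [t] the kernel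
    therefore tends to 0 uniformly as [r] tends to 1. *)
Lemma pk_far (d t s r : R) : 0 < d -> d <= t -> t <= 1 - d -> 0 <= s -> s <= 1 -> d <= `|t - s| ->
  2^-1 <= r -> r < 1 -> pk (r%:C * zeta t) s <= (1 - r ^+ 2) / (1 - cos (2 * pi * d)).
Proof.
move=> d0 dt t1 s0 s1 ds r2 r1.
have r0 : 0 <= r by lra.
have z1 : cnorm (r%:C * zeta t) < 1 by rewrite cnorm_circ.
have pi0 := pi_gt0 R.
have k0 : 0 < 1 - cos (2 * pi * d).
  have m0 : (0 : R) \in `[0, pi] by rewrite in_itv/= lexx ltW.
  have m1 : 2 * pi * d \in `[0, pi] by rewrite in_itv/=; apply/andP; split; nra.
  by rewrite subr_gt0 -[ltRHS](cos0 R) (ltr_cos m0 m1) mulr_gt0// mulr_gt0.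
rewrite pkE// csqM csq_ee mulr1 (_ : csq r%:C = r ^+ 2); last by rewrite /csq/= expr0n addr0.
apply: ler_wpM2l; first by rewrite subr_ge0 expr_le1// ltW.
have e : zeta t * conjc (zeta s) = ee (2 * pi * (t - s)).
  by rewrite /zeta -eeN -eeD; congr ee; ring.
rewrite -mulrA e csq_1B ?csq_ee//=.
have h := cos_far d0 dt t1 s0 s1 ds.
have k1 : 1 - cos (2 * pi * d) <= (1 - r) ^+ 2 + 2 * r * (1 - cos (2 * pi * (t - s))).
  have := sqr_ge0 (1 - r); nra.
by rewrite lef_pV2 ?posrE// (lt_le_trans k0).
Qed.

(** With [d] the distance from [t] to 0, 1 and [b], the step function takes the value [step b t] at
    all points closer than [d] to [t], so only the far part of the kernel contributes to the
    difference. *)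
Lemma poisson_step (b t : R) : 0 < t -> t < 1 -> t != b ->
  Re (circ (Her (step b)) (rj j) t) @[j --> \oo] --> step b t.
Proof.
move=> t0 t1 tb.
pose d := Num.min (Num.min t (1 - t)) `|t - b|.
have d0 : 0 < d by rewrite !lt_min t0 subr_gt0 t1 normr_gt0 subr_eq0.
have [dt [dt1 db]] : d <= t /\ d <= 1 - t /\ d <= `|t - b| by rewrite !ge_min !lexx ?orbT.
have pi0 := pi_gt0 R.
pose k := (1 - cos (2 * pi * d))^-1.
have hb : \forall j \near \oo, `|Re (circ (Her (step b)) (rj j) t) - step b t| <= (1 - rj j ^+ 2) * k.
  have h2 : \forall j \near \oo, 2^-1 <= rj j.
    by apply: (cvgr_ge (1 : R)); [exact: cvg_rj|have [] := half01 R].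
  near=> j.
  have r2 : 2^-1 <= rj j by near: j.
  have r1 := rj_lt1 j.
  have z1 := circ_lt1 j t.
  have ip c : integr (fun s => pk ((rj j)%:C * zeta t) s * c).
    by apply: integr_pk => //; exact: integr_cst.
  have iss := integr_pk z1 (integr_step b).
  have -> : step b t = ri (fun s => pk ((rj j)%:C * zeta t) s * step b t).
    rewrite (eq_ri (g := fun s => step b t * pk ((rj j)%:C * zeta t) s)); last by move=> s _; rewrite mulrC.
    rewrite riZ ?ri_pk ?mulr1//.
    by apply: eq_integr (ip 1) => s _; rewrite mulr1.
  rewrite /circ Re_Her -riB//.
  apply: le_trans (ri_abs (integrB iss (ip _))) _.
  rewrite -[leRHS]ri_cst; apply: ri_le.
  - exact/integr_abs/integrB.
  - exact: integr_cst.
  move=> s; rewrite /I01 /= in_itv/= => /andP[s0 s1].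
  have pf : d <= `|t - s| -> pk ((rj j)%:C * zeta t) s <= (1 - rj j ^+ 2) * k.
    by move=> ds; apply: pk_far => //; lra.
  rewrite -mulrBr normrM (ger0_norm (pk_ge0 _ z1)).
  have k0 : 0 <= (1 - rj j ^+ 2) * k.
    apply: mulr_ge0; first by rewrite subr_ge0 expr_le1// ?rj_ge0// ltW.
    by rewrite invr_ge0 subr_ge0 cos_le1.
  rewrite /step; case: (leP s b) => sb; case: (leP t b) => tb'; rewrite ?subrr ?normr0 ?mulr0//.
    rewrite subr0 normr1 mulr1; apply: pf; rewrite (le_trans db)//.
    by rewrite !gtr0_norm; lra.
  rewrite sub0r normrN normr1 mulr1; apply: pf; rewrite (le_trans db)//.
  by rewrite (ler0_norm (x := t - b)) ?ler0_norm; lra.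
apply/cvgrPdist_le => e e0.
have hk : (1 - rj j ^+ 2) * k @[j --> \oo] --> (0 : R).
  rewrite -[X in _ --> X](mul0r k); apply: cvgMl.
  rewrite -[X in _ --> X](subrr 1); apply: cvgB; first exact: cvg_cst.
  rewrite -[X in _ --> X](expr1n _ 2); rewrite !expr2.
  by under eq_fun do rewrite expr2; apply: cvgM; exact: cvg_rj.
move/cvgrPdist_le : hk => /(_ _ e0) hk.
near=> j; rewrite distrC.
apply: (@le_trans _ _ ((1 - rj j ^+ 2) * k)); first by near: j.
apply: (@le_trans _ _ `|0 - (1 - rj j ^+ 2) * k|); last by near: j.
by rewrite sub0r normrN ler_norm.
Unshelve. all: by end_near. Qed.

(** The primitive of the extension of [g] by 0 vanishes identically, and by Lebesgue's
    differentiation theorem its derivative is [g] almost everywhere. *)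
Lemma ri_step_ae0 (g : R -> R) : integr g -> (forall b, ri (fun t => g t * step b t) = 0) ->
  {ae mu, forall t, D t -> g t = 0}.
Proof.
move=> ig gb; pose f : R -> R := g \_ D.
have iT : mu.-integrable setT (EFin \o f).
  have := ig; rewrite /integr integrable_mkcond; last exact: mI01.
  by rewrite restrict_EFin.
have lf : locally_integrable [set: R] f.
  exact: (integrable_locally_restrict (@mI01 R) ig).
have iy y : mu.-integrable `]-oo, y] (EFin \o f).
  by apply: integrableS iT => //; exact: measurableT.
have F0 y : (\int[lebesgue_measure]_(t in [set` `]-oo, y]]) f t)%R = 0.
  rewrite -(gb y) /ri Rintegral_mkcond [RHS]Rintegral_mkcond; apply: eq_Rintegral => t _.
  rewrite !patchE /f patchE mem_setE in_itv/= /step.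
  by case: ifP => h1; case: ifP => h2 //; rewrite ?mulr0 ?mulr1.
have := FTC1Ny iy lf; apply: (@filterS _ _ (ae_filter_ringOfSetsType _)) => t [_].
rewrite (_ : (fun x => _) = cst 0); last by apply/funext => x; rewrite F0.
rewrite derive1_cst /f patchE => + Dt.
by rewrite mem_set.
Qed.

Lemma ae_neq (c : R) : {ae mu, forall t, D t -> t != c}.
Proof.
exists [set c]; split; [exact: measurable_set1|exact: lebesgue_measure_set1|].
by move=> t /= h; apply: contrapT => tc; apply: h => _; apply/eqP.
Qed.

(* Pairing [f] with the Poisson integrals of the indicators of [0, b] gives
   [\int_0^b f = 0] for all [b]. *)
Theorem fcoef_unique f : cL1 f -> (forall n : int, fcoef f n = 0) -> aezero f.
Proof.
move=> hf fn.
(* Meant for [k] the real or the imaginary part. Dominated convergence applies because the Poisson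
   integral of a step function, an average of values in [0, 1], is bounded by 1. *)
have key (k : C -> R) (b : R) : (forall x y, k (x * y%:C) = k x * y) -> mea (fun t => k (f t)) ->
    (forall x, `|k x| <= cnorm x) ->
    (forall j, ri (fun t => k (f t * (Re (circ (Her (step b)) (rj j) t))%:C)) = 0) ->
    ri (fun t => k (f t) * step b t) = 0.
  move=> kM mk kle k0.
  have [] := @ri_dct _ (fun j t => k (f t) * Re (circ (Her (step b)) (rj j) t))
    (fun t => k (f t) * step b t) (fun t => cnorm (f t)).
  - move=> j; apply: meaM => //.
    exact: (inA_meas (inA_Her (integr_step b)) (rj_ge0 j) (rj_lt1 j)).1.
  - by apply: meaM => //; exact: mea_step.
  - exact: hf.2.
  - have hneq : {ae mu, forall t, D t -> 0 < t < 1}.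
      apply: ae2 (ae_neq 0) (ae_neq 1) => t; rewrite /I01 /= in_itv/= => /andP[t0 t1] n0 n1.
      by rewrite !lt_neqAle t0 t1 n1 eq_sym n0.
    apply: ae2 hneq (ae_neq b) => t _ /andP[t0 t1] tb.
    by apply: cvgMr; exact: poisson_step.
  - apply: aeW => t Dt j; rewrite normrM (le_trans _ (kle (f t)))// ler_piMr//.
    rewrite ler_norml /circ Re_Her; have z1 := circ_lt1 j t; apply/andP; split.
      apply: (@le_trans _ _ 0); first by rewrite lerN10.
      apply: ri_ge0 => s _; apply: mulr_ge0; first exact: pk_ge0.
      by have /andP[] := step01 b s.
    rewrite -(ri_pk z1); apply: ri_le.
    + by apply: integr_pk => //; exact: integr_step.
    + by apply: eq_integr (integr_pk z1 (integr_cst 1)) => s _; rewrite mulr1.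
    + by move=> s _; have /andP[? ?] := step01 b s; rewrite ler_piMr// pk_ge0.
  move=> _ h; apply/esym; apply: (cvg_unique _ _ h) => //.
  rewrite (_ : (fun n => _) = cst 0); first exact: cvg_cst.
  by apply/funext => j; rewrite -(k0 j); apply: eq_ri => t _; rewrite kM.
(* The Poisson integral is half the sum of an analytic trace and its conjugate. The vanishing
   coefficients of [f] of index at most 0 annihilate the former, those of index at least 0 the
   latter. *)
have cz b j : cint (fun t => f t * (Re (circ (Her (step b)) (rj j) t))%:C) = 0.
  have hA := inA_Her (integr_step b).
  have h1 := cint_inA0 hf hA (fun n => fn _) (rj_ge0 j) (rj_lt1 j).
  have hJ : forall n : nat, fcoef (fun t => conjc (f t)) (- n%:Z) = 0.
    move=> n; rewrite fcoef_neg -[RHS](conjc0 R) -(fn n%:Z) fcoef_nat -cintJ; last exact: cL1MJX.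
    by apply: eq_cint => t _; rewrite cJM cJX conjcK.
  have h2 := cint_inA0 (cL1J hf) hA hJ (rj_ge0 j) (rj_lt1 j).
  have [M M0 hM] := inA_bdd hA (rj_ge0 j) (rj_lt1 j).
  have bddM g : cL1 g -> cL1 (fun t => g t * circ (Her (step b)) (rj j) t).
    move=> hg; apply: (@eq_cL1 _ (fun t => circ (Her (step b)) (rj j) t * g t)) => [t _|]; first by rewrite mulrC.
    apply: (@cL1Mb _ _ _ M) hg; first by apply: inA_meas => //; [exact: rj_ge0|exact: rj_lt1].
    by move=> t _; apply: hM; rewrite cnorm_circ// rj_ge0.
  have h3 : cint (fun t => f t * conjc (circ (Her (step b)) (rj j) t)) = 0.
    rewrite -[RHS](conjc0 R) -h2 -cintJ; last exact/bddM/cL1J.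
    by apply: eq_cint => t _; rewrite cJM conjcK.
  have i3 : cL1 (fun t => f t * conjc (circ (Her (step b)) (rj j) t)).
    by apply: eq_cL1 (cL1J (bddM _ (cL1J hf))) => t _; rewrite cJM conjcK.
  rewrite (eq_cint (g := fun t => 2^-1%:C * (f t * circ (Her (step b)) (rj j) t +
      f t * conjc (circ (Her (step b)) (rj j) t)))).
    rewrite cintZ; last by apply: cL1D => //; exact: bddM.
    by rewrite cintD// ?h1 ?h3 ?addr0 ?mulr0//; exact: bddM.
  move=> t _; move: (circ _ _ _) => w; rewrite -mulrDr mulrCA; congr (_ * _).
  by apply: eqC; rewrite !cE /=; field.
have hR := ri_step_ae0 (cL1_Re hf); have hI := ri_step_ae0 (cL1_Im hf).
have zR b : ri (fun t => Re (f t) * step b t) = 0.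
  apply: key => [x y||x|j].
  - by rewrite cE /= mulr0 subr0.
  - by have [[]] := hf.
  - exact: Re_le.
  - exact: (congr1 (@complex.Re R) (cz b j)).
have zI b : ri (fun t => Im (f t) * step b t) = 0.
  apply: key => [x y||x|j].
  - by rewrite cE /= mulr0 add0r.
  - by have [[]] := hf.
  - exact: Im_le.
  - exact: (congr1 (@complex.Im R) (cz b j)).
by apply: ae2 (hR zR) (hI zI) => t _ h1 h2; apply: eqC.
Qed.

End Uniqueness.

(** * Bessel and Riesz-Fischer *)

Section L2theory.
Variable R : realType.
Local Notation C := R[i].
Implicit Types (f g h : R -> C) (z w : C) (a b : nat -> C).

Local Notation mu := (@leb R).
Local Notation D := (@I01 R).

Definition tp a (N : nat) : R -> C := fun t => \sum_(n < N) a n * zeta t ^+ n.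

Lemma tp_poly a N t : tp a N t = circ (horner (\poly_(n < N) a n)) 1 t.
Proof.
by rewrite /circ horner_poly cplx1 mul1r.
Qed.
Lemma L2_tp a N : inL2 (tp a N).
Proof.
apply: L2_sum => i; apply: L2Z; apply: (@L2_bdd _ _ 1); first exact: cmeas_zetaX.
by move=> t _; rewrite -cnorm_sq cnorm_zetaX expr1n.
Qed.
Lemma fcoef_tp a N (n : nat) : fcoef (tp a N) n%:Z = if (n < N)%N then a n else 0.
Proof.
rewrite fcoef_nat (eq_cint (g := fun t => circ (horner (\poly_(n < N) a n)) 1 t * conjc (zeta t) ^+ n)).
  by rewrite poly_coef coef_poly cplx1 expr1n mulr1.
by move=> t _; rewrite tp_poly.
Qed.
Lemma fcoef_tp_neg a N (n : nat) : (0 < n)%N -> fcoef (tp a N) (- n%:Z) = 0.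
Proof.
move=> n0; rewrite fcoef_neg (eq_cint (g := fun t => circ (horner (\poly_(n < N) a n)) 1 t * zeta t ^+ n)).
  exact: poly_neg.
by move=> t _; rewrite tp_poly.
Qed.

Lemma cL1_fcoef f (n : int) : cL1 f -> cL1 (fun t => f t * ee (- (2 * pi * n%:~R * t))).
Proof.
move=> hf; case: n => n; last first.
  apply: (@eq_cL1 _ (fun t => f t * zeta t ^+ n.+1)); last exact: cL1MX.
  move=> t _; rewrite /zeta -eeX; congr (_ * ee _).
  by rewrite NegzE -mulr_natl mulrNz; ring.
apply: (@eq_cL1 _ (fun t => f t * conjc (zeta t) ^+ n)); last exact: cL1MJX.
move=> t _; rewrite -cJX /zeta -eeX -eeN; congr (_ * ee _).
by rewrite -mulr_natl; ring.
Qed.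

Lemma fcoefB f g n : cL1 f -> cL1 g -> fcoef (fun t => f t - g t) n = fcoef f n - fcoef g n.
Proof.
move=> hf hg; rewrite /fcoef -cintB; try exact: cL1_fcoef.
by apply: eq_cint => t _; rewrite mulrBl.
Qed.

Lemma csqB z w : csq (z - w) = csq z - 2 * Re (z * conjc w) + csq w.
Proof. by rewrite /csq !cE; ring. Qed.

Lemma cint_tpJ f a N : inL2 f ->
  cint (fun t => f t * conjc (tp a N t)) = \sum_(n < N) conjc (a n) * fcoef f n%:Z.
Proof.
move=> hf; rewrite (eq_cint (g := fun t => \sum_(n < N) conjc (a n) * (f t * conjc (zeta t) ^+ n))).
  rewrite cint_sum; last by move=> i; apply: cL1Z; apply: cL1MJX; exact: L2_L1.
  apply: eq_bigr => i _; rewrite cintZ ?fcoef_nat//; apply: cL1MJX; exact: L2_L1.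
move=> t _; rewrite /tp (@rmorph_sum _ _ (@conjc R)) mulr_sumr.
by apply: eq_bigr => i _; rewrite -cJX mulrCA -cJM.
Qed.

Lemma nsq_tp a N : nsq (tp a N) = \sum_(n < N) csq (a n).
Proof.
have h : nsq (tp a N) = Re (cint (fun t => tp a N t * conjc (tp a N t))).
  by apply: eq_ri => t _; rewrite mulJ.
rewrite h cint_tpJ; last exact: L2_tp.
rewrite (eq_bigr (fun n : 'I_N => (csq (a n))%:C)).
  by elim/big_ind2: _ => // x1 y1 x2 y2 h1 h2; rewrite cE h1 h2.
by move=> n _; rewrite fcoef_tp ltn_ord mulrC mulJ.
Qed.

Lemma nsqB f g : inL2 f -> inL2 g ->
  nsq (fun t => f t - g t) = nsq f - 2 * Re (cint (fun t => f t * conjc (g t))) + nsq g.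
Proof.
move=> hf hg; have hL := L2M_L1 hf (L2J hg).
rewrite /nsq -[Re _]/(ri _) -riZ; last exact: cL1_Re.
have i1 := L2_csq hf; have i2 := L2_csq hg; have i3 := integrZ 2 (cL1_Re hL).
rewrite -riB// -riD//; last exact: integrB.
by apply: eq_ri => t _; rewrite csqB.
Qed.

(** Expand the nonnegative squared distance from [f] to the partial sum built from its own
    coefficients. *)
Lemma bessel f N : inL2 f -> \sum_(n < N) csq (fcoef f n%:Z) <= nsq f.
Proof.
move=> hf; pose a (n : nat) := fcoef f n%:Z.
have := nsq_ge0 (fun t => f t - tp a N t).
rewrite nsqB//; last exact: L2_tp.
rewrite cint_tpJ// nsq_tp.
have -> : Re (\sum_(n < N) conjc (a n) * fcoef f n%:Z) = \sum_(n < N) csq (a n).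
  rewrite (eq_bigr (fun n : 'I_N => (csq (a n))%:C)).
    by elim/big_ind2: _ => // x1 y1 x2 y2 h1 h2; rewrite cE h1 h2.
  by move=> n _; rewrite mulrC mulJ.
rewrite -/(a _); lra.
Qed.

Lemma tpB a N M : (N <= M)%N -> forall t,
  tp a M t - tp a N t = tp (fun n => if (n < N)%N then 0 else a n) M t.
Proof.
move=> NM t; rewrite /tp (big_ord_widen_cond _ xpredT (fun n => a n * zeta t ^+ n) NM).
rewrite [X in _ - X]big_mkcond -sumrB; apply: eq_bigr => i _ /=.
by case: ifP => _; rewrite ?subrr ?subr0 ?mul0r.
Qed.

Lemma nsq_tpB a N M : (N <= M)%N ->
  nsq (fun t => tp a M t - tp a N t) = \sum_(n < M) csq (a n) - \sum_(n < N) csq (a n).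
Proof.
move=> NM; rewrite (eq_nsq (fun t _ => tpB a NM t)) nsq_tp.
rewrite (big_ord_widen_cond _ xpredT (fun n => csq (a n)) NM).
rewrite [X in _ - X]big_mkcond -sumrB; apply: eq_bigr => i _ /=.
by case: ifP => _; rewrite ?subrr ?subr0// /csq /= expr0n addr0.
Qed.

Lemma sum_cauchy (x : nat -> R) (K : R) : (forall n, 0 <= x n) ->
  (forall N, \sum_(n < N) x n <= K) -> forall e, 0 < e ->
  exists N, forall M, (N <= M)%N -> \sum_(n < M) x n - \sum_(n < N) x n <= e.
Proof.
move=> x0 xK e e0; pose s N := \sum_(n < N) x n.
have nd : {homo s : n m / (n <= m)%N >-> n <= m}.
  by apply/nondecreasing_seqP => n; rewrite /s big_ord_recr /= lerDl.
have cs : cvgn s.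
  by apply: nondecreasing_is_cvgn => //; exists K => _ [n _ <-]; exact: xK.
have /cvgrPdist_le /(_ _ e0)[N _ hN] := cs.
exists N => M NM; have h1 := hN N (leqnn _).
have h2 : s M <= limn s by exact: nondecreasing_cvgn_le.
have := le_trans (ler_norm _) h1; rewrite -/(s _) -/(s _); lra.
Qed.

(** Beppo Levi: by monotone convergence the sum of the series has integral at most [K], hence is
    finite almost everywhere. *)
Lemma ae_summable (x : nat -> R -> R) (K : R) : (forall n, integr (x n)) ->
  (forall n t, D t -> 0 <= x n t) -> (forall N, \sum_(n < N) ri (x n) <= K) ->
  {ae mu, forall t, D t -> exists B, forall n, \sum_(i < n) x i t <= B}.
Proof.
move=> ix x0 xK; pose G t : \bar R := (\sum_(0 <= n <oo) (x n t)%:E)%E.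
have mx n : measurable_fun D (fun t => (x n t)%:E).
  by apply/measurable_EFinP; exact: mea_integr.
have G0 t : D t -> (0 <= G t)%E by move=> Dt; apply: nneseries_ge0 => n _ _; rewrite lee_fin x0.
have iG : (\int[mu]_(t in D) G t <= K%:E)%E.
  rewrite /G (integral_nneseries _ (@mI01 R))//.
  apply: lime_le.
    by apply: is_cvg_nneseries => n _ _; apply: integral_ge0 => t Dt; rewrite lee_fin x0.
  apply: nearW => n; rewrite big_mkord (eq_bigr (fun i : 'I_n => (ri (x i))%:E)).
    rewrite sumEFin lee_fin; exact: xK.
  by move=> i _; rewrite ri_EFin.
have mG : measurable_fun D G.
  by apply: ge0_emeasurable_sum => // n t Dt _; rewrite lee_fin x0.
have iG' : mu.-integrable D G.
  apply/integrableP; split => //.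
  rewrite (@eq_integral _ _ _ mu D G); first by rewrite (le_lt_trans iG)// ltry.
  by move=> t /set_mem Dt; rewrite gee0_abs// G0.
have := integrable_ae (@mI01 R) iG'.
apply: (@filterS _ _ (ae_filter_ringOfSetsType _)) => t h Dt.
exists (fine (G t)) => n; rewrite -lee_fin fineK ?h//.
rewrite -sumEFin -(big_mkord xpredT (fun i => (x i t)%:E)).
by apply: nneseries_lim_ge => i _ _; rewrite lee_fin x0.
Qed.

Lemma cvg_geo (s : nat -> R) (B : R) : (forall k, `|s k.+1 - s k| <= B * 2^-1 ^+ k) -> cvgn s.
Proof.
move=> h; pose d k := s k.+1 - s k.
have hd : cvgn (series d).
  apply: normed_cvg; apply: (@series_le_cvg _ (fun n => `|d n|) (geometric B 2^-1)).
  - by move=> n; exact: normr_ge0.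
  - by move=> n; exact: (le_trans (normr_ge0 _) (h n)).
  - by move=> n; exact: h.
  - by apply: is_cvg_geometric_series; rewrite ger0_norm// invf_lt1// ltr1n.
have e : s = (fun n => s 0%N + series d n).
  apply/funext => n; rewrite /series /= (telescope_sumr s)//; ring.
by rewrite e; apply: is_cvgD => //; exact: is_cvg_cst.
Qed.

Lemma csq_cvg (x : nat -> C) (a b : R) w :
  (fun k => Re (x k)) @ \oo --> a -> (fun k => Im (x k)) @ \oo --> b ->
  (fun k => csq (x k - w)) @ \oo --> csq (Complex a b - w).
Proof.
move=> xa xb; rewrite /csq !cE /=.
have e : (fun k => Re (x k - w) ^+ 2 + Im (x k - w) ^+ 2) =
   (fun k => (Re (x k) - Re w) * (Re (x k) - Re w) + (Im (x k) - Im w) * (Im (x k) - Im w)).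
  by apply/funext => k; rewrite !cE !expr2.
rewrite e !expr2; apply: cvgD; apply: cvgM; apply: cvgB => //; exact: cvg_cst.
Qed.

(** A rapidly convergent subsequence of the partial sums converges almost everywhere, and Fatou's
    lemma along it bounds the distance from its limit to every late partial sum. *)
Theorem riesz_fischer a (K : R) : (forall N, \sum_(n < N) csq (a n) <= K) ->
  exists f, inL2 f /\ forall e, 0 < e -> exists N0, forall N, (N0 <= N)%N ->
    nsq (fun t => f t - tp a N t) <= e.
Proof.
move=> aK; pose s N := \sum_(n < N) csq (a n).
have nd N M : (N <= M)%N -> s N <= s M.
  by have := nsq_ge0 (fun t => tp a M t - tp a N t) => + NM; rewrite nsq_tpB// subr_ge0.
have ca := sum_cauchy (fun n => csq_ge0 (a n)) aK.
have /choice[n0 hn0] : forall k : nat, exists N, forall M, (N <= M)%N -> s M - s N <= 8^-1 ^+ k.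
  by move=> k; apply: ca; rewrite exprn_gt0.
(* Running maxima make the subsequence of indices nondecreasing, so that [nsq_tpB] applies to
   consecutive terms. *)
pose Nk (k : nat) := \max_(i < k.+1) n0 i.
have Nk_ge k : (n0 k <= Nk k)%N by exact: (leq_bigmax (F := fun i : 'I_k.+1 => n0 i) ord_max).
have NkS k : (Nk k <= Nk k.+1)%N.
  apply/bigop.bigmax_leqP => i _.
  exact: (leq_bigmax (F := fun i : 'I_k.+2 => n0 i) (widen_ord (leqnSn _) i)).
have hN k M : (Nk k <= M)%N -> s M - s (Nk k) <= 8^-1 ^+ k.
  move=> kM; have h1 := hn0 k M (leq_trans (Nk_ge k) kM).
  by have := nd _ _ (Nk_ge k); lra.
pose S k := tp a (Nk k).
pose d k t := csq (S k.+1 t - S k t).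
have id k : integr (d k) by apply: L2_csq; apply: L2B; exact: L2_tp.
have rd k : ri (d k) <= 8^-1 ^+ k.
  by rewrite -[ri _]/(nsq _) nsq_tpB//; exact: hN.
(* Since [4 / 8 = 1 / 2], the weights [4 ^+ k] leave a series of integrals of sum at most 2.
   Boundedness of [4 ^+ k * d k t] then makes the increments of [S] at [t] of order [2^-1 ^+ k]. *)
have := @ae_summable (fun k t => 4 ^+ k * d k t) 2.
move=> /(_ (fun k => integrZ _ (id k))) h1.
have {h1} ae1' : {ae mu, forall t, D t -> exists B, forall n, 4 ^+ n * d n t <= B}.
  have : {ae mu, forall t, D t -> exists B, forall n, \sum_(i < n) 4 ^+ i * d i t <= B}; last first.
    apply: ae1 => t Dt [B hB]; exists B => n; apply: le_trans (hB n.+1).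
    rewrite big_ord_recr /= lerDr sumr_ge0// => i _.
    by rewrite mulr_ge0// ?exprn_ge0// csq_ge0.
  apply: h1 => [k t _|N]; first by rewrite mulr_ge0// ?exprn_ge0// csq_ge0.
  apply: (@le_trans _ _ (\sum_(k < N) 2^-1 ^+ k)).
    apply: ler_sum => k _; rewrite riZ//.
    apply: le_trans (ler_wpM2l _ (rd k)) _; first by rewrite exprn_ge0.
    by rewrite -exprMn (_ : 4 * 8^-1 = 2^-1 :> R)//; field.
  have [h0 h1] := half01 R; apply: le_trans (geo_le N h0 h1) _.
  by rewrite (_ : (1 - 2^-1)^-1 = 2 :> R)//; field.
(* An upper limit is measurable regardless of convergence and equals the limit where there is one;
   [fine] sends infinite values to 0. *)
pose fr t := fine (limn_esup (fun k => (Re (S k t))%:E)).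
pose fi t := fine (limn_esup (fun k => (Im (S k t))%:E)).
pose f t : C := Complex (fr t) (fi t).
have mS k : cmeas (S k) by apply: L2_cmeas; exact: L2_tp.
have mf : cmeas f.
  split.
    apply: (measurableT_comp (@fine_measurable _ _ measurableT)) => //.
    by apply: measurable_fun_limn_esup => k; apply/measurable_EFinP; have [] := mS k.
  apply: (measurableT_comp (@fine_measurable _ _ measurableT)) => //.
  by apply: measurable_fun_limn_esup => k; apply/measurable_EFinP; have [] := mS k.
have cvS : {ae mu, forall t, D t -> ((fun k => Re (S k t)) @ \oo --> fr t) /\
                                    ((fun k => Im (S k t)) @ \oo --> fi t)}.
  apply: ae1 ae1' => t Dt [B hB].
  have B0 : 0 <= B by apply: le_trans (hB 0%N); rewrite expr0 mul1r csq_ge0.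
  have hs k : cnorm (S k.+1 t - S k t) <= Num.sqrt B * 2^-1 ^+ k.
    rewrite cnormE -[2^-1 ^+ k]ger0_norm ?exprn_ge0// -sqrtr_sqr -sqrtrM//.
    rewrite ler_sqrt; last by rewrite mulr_ge0// sqr_ge0.
    rewrite -exprM mulnC exprM expr2 (_ : 2^-1 * 2^-1 = 4^-1 :> R); last by field.
    by rewrite exprVn ler_pdivlMr ?exprn_gt0// mulrC; exact: hB.
  have cvgfine (x : nat -> R) : cvgn x -> x @ \oo --> fine (limn_esup (fun k => (x k)%:E)).
    move=> /cvg_ex[l xl].
    have xl' : (x k)%:E @[k --> \oo] --> l%:E by apply/fine_cvgP; split; [exact: nearW|].
    by rewrite (cvg_limn_einf_sup xl').2.
  split; apply: cvgfine; apply: (@cvg_geo _ (Num.sqrt B)) => k.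
    by apply: le_trans (hs k); rewrite -ReN -ReD; exact: Re_le.
  by apply: le_trans (hs k); rewrite -ImN -ImD; exact: Im_le.
have key e N0 : (forall M, (N0 <= M)%N -> s M - s N0 <= e) -> 0 < e -> forall N, (N0 <= N)%N ->
    integr (fun t => csq (f t - tp a N t)) /\ nsq (fun t => f t - tp a N t) <= e.
  move=> hM e0 N NN.
  have L2d k : inL2 (fun t => S k t - tp a N t) by apply: L2B; exact: L2_tp.
  apply: (@ri_fatou _ (fun k t => csq (S k t - tp a N t))) => //.
  - by move=> k; exact: L2_csq.
  - by apply: mea_csq; apply: cmeasB => //; apply: L2_cmeas; exact: L2_tp.
  - by apply: ae1 cvS => t Dt [h1 h2]; exact: csq_cvg.
  - have [p8 q8] : 0 <= 8^-1 :> R /\ 8^-1 < 1 :> R by split; lra.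
    have [K0 hK0] := pow_small 1 p8 q8 e0.
    exists K0 => // k /= kK; rewrite -/(nsq _).
    (* If the subsequence has passed [N], the Cauchy tail from [N0] bounds the distance; otherwise
       the tail after [Nk k], at most [8^-1 ^+ k], is already below [e]. *)
    case: (leqP N (Nk k)) => h.
      rewrite nsq_tpB//; have := hM _ (leq_trans NN h); have := nd _ _ NN.
      by rewrite -/(s _) -/(s _); lra.
    rewrite (eq_nsq (g := fun t => - (tp a N t - S k t))) ?nsqN; last by move=> t _; rewrite opprB.
    rewrite nsq_tpB; last exact: ltnW.
    have := hN k _ (ltnW h); have := hK0 k kK; rewrite mulr1.
    by rewrite -/(s _) -/(s _); lra.
have [N1 hN1] := ca _ ltr01.
have iff : inL2 f.
  have [i1 _] := key 1 N1 hN1 ltr01 N1 (leqnn _).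
  have h1 : inL2 (fun t => f t - tp a N1 t).
    by apply/inL2P; split => //; apply: cmeasB => //; apply: L2_cmeas; exact: L2_tp.
  by apply: eq_L2 (L2D h1 (L2_tp a N1)) => t _; rewrite subrK.
exists f; split => // e e0; have [N0 hN0] := ca _ e0; exists N0 => N NN.
by have [_] := key e N0 hN0 e0 N NN.
Qed.

Lemma ri_cnorm_le f (e : R) : 0 < e -> inL2 f -> nsq f <= e ^+ 2 -> ri (fun t => cnorm (f t)) <= 2 * e.
Proof.
move=> e0 hf h; have ei : 0 < e^-1 by rewrite invr_gt0.
have := ri_cnormM_le ei hf (L2_cst 1); rewrite (eq_ri (g := fun t => cnorm (f t))); last first.
  by move=> t _; rewrite mulr1.
move=> /le_trans; apply; rewrite invrK.
have -> : nsq (fun=> 1 : C) = 1 by rewrite /nsq ri_cst /csq /= expr1n expr0n addr0.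
rewrite mulr1 (_ : 2 * e = e + e); last by ring.
rewrite lerD2r -(ler_pM2l e0) mulrA divff ?gt_eqF// mul1r -expr2 //.
Qed.

(** * Convergence in L^2 and in L^1 *)

Definition L2cvg (F : nat -> R -> C) f := (forall n, inL2 (F n)) /\ inL2 f /\
  forall e, 0 < e -> exists N, forall n, (N <= n)%N -> nsq (fun t => F n t - f t) <= e.
Definition L1cvg (F : nat -> R -> C) f := (forall n, cL1 (F n)) /\ cL1 f /\
  forall e, 0 < e -> exists N, forall n, (N <= n)%N -> ri (fun t => cnorm (F n t - f t)) <= e.

Lemma L2cvg_L1 F f : L2cvg F f -> L1cvg F f.
Proof.
move=> [h1 [h2 h3]]; split; [by move=> n; exact: L2_L1|split; first exact: L2_L1].
move=> e e0; have e2 : 0 < e / 2 by rewrite divr_gt0.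
have [N hN] := h3 _ (exprn_gt0 2 e2); exists N => n Nn.
apply: le_trans (ri_cnorm_le e2 (L2B (h1 n) h2) (hN n Nn)) _.
by rewrite mulrC divfK.
Qed.

Lemma L2_small f (G : nat -> R -> C) g e : inL2 f -> L2cvg G g -> 0 < e ->
  exists N, forall n, (N <= n)%N -> ri (fun t => cnorm (f t * (G n t - g t))) <= e.
Proof.
move=> hf [h1 [h2 h3]] e0; have n0 := nsq_ge0 f.
(* This weight makes [d * nsq f] at most [e / 2]; the large opposite weight [d^-1] is absorbed by
   the smallness of [nsq (G n - g)]. *)
pose d := e / (2 * (nsq f + 1)).
have d0 : 0 < d by rewrite divr_gt0// mulr_gt0// ltr_wpDl.
have de : 0 < d * (e / 2) by rewrite mulr_gt0// divr_gt0.
have [N hN] := h3 _ de; exists N => n Nn.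
apply: le_trans (ri_cnormM_le d0 hf (L2B (h1 n) h2)) _.
rewrite (splitr e); apply: lerD.
  rewrite /d mulrAC ler_pdivrMr ?mulr_gt0// ?ltr_wpDl//.
  rewrite (_ : e / 2 * _ = e * (nsq f + 1)); last by field.
  by rewrite ler_pM2l// lerDl.
by rewrite -(ler_pM2l d0) mulrA divff ?gt_eqF// mul1r; exact: hN.
Qed.

Lemma L2cvgM F G f g : L2cvg F f -> L2cvg G g ->
  L1cvg (fun n t => F n t * G n t) (fun t => f t * g t).
Proof.
move=> hF hG; have [F1 [F2 F3]] := hF; have [G1 [G2 G3]] := hG.
split; first by move=> n; exact: L2M_L1.
split; first exact: L2M_L1.
(* One quarter for each of the two cross terms, and two for the product of the differences, which is
   bounded by the sum of their squared norms. *)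
move=> e e0; have e4 : 0 < e / 4 by rewrite divr_gt0.
have [N1 h1] := L2_small F2 hG e4; have [N2 h2] := L2_small G2 hF e4.
have [N3 h3] := F3 _ e4; have [N4 h4] := G3 _ e4.
exists (maxn (maxn N1 N2) (maxn N3 N4)) => n; rewrite !geq_max => /andP[/andP[n1 n2] /andP[n3 n4]].
have dF := L2B (F1 n) F2; have dG := L2B (G1 n) G2.
have h5 := ri_cnormM_le ltr01 dF dG.
have i1 := (L2M_L1 F2 dG).2; have i2 := (L2M_L1 G2 dF).2; have i3 := (L2M_L1 dF dG).2.
apply: (@le_trans _ _ (ri (fun t => cnorm (f t * (G n t - g t)) + cnorm (g t * (F n t - f t)) +
   cnorm ((F n t - f t) * (G n t - g t))))).
  apply: ri_le.
  - by apply: (cL1B _ _).2; exact: L2M_L1.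
  - by apply: integrD => //; exact: integrD.
  - move=> t _; rewrite (_ : _ - _ = f t * (G n t - g t) + g t * (F n t - f t) +
      (F n t - f t) * (G n t - g t)); last by ring.
    by apply: le_trans (cnormD _ _) _; rewrite lerD2r cnormD.
rewrite riD//; last exact: integrD.
rewrite riD//; have := h1 n n1; have := h2 n n2; have := h3 n n3; have := h4 n n4.
by move: h5; rewrite invr1; lra.
Qed.

Lemma L1cvg_cint F f : L1cvg F f -> forall e, 0 < e -> exists N, forall n, (N <= n)%N ->
  cnorm (cint (F n) - cint f) <= e.
Proof.
move=> [h1 [h2 h3]] e e0; have [N hN] := h3 e e0; exists N => n Nn.
rewrite -cintB//; apply: le_trans (cint_norm (cL1B (h1 n) h2)) _; exact: hN.
Qed.

Lemma L1cvg_uni F f (u : R -> C) : cmeas u -> (forall t, cnorm (u t) = 1) -> L1cvg F f ->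
  L1cvg (fun n t => F n t * u t) (fun t => f t * u t).
Proof.
move=> mu1 u1 [h1 [h2 h3]].
have hL h : cL1 h -> cL1 (fun t => h t * u t).
  move=> hh; apply: (@eq_cL1 _ (fun t => u t * h t)) => [t _|]; first by rewrite mulrC.
  by apply: (@cL1Mb _ _ _ 1) => // t _; rewrite u1.
split; first by move=> n; exact: hL.
split; first exact: hL.
move=> e e0; have [N hN] := h3 e e0; exists N => n Nn.
rewrite (eq_ri (g := fun t => cnorm (F n t - f t))); first exact: hN.
by move=> t _; rewrite -mulrBl cnormM u1 mulr1.
Qed.

Lemma L1cvg_cint_eq F f (c : C) : L1cvg F f ->
  (forall e, 0 < e -> exists N, forall n, (N <= n)%N -> cnorm (cint (F n) - c) <= e) -> cint f = c.
Proof.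
move=> hF hc; apply/eqP; rewrite -subr_eq0; apply/eqP; apply: (@cnorm_small _ _ 2) => e e0.
have [N hN] := L1cvg_cint hF e0; have [M hM] := hc e e0.
have := hN _ (leq_maxl N M); have := hM _ (leq_maxr N M).
set x := cint (F _) => h1 h2; rewrite (_ : _ - _ = (x - c) - (x - cint f)); last by ring.
by apply: le_trans (cnormB _ _) _; lra.
Qed.

Lemma L1cvg_unique F f g : L1cvg F f -> L1cvg F g -> {ae mu, forall t, D t -> f t = g t}.
Proof.
move=> [h1 [h2 h3]] [_ [g2 g3]].
have hL := cL1B h2 g2.
have : {ae mu, forall t, D t -> cnorm (f t - g t) = 0}.
  apply: ri_eq0; [exact: hL.2|by apply: aeW|].
  apply/ler_addgt0Pr => e e0; rewrite add0r; have e2 : 0 < e / 2 by rewrite divr_gt0.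
  have [N hN] := h3 _ e2; have [M hM] := g3 _ e2.
  have := hN _ (leq_maxl N M); have := hM _ (leq_maxr N M); set k := maxn N M => a1 a2.
  have i1 := (cL1B (h1 k) h2).2; have i2 := (cL1B (h1 k) g2).2.
  apply: (@le_trans _ _ (ri (fun t => cnorm (F k t - g t) + cnorm (F k t - f t)))).
    apply: ri_le; [exact: hL.2|exact: integrD|move=> t _].
    rewrite (_ : f t - g t = (F k t - g t) - (F k t - f t)); last by ring.
    exact: cnormB.
  by rewrite riD//; lra.
by apply: ae1 => t _ /cnorm_eq0 /eqP; rewrite subr_eq0 => /eqP.
Qed.

(** The excess [u] of [cnorm f] over [M] is pointwise at most [cnorm (F n - f)], so its integral is
    0; no subsequence is extracted. *)
Lemma L2cvg_bound F f (M : R) : L2cvg F f -> (forall n t, D t -> cnorm (F n t) <= M) ->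
  {ae mu, forall t, D t -> cnorm (f t) <= M}.
Proof.
move=> hF FM; have [h1 [h2 h3]] := L2cvg_L1 hF.
pose u t := Num.max (cnorm (f t) - M) 0.
have mu1 : mea u.
  apply: mea_max; last exact: mea_cst.
  by apply: meaB; [exact: mea_cnorm h2.1|exact: mea_cst].
have iu : integr u.
  apply: (integr_le mu1 (integrD h2.2 (integr_cst `|M|))) => t _.
  rewrite ger0_norm; last by rewrite le_max lexx orbT.
  have h := ler_norm (- M); rewrite normrN in h.
  have := cnorm_ge0 (f t); have := normr_ge0 M.
  by rewrite ge_max => ? ?; apply/andP; split; lra.
have : {ae mu, forall t, D t -> u t = 0}.
  apply: ri_eq0 => //; first by apply: aeW => t _; rewrite le_max lexx orbT.
  apply/ler_addgt0Pr => e e0; rewrite add0r; have [N hN] := h3 _ e0.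
  apply: le_trans _ (hN N (leqnn _)); apply: ri_le => //.
    exact: (cL1B (h1 N) h2).2.
  move=> t Dt; rewrite /u ge_max cnorm_ge0 andbT lerBlDr.
  have := cnormBD (f t) (F N t); rewrite cnormBC; have := FM N t Dt; lra.
apply: ae1 => t _ h; have : cnorm (f t) - M <= u t by rewrite le_max lexx.
by rewrite h subr_le0.
Qed.

End L2theory.

(** * Boundary values in H^2 *)

Section HardySpace.
Variable R : realType.
Local Notation C := R[i].
Implicit Types (f g h : R -> C) (z w : C) (a b : nat -> C).

Local Notation mu := (@leb R).
Local Notation D := (@I01 R).

Lemma H2P f : inH2 f <-> inL2 f /\ forall n : nat, (0 < n)%N -> fcoef f (- n%:Z) = 0.
Proof.
split=> [[hf h]|[hf h]]; split => //.
  by move=> n n0; apply: h; rewrite oppr_lt0.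
by move=> [//|n] _; rewrite NegzE; apply: h.
Qed.
Lemma H2_0 : inH2 (fun=> 0 : C).
Proof.
apply/H2P; split; first exact: L2_cst.
by move=> n n0; rewrite fcoef_neg -[RHS](cint_cst 0); apply: eq_cint => t _; rewrite mul0r.
Qed.
Lemma H2_L2 f : inH2 f -> inL2 f. Proof. by case. Qed.
Lemma H2_L1 f : inH2 f -> cL1 f. Proof. by move=> /H2_L2; exact: L2_L1. Qed.
Lemma H2_neg f n : inH2 f -> (0 < n)%N -> fcoef f (- n%:Z) = 0.
Proof. by move=> /H2P[_]; exact. Qed.

Lemma ae_fcoef f g n : cmeas f -> cmeas g -> {ae mu, forall t, D t -> f t = g t} ->
  fcoef f n = fcoef g n.
Proof.
have me : cmeas (fun t : R => ee (- (2 * pi * n%:~R * t))).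
  have h : mea (fun t : R => - (2 * pi * n%:~R * t)).
    by apply: meaN; apply: meaM; [exact: mea_cst|exact: mea_id].
  by split; [exact: (mea_cont (@continuous_cos R) h)|exact: (mea_cont (@continuous_sin R) h)].
move=> mf mg fg; apply: ae_cint; try exact: cmeasM.
by apply: ae1 fg => t _ ->.
Qed.

Lemma ae_nsq f g : cmeas f -> cmeas g -> {ae mu, forall t, D t -> f t = g t} -> nsq f = nsq g.
Proof.
move=> mf mg fg; apply: ae_ri; try exact: mea_csq.
by apply: ae1 fg => t _ ->.
Qed.

Lemma ae_L2 f g : cmeas g -> {ae mu, forall t, D t -> f t = g t} -> inL2 f -> inL2 g.
Proof.
move=> mg fg hf; apply: (L2_le_ae mg (L2_csq hf)).
by apply: ae1 fg => t _ ->.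
Qed.

Lemma ae_H2 f g : cmeas g -> {ae mu, forall t, D t -> f t = g t} -> inH2 f -> inH2 g.
Proof.
move=> mg fg [hf h]; split; first exact: ae_L2 fg hf.
by move=> n n0; rewrite -(ae_fcoef n (L2_cmeas hf) mg fg) h.
Qed.

Lemma L2cvg_coef F f n : L2cvg F f -> forall c,
  (forall e, 0 < e -> exists N, forall k, (N <= k)%N -> cnorm (fcoef (F k) n%:Z - c) <= e) ->
  fcoef f n%:Z = c.
Proof.
move=> hF c hc; rewrite fcoef_nat.
apply: (L1cvg_cint_eq (L1cvg_uni (cmeas_zetaJX R n) _ (L2cvg_L1 hF))).
  by move=> t; exact: cnorm_zetaJX.
by move=> e e0; have [N hN] := hc e e0; exists N => k Nk; rewrite -fcoef_nat hN.
Qed.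

Lemma L2cvg_coef_neg F f n : L2cvg F f -> (forall k, fcoef (F k) (- n%:Z) = 0) ->
  fcoef f (- n%:Z) = 0.
Proof.
move=> hF hc; rewrite fcoef_neg.
apply: (L1cvg_cint_eq (L1cvg_uni (cmeas_zetaX R n) _ (L2cvg_L1 hF))).
  by move=> t; exact: cnorm_zetaX.
by move=> e e0; exists 0%N => k _; rewrite -fcoef_neg hc subrr cnorm0 ltW.
Qed.

Lemma riesz_fischer_H2 a (K : R) : (forall N, \sum_(n < N) csq (a n) <= K) ->
  exists f, [/\ inH2 f, forall n : nat, fcoef f n%:Z = a n & L2cvg (tp a) f].
Proof.
move=> aK; have [f [hf hc]] := riesz_fischer aK.
have hF : L2cvg (tp a) f.
  split; first by move=> N; exact: L2_tp.
  split => // e e0; have [N hN] := hc e e0; exists N => n Nn.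
  rewrite (eq_nsq (g := fun t => - (f t - tp a n t))) ?nsqN; first exact: hN.
  by move=> t _; rewrite opprB.
exists f; split => //; last first.
  move=> n; apply: (L2cvg_coef hF) => e e0; exists n.+1 => k nk.
  by rewrite fcoef_tp nk subrr cnorm0 ltW.
apply/H2P; split => // n n0; apply: (L2cvg_coef_neg hF) => k.
exact: fcoef_tp_neg.
Qed.

Lemma L2_unique f g : inL2 f -> inL2 g -> (forall n, fcoef f n = fcoef g n) ->
  {ae mu, forall t, D t -> f t = g t}.
Proof.
move=> hf hg fg; have h := fcoef_unique (cL1B (L2_L1 hf) (L2_L1 hg)).
have : aezero (fun t => f t - g t).
  by apply: h => n; rewrite fcoefB ?fg ?subrr//; exact: L2_L1.
by apply: ae1 => t _ /eqP; rewrite subr_eq0 => /eqP.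
Qed.

Lemma H2_coef_unique f g : inH2 f -> inH2 g -> (forall n : nat, fcoef f n%:Z = fcoef g n%:Z) ->
  {ae mu, forall t, D t -> f t = g t}.
Proof.
move=> hf hg fg; apply: L2_unique; try exact: H2_L2.
by move=> [n|n]; rewrite ?fg// NegzE !H2_neg.
Qed.

(** Riesz-Fischer gives some limit of the Fourier sums, and uniqueness of coefficients identifies it
    with [f] almost everywhere. *)
Lemma H2_fourier f : inH2 f -> L2cvg (tp (fun n => fcoef f n%:Z)) f.
Proof.
move=> hf; have [g [hg gc gF]] := @riesz_fischer_H2 (fun n => fcoef f n%:Z) _ (fun N => bessel N (H2_L2 hf)).
have fg : {ae mu, forall t, D t -> g t = f t} by exact: H2_coef_unique.
have [h1 [h2 h3]] := gF; split => //; split; first exact: H2_L2.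
move=> e e0; have [N hN] := h3 e e0; exists N => n Nn.
rewrite -(ae_nsq (f := fun t => tp (fun n => fcoef f n%:Z) n t - g t)) ?hN//.
- by apply: cmeasB; apply: L2_cmeas => //; exact: h1.
- by apply: cmeasB; apply: L2_cmeas; [exact: h1|exact: H2_L2].
- by apply: ae1 fg => t _ ->.
Qed.

Lemma ler_eps (x y : R) : (forall e, 0 < e -> x <= y + 2 * e ^+ 2) -> x <= y.
Proof.
move=> h; apply/ler_addgt0Pr => e e0.
pose d := Num.min 1 (e / 2).
have d0 : 0 < d by rewrite lt_min ltr01 divr_gt0.
have d1 : d <= 1 by rewrite ge_min lexx.
have d2 : d <= e / 2 by rewrite ge_min lexx orbT.
apply: le_trans (h d d0) _; rewrite lerD2l.
have : d ^+ 2 <= d by rewrite expr2 ler_piMr// ltW.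
lra.
Qed.

Lemma nsq_poly (q : {poly C}) r : nsq (circ (horner q) r) = \sum_(n < size q) csq (q`_n * r%:C ^+ n).
Proof.
rewrite -(nsq_tp (fun n => q`_n * r%:C ^+ n)); apply: eq_nsq => t _.
by rewrite circ_poly.
Qed.

Lemma cvg_sum_ord (N : nat) (u : nat -> nat -> R) (l : nat -> R) :
  (forall n, u n j @[j --> \oo] --> l n) ->
  (\sum_(n < N) u n j) @[j --> \oo] --> \sum_(n < N) l n.
Proof.
move=> h; elim: N => [|N ih].
  by under eq_fun do rewrite big_ord0; rewrite big_ord0; exact: cvg_cst.
by under eq_fun do rewrite big_ord_recr/=; rewrite big_ord_recr/=; exact: cvgD.
Qed.

Lemma cvg_rjX n : (rj R j) ^+ n @[j --> \oo] --> (1 : R).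
Proof.
rewrite -[X in _ --> X](expr1n _ n); elim: n => [|m ih].
  by under eq_fun do rewrite expr0; exact: cvg_cst.
by rewrite exprS; under eq_fun do rewrite exprS; apply: cvgM => //; exact: cvg_rj.
Qed.

Lemma csq0 : csq (0 : C) = 0.
Proof. by rewrite /csq /= expr0n addr0. Qed.

Lemma csq_cplxX (r : R) n : csq (r%:C ^+ n) = r ^+ n ^+ 2.
Proof. by rewrite -cplxX /csq /= expr0n addr0. Qed.

Lemma L2_circ_poly (q : {poly C}) r : inL2 (circ (horner q) r).
Proof.
apply: (@eq_L2 _ (tp (fun n => q`_n * r%:C ^+ n) (size q))); last exact: L2_tp.
by move=> t _; rewrite circ_poly.
Qed.

(** Bessel's inequality for the truncated series, whose coefficients shrink under dilation. The
    factor 2 comes from [nsqD_le]; what counts is uniformity in [r]. *)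
Lemma nsq_Cau f r : inL2 f -> 0 <= r -> r < 1 -> nsq (circ (Cau f) r) <= 2 * nsq f.
Proof.
move=> hf r0 r1; have hA := inA_Cau (L2_L1 hf); apply: ler_eps => e e0.
have [N hN] := pow_small ((1 - r)^-1 * ri (fun t => cnorm (f t))) r0 r1 e0.
pose q := \poly_(n < N) fcoef f n%:Z.
have hq z : cnorm z <= r -> cnorm (Cau f z - q.[z]) <= e.
  by move=> hz; apply: le_trans (Cau_approx N (L2_L1 hf) r1 hz) _; rewrite -mulrA hN.
have h1 := inA_L2 hA r0 r1; have h2 := L2_circ_poly q r.
rewrite (eq_nsq (g := fun t => circ (horner q) r t + (circ (Cau f) r t - circ (horner q) r t))); last first.
  by move=> t _; rewrite addrC subrK.
apply: le_trans (nsqD_le h2 (L2B h1 h2)) _.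
apply: lerD; apply: ler_wpM2l => //.
  rewrite nsq_poly; apply: le_trans _ (bessel (size q) hf).
  apply: ler_sum => i _; rewrite csqM csq_cplxX coef_poly.
  case: ifP => _; last by rewrite csq0 mul0r.
  by rewrite ler_piMr// exprn_ile1// ?exprn_ge0// exprn_ile1// ltW.
rewrite -[leRHS]ri_cst; apply: ri_le.
- by apply: L2_csq; exact: L2B.
- exact: integr_cst.
- move=> t _; rewrite -cnorm_sq ler_pXn2r ?nnegrE ?(ltW e0)//.
  by apply: hq; rewrite cnorm_circ.
Qed.

(** Split [f] into a Fourier sum [q] and a small remainder [phi]: dilates of [q] converge
    coefficientwise, and those of [phi] stay small by [nsq_Cau]. *)
Theorem H2_radial f : inH2 f -> L2cvg (fun j => circ (Cau f) (rj R j)) f.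
Proof.
move=> hf; have hA := inA_Cau (H2_L1 hf); have hL := H2_L2 hf.
split; first by move=> j; apply: inA_L2 => //; [exact: rj_ge0|exact: rj_lt1].
split => // e e0; pose a (n : nat) := fcoef f n%:Z.
(* The three terms [Cau phi], [d] and [phi] contribute at most 4, 4 and 4 sixteenths of [e], after
   two uses of the factor 2 for squared norms of sums and differences. *)
have e12 : 0 < e / 16 by rewrite divr_gt0.
have [N hN] := (H2_fourier hf).2.2 _ e12; have {hN} := hN N (leqnn _).
set q := tp _ N => hq; pose phi t := f t - q t.
have hphi : inL2 phi by apply: L2B => //; exact: L2_tp.
have nphi : nsq phi <= e / 16.
  by rewrite (eq_nsq (g := fun t => - (q t - f t))) ?nsqN// => t _; rewrite opprB.
have Cphi z : cnorm z < 1 -> Cau f z = Cau phi z + \sum_(n < N) a n * z ^+ n.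
  move=> z1; have hqL := L2_L1 (L2_tp a N).
  have -> : \sum_(n < N) a n * z ^+ n = Cau q z.
    apply: (csum_unique _ (Cau_csum hqL z1)) => e1 e10; exists N => m Nm.
    rewrite (big_ord_widen_cond _ xpredT (fun n => a n * z ^+ n) Nm) [X in _ - X]big_mkcond -sumrB.
    rewrite big1 ?cnorm0// => i _; rewrite fcoef_tp /=.
    by case: ifP => _; rewrite ?mul0r subrr.
  rewrite /Cau -cintD.
  - by apply: eq_cint => t _; rewrite -mulrDl subrK.
  - by apply: cL1_ck => //; exact: L2_L1.
  - exact: cL1_ck.
have cq : (\sum_(n < N) csq (a n * ((rj R j) ^+ n - 1)%:C)) @[j --> \oo] --> (0 : R).
  have es : \sum_(n < N) (csq (a n) * ((1 - 1) * (1 - 1))) = 0 :> R.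
    by rewrite big1// => i _; rewrite subrr !mulr0.
  rewrite -[X in _ --> X]es.
  have ee1 j : \sum_(n < N) csq (a n * ((rj R j) ^+ n - 1)%:C) =
      \sum_(n < N) csq (a n) * (((rj R j) ^+ n - 1) * ((rj R j) ^+ n - 1)).
    by apply: eq_bigr => i _; rewrite csqM; congr (_ * _); rewrite /csq /= expr0n addr0 expr2.
  under eq_fun do rewrite ee1.
  apply: (@cvg_sum_ord N (fun n j => csq (a n) * (((rj R j) ^+ n - 1) * ((rj R j) ^+ n - 1)))
    (fun n => csq (a n) * ((1 - 1) * (1 - 1)))) => n; apply: cvgMr.
  have h : (rj R j) ^+ n - 1 @[j --> \oo] --> (1 - 1 : R).
    by apply: cvgB; [exact: cvg_rjX|exact: cvg_cst].
  exact: cvgM.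
move/cvgrPdist_le : cq => /(_ _ e12)[M _ hM]; exists M => j Mj.
have r0 := rj_ge0 R j; have r1 := rj_lt1 R j.
pose d t := tp (fun n => a n * ((rj R j) ^+ n - 1)%:C) N t.
have hd : inL2 d by exact: L2_tp.
have nd : nsq d <= e / 16.
  rewrite nsq_tp; have := hM j Mj; rewrite sub0r normrN; exact: le_trans (ler_norm _).
have hc := inA_L2 (inA_Cau (L2_L1 hphi)) r0 r1.
have nc := nsq_Cau hphi r0 r1.
rewrite (eq_nsq (g := fun t => circ (Cau phi) (rj R j) t + (d t - phi t))); last first.
  move=> t _; rewrite /circ Cphi ?circ_lt1// /d /phi /q /tp -/a.
  have -> : \sum_(n < N) a n * ((rj R j) ^+ n - 1)%:C * zeta t ^+ n =
     \sum_(n < N) a n * ((rj R j)%:C * zeta t) ^+ n - \sum_(n < N) a n * zeta t ^+ n.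
    by rewrite -sumrB; apply: eq_bigr => i _; rewrite cplxD cplxN cplx1 cplxX exprMn; ring.
  by ring.
apply: le_trans (nsqD_le hc (L2B hd hphi)) _.
have := nsqB_le hd hphi; lra.
Qed.

(** Bessel at radius [rj j] bounds the sums of [csq (tc F n)] weighted by [(rj j) ^+ n ^+ 2];
    letting [j] tend to infinity removes the weights, and Riesz-Fischer provides the boundary
    function. *)
Theorem H2_of_inA F (K : R) : inA F -> (forall j, nsq (circ F (rj R j)) <= K) ->
  exists f, inH2 f /\ forall z, cnorm z < 1 -> Cau f z = F z.
Proof.
move=> hF FK.
have b1 N : \sum_(n < N) csq (tc F n) <= K.
  have h j : \sum_(n < N) csq (tc F n) * ((rj R j) ^+ n * (rj R j) ^+ n) <= K.
    have r0 := rj_ge0 R j; have r1 := rj_lt1 R j.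
    apply: le_trans _ (FK j); apply: le_trans _ (bessel N (inA_L2 hF r0 r1)).
    by apply: ler_sum => n _; rewrite fcoef_nat inA_coef// csqM csq_cplxX expr2.
  have cv : (\sum_(n < N) csq (tc F n) * ((rj R j) ^+ n * (rj R j) ^+ n)) @[j --> \oo] -->
      \sum_(n < N) csq (tc F n).
    apply: (@cvg_sum_ord N (fun n j => csq (tc F n) * ((rj R j) ^+ n * (rj R j) ^+ n))
      (fun n => csq (tc F n))) => n.
    have e1 : csq (tc F n) * (1 * 1) = csq (tc F n) by rewrite !mulr1.
    rewrite -[X in _ --> X]e1; apply: cvgMr.
    by apply: cvgM; exact: cvg_rjX.
  by apply: (cvgr_to_le cv); exact: nearW.
have [f [hf fc _]] := riesz_fischer_H2 b1; exists f; split => // z z1.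
apply: (inA_eq (inA_Cau (H2_L1 hf)) hF _ z1) => n.
by rewrite tc_Cau ?fc//; exact: H2_L1.
Qed.

Lemma H2_Cau_unique f g : inH2 f -> inH2 g -> (forall z, cnorm z < 1 -> Cau f z = Cau g z) ->
  {ae mu, forall t, D t -> f t = g t}.
Proof.
move=> hf hg fg; apply: H2_coef_unique => // n.
rewrite -!tc_Cau; try exact: H2_L1.
have [h0 h1] := half01 R.
have e t : circ (Cau f) 2^-1 t = circ (Cau g) 2^-1 t.
  by apply: fg; rewrite cnorm_circ.
rewrite /tc (eq_cint (g := fun t => circ (Cau g) 2^-1 t * conjc (zeta t) ^+ n)) //.
by move=> t _; rewrite e.
Qed.

(** * Products and bounded functions in H^2 *)

Lemma H2M_radial f g : inH2 f -> inH2 g ->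
  L1cvg (fun j => circ (fun z => Cau f z * Cau g z) (rj R j)) (fun t => f t * g t).
Proof. by move=> hf hg; exact: (L2cvgM (H2_radial hf) (H2_radial hg)). Qed.

(** The product is only known to be in L^1, but it is the L^1 limit of traces of analytic functions,
    which have no negative coefficients. *)
Lemma H2M_neg f g n : inH2 f -> inH2 g -> (0 < n)%N -> fcoef (fun t => f t * g t) (- n%:Z) = 0.
Proof.
move=> hf hg n0; rewrite fcoef_neg.
apply: (L1cvg_cint_eq (L1cvg_uni (cmeas_zetaX R n) _ (H2M_radial hf hg))).
  by move=> t; exact: cnorm_zetaX.
move=> e e0; exists 0%N => k _; rewrite inA_neg ?subrr ?cnorm0 ?(ltW e0)//.
- by apply: inAM; apply: inA_Cau; exact: H2_L1.
- exact: rj_ge0.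
- exact: rj_lt1.
Qed.

Lemma H2M_Cau f g z : inH2 f -> inH2 g -> cnorm z < 1 ->
  Cau (fun t => f t * g t) z = Cau f z * Cau g z.
Proof.
move=> hf hg z1.
have hA : inA (fun z => Cau f z * Cau g z) by apply: inAM; apply: inA_Cau; exact: H2_L1.
have hL := L2M_L1 (H2_L2 hf) (H2_L2 hg).
apply: (inA_eq (inA_Cau hL) hA _ z1) => n; rewrite tc_Cau// fcoef_nat.
apply: (L1cvg_cint_eq (L1cvg_uni (cmeas_zetaJX R n) _ (H2M_radial hf hg))).
  by move=> t; exact: cnorm_zetaJX.
move=> e e0; set T := tc _ n.
have cv := cvg_rjX n.
have k0 : 0 < e / (cnorm T + 1) by rewrite divr_gt0// ltr_wpDl.
move/cvgrPdist_le : cv => /(_ _ k0)[M _ hM]; exists M => k Mk.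
rewrite (inA_coef n hA (rj_ge0 R k) (rj_lt1 R k)) -/T -cplxX.
have -> : T * ((rj R k) ^+ n)%:C - T = - (T * (1 - (rj R k) ^+ n)%:C).
  by rewrite cplxD cplxN cplx1; ring.
rewrite cnormN cnormM cnorm_real; apply: le_trans (ler_wpM2l _ (hM k Mk)) _ => //.
rewrite mulrCA ler_piMr// ?(ltW e0)// ler_pdivrMr ?ltr_wpDl// mul1r lerDl//.
Qed.

Lemma H2M f g : inH2 f -> inH2 g -> inL2 (fun t => f t * g t) -> inH2 (fun t => f t * g t).
Proof. by move=> hf hg h; apply/H2P; split => // n n0; exact: H2M_neg. Qed.

Lemma H2_bound f (M : R) : inH2 f -> (forall z, cnorm z < 1 -> cnorm (Cau f z) <= M) ->
  {ae mu, forall t, D t -> cnorm (f t) <= M}.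
Proof.
move=> hf fM; apply: (L2cvg_bound (H2_radial hf)) => n t _.
by apply: fM; exact: circ_lt1.
Qed.

Lemma H2_Cau_le f (M : R) z : inH2 f -> {ae mu, forall t, D t -> cnorm (f t) <= M} ->
  cnorm z < 1 -> cnorm (Cau f z) <= M.
Proof.
move=> hf fM z1; apply: Cau_le => //; first exact: H2_L1.
by move=> n; exact: H2_neg.
Qed.

Lemma H2_bdd_of_inA F (M : R) : inA F -> (forall z, cnorm z < 1 -> cnorm (F z) <= M) ->
  exists f, [/\ inH2 f, forall z, cnorm z < 1 -> Cau f z = F z &
    {ae mu, forall t, D t -> cnorm (f t) <= M}].
Proof.
move=> hF FM; have M0 : 0 <= M.
  by apply: le_trans (FM 0 _); rewrite ?cnorm0 ?ltr01.
have [j|f [hf fF]] := @H2_of_inA F (M ^+ 2) hF.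
  rewrite -[leRHS]ri_cst; apply: ri_le.
  - by apply: L2_csq; apply: inA_L2 => //; [exact: rj_ge0|exact: rj_lt1].
  - exact: integr_cst.
  - move=> t _; rewrite -cnorm_sq ler_pXn2r ?nnegrE//.
    by apply: FM; exact: circ_lt1.
exists f; split => //; apply: H2_bound => // z z1.
by rewrite fF// FM.
Qed.

Lemma H2_zeta n : inH2 (fun t : R => zeta t ^+ n).
Proof.
apply/H2P; split.
  apply: (@L2_bdd _ _ 1); first exact: cmeas_zetaX.
  by move=> t _; rewrite -cnorm_sq cnorm_zetaX expr1n.
move=> m m0; rewrite fcoef_neg (eq_cint (g := fun t => zeta t ^+ (n + m))).
  by rewrite cint_zeta addn_eq0 (gtn_eqF m0) andbF.
by move=> t _; rewrite exprD.
Qed.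

(* Exchanges H^2 and the orthogonal complement of H^2, see [H20barP]. *)
Definition refl (h : R -> C) : R -> C := fun t => conjc (zeta t * h t).

Lemma reflE h t : h t = conjc (zeta t) * conjc (refl h t).
Proof. by rewrite /refl conjcK mulrA [conjc _ * _]mulrC zetaJ mul1r. Qed.

Lemma cmeas_refl h : cmeas h -> cmeas (refl h).
Proof. by move=> mh; apply: cmeasJ; apply: cmeasM => //; exact: cmeas_zeta. Qed.

Lemma L2_refl h : inL2 h -> inL2 (refl h).
Proof.
move=> hh; apply: L2J; apply: eq_L2 (L2_zeta 1 hh) => t _.
by rewrite expr1 mulrC.
Qed.

(** Conjugating the pairing of [h] with [zeta ^+ m] gives the coefficient of index [- (m + 1)] of
    [refl h], the shift being due to the factor [zeta]. Conversely, the pairing of [h] with [f] is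
    the conjugate of the coefficient of index -1 of [refl h * f], a product of H^2 functions. *)
Lemma H20barP h : inH20bar h <-> inL2 h /\ inH2 (refl h).
Proof.
split=> [[hh h0]|[hh hq]]; split => //.
  apply/H2P; split; first exact: L2_refl.
  move=> [//|m] _; rewrite fcoef_neg -[RHS](cJ0 R) -(h0 _ (H2_zeta m)) /cip -cintJ.
    apply: eq_cint => t _; rewrite /refl !cJM conjcK exprS mulrACA [conjc _ * zeta t]mulrC zetaJ.
    by rewrite mul1r.
  by apply: L2M_L1 => //; apply: L2J; exact: H2_L2 (H2_zeta m).
move=> f hf; rewrite /cip -[RHS](cJ0 R) -(H2M_neg hq hf (ltn0Sn 0)) fcoef_neg -cintJ.
  by apply: eq_cint => t _; rewrite expr1 !cJM {1}(reflE h); ring.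
by apply: cL1MX; apply: L2M_L1; exact: H2_L2.
Qed.

End HardySpace.

(** * Integrability of the logarithm *)

Section Jensen.
Variable R : realType.
Local Notation C := R[i].
Implicit Types (f g h p : R -> C) (z w : C) (u : R -> R).

Local Notation mu := (@leb R).
Local Notation D := (@I01 R).

Lemma L2_real u : mea u -> integr (fun t => u t ^+ 2) -> inL2 (fun t => (u t)%:C).
Proof.
move=> m i; apply: (L2_le (cmeas_real m) i) => t _.
by rewrite /csq /= expr0n addr0.
Qed.

Lemma fcoef_cst (c : C) (n : nat) : fcoef (fun=> c) n%:Z = if n == 0%N then c else 0.
Proof.
rewrite fcoef_nat (eq_cint (g := fun t => c * (zeta t ^+ 0 * conjc (zeta t) ^+ n))).
  rewrite cintZ; last by apply: cL1MJX; exact: cL1_zeta.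
  by rewrite cint_zetaMJ eq_sym; case: eqP => _; rewrite ?mulr1 ?mulr0.
by move=> t _; rewrite expr0 mul1r.
Qed.

Lemma fcoefD f g (n : nat) : cL1 f -> cL1 g ->
  fcoef (fun t => f t + g t) n%:Z = fcoef f n%:Z + fcoef g n%:Z.
Proof.
move=> hf hg; rewrite !fcoef_nat -cintD; try exact: cL1MJX.
by apply: eq_cint => t _; rewrite mulrDl.
Qed.

Lemma real_conj f (n : nat) : cL1 f -> (forall t, conjc (f t) = f t) ->
  fcoef f (- n%:Z) = conjc (fcoef f n%:Z).
Proof.
move=> hf fr; rewrite -[LHS]conjcK -fcoefJ//; congr conjc.
by rewrite !fcoef_nat; apply: eq_cint => t _; rewrite fr.
Qed.

(* The analytic projection [y] of [u] satisfies [2 * Re y = u + \int u], and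
   [2 * y - \int u] has the Herglotz integral of [u] as holomorphic extension. *)
Lemma herglotz_H2 u : mea u -> integr u -> integr (fun t => u t ^+ 2) ->
  exists v, [/\ inH2 v, forall z, cnorm z < 1 -> Cau v z = Her u z &
    {ae mu, forall t, D t -> Re (v t) = u t}].
Proof.
move=> m iu iu2; pose U t := (u t)%:C; have hU : inL2 U by exact: L2_real.
have LU := L2_L1 hU; pose c := (ri u)%:C.
have [y [hy yc _]] := @riesz_fischer_H2 _ (fun n => fcoef U n%:Z) _ (fun N => bessel N hU).
have Ly := H2_L1 hy.
have L2c := L2_cst c.
have cU : fcoef U 0 = c.
  by rewrite (fcoef_nat U 0) /c -cint_real; apply: eq_cint => t _; rewrite expr0 mulr1.
exists (fun t => 2 * y t - c); split.
- apply/H2P; split; first by apply: L2B => //; apply: L2Z; exact: H2_L2.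
  move=> n n0; rewrite fcoef_neg (eq_cint (g := fun t => 2 * (y t * zeta t ^+ n) - c * zeta t ^+ n)).
    rewrite cintB; last 2 first.
    + by apply: cL1Z; exact: cL1MX.
    + by apply: cL1Z; exact: cL1_zeta.
    rewrite !cintZ; [|exact: cL1_zeta|exact: cL1MX].
    by rewrite -fcoef_neg H2_neg// cint_zeta (gtn_eqF n0) !mulr0 subrr.
  by move=> t _; ring.
- move=> z z1; rewrite HerE//.
  have -> : Cau (fun t => (u t)%:C) z = Cau y z.
    apply: (csum_unique (Cau_csum LU z1)).
    by have := Cau_csum Ly z1; under eq_fun do rewrite yc.
  rewrite -[X in _ = _ - X](Cau_cst c z1) /Cau -cintZ; last exact: cL1_ck.
  rewrite -cintB; last 2 first.
  + by apply: cL1Z; exact: cL1_ck.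
  + by apply: cL1_ck => //; exact: cL1_cst.
  by apply: eq_cint => t _; ring.
(* [g] is real, so its coefficients of nonnegative index suffice. At index 0 both [y] and its
   conjugate contribute the mean of [u], whence the additional [c]. *)
pose g t := (y t + conjc (y t)) - (c + U t).
have Lg : cL1 g.
  by apply: cL1B; [apply: cL1D => //; exact: cL1J|apply: cL1D => //; exact: cL1_cst].
have gr t : conjc (g t) = g t.
  rewrite /g cJD cJN !cJD conjcK [conjc (y t) + _]addrC.
  by congr (_ - (_ + _)); apply: eqC; rewrite cE /= ?oppr0.
have gn (n : nat) : fcoef g n%:Z = 0.
  rewrite fcoefB; last 2 first.
  - by apply: cL1D => //; exact: cL1J.
  - by apply: cL1D => //; exact: cL1_cst.
  rewrite !fcoefD//; last 2 first.
  - exact: cL1_cst.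
  - exact: cL1J.
  rewrite fcoefJ// yc fcoef_cst; case: n => [|n].
    rewrite oppr0 -(fcoefJ 0 Ly) /= .
    have -> : fcoef (fun t => conjc (y t)) 0 = conjc (fcoef y 0) by rewrite (fcoefJ 0 Ly) oppr0.
    rewrite (yc 0%N) cU /c.
    by rewrite (_ : conjc (ri u)%:C = (ri u)%:C) ?subrr//; apply: eqC; rewrite cE /= ?oppr0.
  by rewrite H2_neg// cJ0 /= add0r addr0 subrr.
have : aezero g.
  apply: fcoef_unique => // -[n|n]; first exact: gn.
  by rewrite NegzE real_conj// gn cJ0.
apply: ae1 => t _ /(congr1 (@complex.Re R)); rewrite /g /U /c -cplx2 !cE /=.
lra.
Qed.

Lemma expR_lip (x y m : R) : x <= m -> y <= m -> `|expR x - expR y| <= expR m * `|x - y|.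
Proof.
wlog xy : x y / y <= x => [hw xm ym|xm ym].
  have [h|/ltW h] := leP y x; first exact: hw.
  by rewrite distrC (distrC x); exact: hw.
rewrite !ger0_norm ?subr_ge0 ?ler_expR//.
have h := expR_ge1Dx (y - x).
have e : expR y = expR x * expR (y - x) by rewrite -expRD addrC subrK.
apply: (@le_trans _ _ (expR x * (x - y))).
  rewrite e; have := ler_wpM2l (expR_ge0 x) h.
  by rewrite mulrDr mulr1 mulrBr mulrBr; lra.
by rewrite ler_wpM2r ?subr_ge0// ler_expR.
Qed.

Lemma Re_Her_le u z (m : R) : integr u -> {ae mu, forall t, D t -> u t <= m} -> cnorm z < 1 ->
  Re (Her u z) <= m.
Proof.
move=> iu um z1; rewrite Re_Her.
have -> : m = ri (fun t => pk z t * m).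
  rewrite (eq_ri (g := fun t => m * pk z t)) => [|t _]; last by rewrite mulrC.
  rewrite riZ ?ri_pk ?mulr1//.
  by apply: eq_integr (integr_pk z1 (integr_cst 1)) => t _; rewrite mulr1.
apply: ri_le_ae; try by apply: integr_pk => //; exact: integr_cst.
by apply: ae1 um => t _ h; apply: ler_wpM2l => //; exact: pk_ge0.
Qed.

Lemma inA_expHer u : integr u -> inA (fun z => cexpC (Her u z)).
Proof. by move=> iu; apply: inA_exp; exact: inA_Her. Qed.

(** The moduli of the dilates of [b] converge in L^1 to [cnorm b]. They are also the exponentials of
    the real parts of the dilates of [v], all at most [m]; the exponential being Lipschitz there,
    they converge to [expR u] too. *)
Lemma bounded_outer u (m : R) : mea u -> integr u -> integr (fun t => u t ^+ 2) ->
  (forall t, D t -> u t <= m) ->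
  exists b, [/\ inH2 b, forall z, cnorm z < 1 -> Cau b z = cexpC (Her u z) &
    {ae mu, forall t, D t -> cnorm (b t) = expR (u t)}].
Proof.
move=> mu1 iu iu2 um; have [v [hv vV vu]] := herglotz_H2 mu1 iu iu2.
have hA := inA_expHer iu.
have bd z : cnorm z < 1 -> Re (Her u z) <= m by move=> z1; apply: Re_Her_le => //; exact: aeW.
have [b [hb bB bM]] : exists b, [/\ inH2 b, forall z, cnorm z < 1 -> Cau b z = cexpC (Her u z) &
    {ae mu, forall t, D t -> cnorm (b t) <= expR m}].
  by apply: H2_bdd_of_inA => // z z1; rewrite cnorm_cexpC ler_expR bd.
exists b; split => //.
have [B1 [B2 B3]] := L2cvg_L1 (H2_radial hb); have [V1 [V2 V3]] := L2cvg_L1 (H2_radial hv).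
pose F j t := (cnorm (circ (Cau b) (rj R j) t))%:C.
have LF j : cL1 (F j) by apply: cL1_real; exact: (B1 j).2.
have c1 : L1cvg F (fun t => (cnorm (b t))%:C).
  split => //; split; first by apply: cL1_real; exact: B2.2.
  move=> e e0; have [N hN] := B3 e e0; exists N => n Nn; apply: le_trans (hN n Nn).
  apply: ri_le.
  - by apply: (cL1B (LF n) _).2; apply: cL1_real; exact: B2.2.
  - exact: (cL1B (B1 n) B2).2.
  - move=> t _; rewrite /F -cplxN -cplxD cnorm_real ler_norml.
    have := cnormBD (circ (Cau b) (rj R n) t) (b t).
    have := cnormBD (b t) (circ (Cau b) (rj R n) t); rewrite (cnormBC (b t)).
    by move=> ? ?; apply/andP; split; lra.
have Leu : cL1 (fun t => (expR (u t))%:C).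
  apply: cL1_real; apply: (@integr_bdd _ _ (expR m)); first exact: mea_exp.
  by move=> t Dt; rewrite ger0_norm ?expR_ge0// ler_expR um.
have c2 : L1cvg F (fun t => (expR (u t))%:C).
  split => //; split => // e e0.
  have e1 : 0 < e / expR m by rewrite divr_gt0// expR_gt0.
  have [N hN] := V3 _ e1; exists N => n Nn.
  have i1 := (cL1B (V1 n) V2).2.
  apply: (@le_trans _ _ (ri (fun t => expR m * cnorm (circ (Cau v) (rj R n) t - v t)))).
    apply: ri_le_ae; [exact: (cL1B (LF n) Leu).2|exact: integrZ|].
    apply: ae1 vu => t Dt vt; rewrite /F -cplxN -cplxD cnorm_real.
    have z1 := circ_lt1 n t.
    rewrite /circ bB// cnorm_cexpC (le_trans (expR_lip (bd _ z1) (um _ Dt)))//.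
    apply: ler_wpM2l; first exact: expR_ge0.
    by rewrite -vt -vV// -ReN -ReD; exact: Re_le.
  rewrite riZ// (le_trans (ler_wpM2l (expR_ge0 m) (hN n Nn)))//.
  by rewrite mulrC divfK// gt_eqF// expR_gt0.
have := L1cvg_unique c1 c2; apply: ae1 => t _.
by move=> /(congr1 (@complex.Re R)).
Qed.

(** From [s ^+ 2 + 1 <= (1 + s) ^+ 2 <= expR (2 * s)] with [s = x / d]. A bound linear in [x] makes
    the regularized logarithm of an L^2 function square integrable, as [bounded_outer] requires. *)
Lemma ln_bounds (x d : R) : 0 <= x -> 0 < d ->
  ln (d ^+ 2) <= ln (x ^+ 2 + d ^+ 2) /\ ln (x ^+ 2 + d ^+ 2) - ln (d ^+ 2) <= 2 * (x / d).
Proof.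
move=> x0 d0; have d2 : 0 < d ^+ 2 by rewrite exprn_gt0.
have s0 : 0 < x ^+ 2 + d ^+ 2 by rewrite ltr_wpDl// sqr_ge0.
split; first by rewrite ler_ln ?posrE// lerDr sqr_ge0.
rewrite -ln_div ?posrE// -[leRHS]expRK ler_ln ?posrE ?expR_gt0 ?divr_gt0//.
have -> : (x ^+ 2 + d ^+ 2) / d ^+ 2 = (x / d) ^+ 2 + 1 by field; rewrite gt_eqF.
set s := x / d; have s1 : 0 <= s by rewrite divr_ge0// ltW.
have h := expR_ge1Dx s.
rewrite (_ : 2 * s = s + s); last by ring.
rewrite expRD; apply: (@le_trans _ _ ((1 + s) * (1 + s))); first by nra.
by apply: ler_pM => //; rewrite addr_ge0.
Qed.

Lemma integr_cnorm2 p : inL2 p -> integr (fun t => cnorm (p t)).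
Proof. by move=> /L2_L1[]. Qed.

(* Multiplying [p] by the bounded outer function of modulus [(|p|^2 + d^2)^(-1/2)]
   gives a function bounded by [1], to which the maximum principle applies. *)
Lemma jensen_eps p (d : R) z : inH2 p -> 0 < d -> cnorm z < 1 ->
  integr (fun t => ln (csq (p t) + d ^+ 2)) /\
  csq (Cau p z) <= expR (ri (fun t => pk z t * ln (csq (p t) + d ^+ 2))).
Proof.
move=> hp d0 z1; have hL := H2_L2 hp.
pose l t := ln (csq (p t) + d ^+ 2).
pose k := ln (d ^+ 2).
have lb t : k <= l t /\ l t - k <= 2 * (cnorm (p t) / d).
  by rewrite /l /k -cnorm_sq; exact: ln_bounds.
have ml : mea l.
  by apply: mea_ln; apply: meaD; [exact: mea_csq (L2_cmeas hL)|exact: mea_cst].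
have il : integr l.
  apply: (integr_le ml (integrD (integr_cst `|k|) (integrZ (2 / d) (integr_cnorm2 hL)))) => t _.
  have [h1 h2] := lb t; have := ler_norm k; have := ler_norm (- k); rewrite normrN => ? ?.
  have e : 2 / d * cnorm (p t) = 2 * (cnorm (p t) / d) by rewrite mulrAC mulrA.
  by rewrite ler_norml e; apply/andP; split; lra.
have il2 : integr (fun t => l t ^+ 2).
  (* Writing [l = k + (l - k)], the square is at most [2 * k ^+ 2 + 2 * (l - k) ^+ 2], and [l - k]
     is at most [2 * cnorm p / d]. *)
  have i1 := integrD (integr_cst (2 * k ^+ 2)) (integrZ (8 / d ^+ 2) (L2_csq hL)).
  apply: (integr_le (meaX 2 ml) i1) => t _; rewrite ger0_norm ?sqr_ge0//.
  have [h1 h2] := lb t; rewrite -cnorm_sq.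
  have -> : 8 / d ^+ 2 * cnorm (p t) ^+ 2 = 2 * (2 * (cnorm (p t) / d)) ^+ 2.
    by field; rewrite gt_eqF.
  set s := 2 * _ in h2 *; have : 0 <= (k - (l t - k)) ^+ 2 by exact: sqr_ge0.
  have : (l t - k) ^+ 2 <= s ^+ 2 by rewrite lerXn2r ?nnegrE ?subr_ge0// (le_trans _ h2)// subr_ge0.
  by rewrite !expr2; nra.
split => //.
pose u t := - 2^-1 * l t.
have [b [hb bB bu]] : exists b, [/\ inH2 b, forall z, cnorm z < 1 -> Cau b z = cexpC (Her u z) &
    {ae mu, forall t, D t -> cnorm (b t) = expR (u t)}].
  apply: (@bounded_outer u (- 2^-1 * k)).
  - by apply: meaM => //; exact: mea_cst.
  - exact: integrZ.
  - by apply: eq_integr (integrZ (2^-1 ^+ 2) il2) => t _; rewrite exprMn sqrrN.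
  - by move=> t _; have [h1 _] := lb t; rewrite /u; lra.
have pb : {ae mu, forall t, D t -> cnorm (p t * b t) <= 1}.
  apply: ae1 bu => t _ e; rewrite cnormM e.
  have s0 : 0 < csq (p t) + d ^+ 2 by rewrite ltr_wpDl// exprn_gt0.
  rewrite -(@ler_pXn2r _ 2)// ?nnegrE ?mulr_ge0 ?expR_ge0// expr1n exprMn cnorm_sq.
  rewrite -expRM_natl (_ : 2%:R * u t = - l t); last by rewrite /u; field.
  by rewrite expRN lnK ?posrE// ler_pdivrMr// mul1r lerDl sqr_ge0.
have hpb : inH2 (fun t => p t * b t).
  apply: H2M => //; apply: (L2_le_ae _ (integr_cst 1)).
    by apply: cmeasM; apply: L2_cmeas; exact: H2_L2.
  by apply: ae1 pb => t _ h; rewrite -cnorm_sq expr_le1.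
have := H2_Cau_le hpb pb z1; rewrite H2M_Cau// bB// cnormM cnorm_cexpC Re_Her.
rewrite (eq_ri (g := fun t => - 2^-1 * (pk z t * l t))); last by move=> t _; rewrite /u mulrCA.
rewrite riZ; last exact: integr_pk.
rewrite -/l; set I := ri _ => h.
rewrite -cnorm_sq; have -> : expR I = expR (2^-1 * I) ^+ 2.
  by rewrite -expRM_natl; congr expR; field.
rewrite lerXn2r ?nnegrE ?expR_ge0//.
by move: h; rewrite mulNr expRN ler_pdivrMr ?expR_gt0// mul1r.
Qed.

Lemma Cau_neq0 p : inH2 p -> ~ aezero p -> exists2 z, cnorm z < 1 & Cau p z != 0.
Proof.
move=> hp np; apply: contrapT => h; apply: np.
have z0 z : cnorm z < 1 -> Cau p z = 0.
  by move=> z1; apply/eqP; apply: contrapT => /negP h2; apply: h; exists z.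
have h0 := H2_0 R.
apply: (H2_Cau_unique hp h0) => z z1.
by rewrite z0// Cau_cst.
Qed.

Definition dj (j : nat) : R := j.+1%:R^-1.
Lemma dj_gt0 j : 0 < dj j. Proof. by rewrite invr_gt0. Qed.
Lemma cvg_dj2 : dj j ^+ 2 @[j --> \oo] --> (0 : R).
Proof.
have e : (0 : R) = 0 * 0 by rewrite mulr0.
rewrite [X in _ --> X]e; under eq_fun do rewrite expr2.
by apply: cvgM; exact: cvg_harmonic.
Qed.
Lemma dj_le i j : (i <= j)%N -> dj j <= dj i.
Proof. by move=> ij; rewrite lef_pV2 ?posrE// ler_nat. Qed.

Lemma cvg_ln_dj x : 0 < x -> ln (x + dj j ^+ 2) @[j --> \oo] --> ln x.
Proof.
move=> x0; apply: (continuous_cvg _ (continuous_ln x0)).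
by rewrite -[X in _ --> X](addr0 x); apply: cvgD; [exact: cvg_cst|exact: cvg_dj2].
Qed.

Lemma ln_dj_mono x i j : 0 <= x -> (i <= j)%N -> ln (x + dj j ^+ 2) <= ln (x + dj i ^+ 2).
Proof.
move=> x0 ij; have s k : 0 < x + dj k ^+ 2 by rewrite ltr_wpDl// exprn_gt0// dj_gt0.
rewrite ler_ln ?posrE// lerD2l lerXn2r ?nnegrE ?(ltW (dj_gt0 _))//.
exact: dj_le.
Qed.

(** At a point [z0] where the extension is nonzero, the regularized Jensen inequality bounds the
    Poisson averages of the decreasing logarithms [l j] from below. Monotonicity then excludes zeros
    on a set of positive measure and gives integrability; Jensen's inequality itself follows by
    dominated convergence. *)
Theorem H2_log p : inH2 p -> ~ aezero p ->
  [/\ {ae mu, forall t, D t -> p t != 0}, integr (fun t => ln (csq (p t))) &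
    forall z, cnorm z < 1 -> csq (Cau p z) <= expR (ri (fun t => pk z t * ln (csq (p t))))].
Proof.
move=> hp np; have [z0 z01 Pz0] := Cau_neq0 hp np.
have hL := H2_L2 hp.
pose l j t := ln (csq (p t) + dj j ^+ 2).
have il j : integr (l j) by have [] := jensen_eps hp (dj_gt0 j) z01.
have jen j z : cnorm z < 1 -> csq (Cau p z) <= expR (ri (fun t => pk z t * l j t)).
  by move=> z1; have [] := jensen_eps hp (dj_gt0 j) z1.
pose B j t := l 0%N t - l j t.
have iB j : integr (B j) by exact: integrB.
have B0 j t : 0 <= B j t by rewrite subr_ge0 ln_dj_mono.
pose kp := (1 - csq z0) / 4.
have kp0 : 0 < kp by rewrite divr_gt0// subr_gt0 csq_lt1.
have c0 : 0 < csq (Cau p z0) by rewrite lt_def csq_ge0 andbT; apply: contra_neq Pz0 => /csq_eq0.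
(* Jensen at [z0] bounds the Poisson average of [B j] by the numerator, independently of [j]; the
   lower bound [kp] of the kernel converts this into a bound on the plain integral. *)
pose K := (ri (fun t => pk z0 t * l 0%N t) - ln (csq (Cau p z0))) / kp.
have BK j : ri (B j) <= K.
  rewrite /K ler_pdivlMr// mulrC -riZ//.
  apply: (@le_trans _ _ (ri (fun t => pk z0 t * B j t))).
    apply: ri_le; [exact: integrZ|exact: integr_pk|move=> t _].
    by apply: ler_wpM2r => //; exact: pk_gt0.
  rewrite (eq_ri (g := fun t => pk z0 t * l 0%N t - pk z0 t * l j t)); last by move=> t _; rewrite mulrBr.
  rewrite riB; try exact: integr_pk.
  rewrite lerD2l lerN2 -[leRHS]expRK ler_ln ?posrE ?expR_gt0//.
  exact: jen.
pose x j t := B j.+1 t - B j t.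
have x0 j t : 0 <= x j t.
  by rewrite /x /B; have := ln_dj_mono (csq_ge0 (p t)) (leqnSn j); rewrite -/(l _ _) -/(l _ _); lra.
have sx N t : \sum_(i < N) x i t = B N t.
  rewrite -(big_mkord xpredT (fun i => x i t)) (telescope_sumr (fun i => B i t))//.
  by rewrite /B subrr subr0.
have ix j : integr (x j) by exact: integrB.
have aeB : {ae mu, forall t, D t -> exists M, forall n, B n t <= M}.
  have : {ae mu, forall t, D t -> exists M, forall n, \sum_(i < n) x i t <= M}.
    apply: (@ae_summable _ x K) => // N.
    rewrite -ri_sum//; apply: le_trans (BK N); rewrite le_eqVlt; apply/orP; left.
    by apply/eqP; apply: eq_ri => t _; exact: sx.
  by apply: ae1 => t _ [M hM]; exists M => n; rewrite -sx.
(* At a zero of [p] the value of [B n] is [2 * ln (n + 1)], unbounded in [n]. *)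
have pn0 : {ae mu, forall t, D t -> p t != 0}.
  apply: ae1 aeB => t _ [M hM]; apply/eqP => pt.
  have h n : 2 * ln n.+1%:R <= M.
    apply: le_trans (hM n); rewrite /B /l pt (_ : csq 0 = 0); last exact: csq0.
    rewrite !add0r /dj invr1 expr1n ln1 sub0r lnXn ?invr_gt0// lnV ?posrE// mulNrn opprK.
    by rewrite -[leRHS]mulr_natl.
  pose n := Num.truncn (expR (M / 2)).
  have := h n; have : M / 2 < ln n.+1%:R.
    rewrite -[ltLHS]expRK ltr_ln ?posrE ?expR_gt0//.
    exact: truncnS_gt.
  lra.
have p0' t : p t != 0 -> 0 < csq (p t).
  by move=> h; rewrite lt_def csq_ge0 andbT; apply: contra_neq h => /csq_eq0.
pose Bi t := l 0%N t - ln (csq (p t)).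
have mBi : mea Bi.
  by apply: meaB; [exact: mea_integr (il 0%N)|apply: mea_ln; exact: mea_csq (L2_cmeas hL)].
have cB t : p t != 0 -> B j t @[j --> \oo] --> Bi t.
  move=> pt; apply: cvgB; first exact: cvg_cst.
  by apply: cvg_ln_dj; exact: p0'.
have iBi : integr Bi.
  have [] := @ri_fatou _ B Bi K iB mBi (fun j t _ => B0 j t) _ _ (nearW _ BK) => //.
  - move=> t _; rewrite /Bi /l /dj invr1 expr1n.
    case: (eqVneq (p t) 0) => [->|pt].
      by rewrite csq0 add0r ln1 sub0r oppr_ge0 ln_le0.
    by rewrite subr_ge0 ler_ln ?posrE ?p0' ?lerDl// ltr_wpDr// p0'.
  - by apply: ae1 pn0 => t _; exact: cB.
have ilog : integr (fun t => ln (csq (p t))).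
  by apply: eq_integr (integrB (il 0%N) iBi) => t _; rewrite /Bi; ring.
split => // z z1.
have [] := @ri_dct _ (fun j t => pk z t * l j t) (fun t => pk z t * ln (csq (p t)))
  (fun t => pk z t * (`|l 0%N t| + `|Bi t|)).
- by move=> n; apply: mea_integr; exact: integr_pk.
- by apply: mea_integr; exact: integr_pk.
- by apply: integr_pk => //; apply: integrD; exact: integr_abs.
- apply: ae1 pn0 => t _ pt; apply: cvgMr.
  by apply: cvg_ln_dj; exact: p0'.
- apply: ae1 pn0 => t _ pt n; rewrite normrM (ger0_norm (pk_ge0 t z1)).
  apply: ler_wpM2l; first exact: pk_ge0.
  have h1 : B n t <= Bi t.
    rewrite lerD2l lerN2 ler_ln ?posrE ?p0' ?lerDl ?sqr_ge0// ltr_wpDr ?sqr_ge0// p0' //.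
  have h2 := B0 n t.
  rewrite (_ : l n t = l 0%N t - B n t); last by rewrite /B; ring.
  apply: le_trans (ler_normB _ _) _; rewrite lerD2l (ger0_norm h2).
  by apply: le_trans h1 (ler_norm _).
move=> _ cv.
have cv2 : expR (ri (fun t => pk z t * l j t)) @[j --> \oo] --> expR (ri (fun t => pk z t * ln (csq (p t)))).
  by apply: (continuous_cvg _ _ cv); exact: continuous_expR.
by apply: (cvgr_to_ge cv2); apply: nearW => j; exact: jen.
Qed.

End Jensen.

(** * Outer functions and inner-outer factorization *)

Section Factorization.
Variable R : realType.
Local Notation C := R[i].
Implicit Types (f g h p : R -> C) (z w : C) (u : R -> R).

Local Notation mu := (@leb R).
Local Notation D := (@I01 R).

Lemma L2cvg_cst f : inL2 f -> L2cvg (fun=> f) f.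
Proof.
move=> hf; split => //; split => // e e0; exists 0%N => n _.
rewrite /nsq (eq_ri (g := fun=> 0)) ?ri_cst ?(ltW e0)// => t _.
by rewrite subrr csq0.
Qed.

(** The weight [d] in [nsqD_eps] makes the loss arbitrarily small. The constant must be sharp: it
    serves to compare the norms of a function and of its outer factor, where equality is the
    point. *)
Lemma L2cvg_nsq_le F f (K : R) : L2cvg F f -> (forall n, nsq (F n) <= K) -> nsq f <= K.
Proof.
move=> [h1 [h2 h3]] FK; have K0 : 0 <= K by apply: le_trans (FK 0%N); exact: nsq_ge0.
apply/ler_addgt0Pr => e e0.
pose d := e / (2 * (K + 1)).
have K1 : 0 < K + 1 by rewrite ltr_wpDl.
have d0 : 0 < d by rewrite divr_gt0// mulr_gt0.
have s0 : 0 < 1 + d^-1 by rewrite addr_gt0// invr_gt0.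
have e1 : 0 < e / 2 / (1 + d^-1) by rewrite !divr_gt0.
have [N hN] := h3 _ e1; have {hN} hN := hN N (leqnn _).
have := nsqD_eps d0 (h1 N) (L2B h2 (h1 N)).
rewrite (eq_nsq (g := f)) => [|t _]; last by rewrite addrC subrK.
rewrite [X in _ + _ * X](eq_nsq (g := fun t => - (F N t - f t))) => [|t _]; last by rewrite opprB.
rewrite nsqN => /le_trans; apply.
have : (1 + d^-1) * nsq (fun t => F N t - f t) <= e / 2 by rewrite mulrC -ler_pdivlMr.
have : (1 + d) * nsq (F N) <= (1 + d) * K by apply: ler_wpM2l (FK N); rewrite addr_ge0// ltW.
have : d * K <= e / 2.
  rewrite /d mulrAC ler_pdivrMr ?mulr_gt0//.
  rewrite (_ : e / 2 * _ = e * (K + 1)); last by field.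
  by rewrite ler_pM2l// lerDl.
rewrite mulrDl mul1r; lra.
Qed.

Lemma ae_Cau f g z : cmeas f -> cmeas g -> {ae mu, forall t, D t -> f t = g t} -> cnorm z < 1 ->
  Cau f z = Cau g z.
Proof.
move=> mf mg fg z1; apply: ae_cint; try by apply: cmeasM => //; exact: cmeas_ck.
by apply: ae1 fg => t _ ->.
Qed.

Lemma ri_min0 u : integr u ->
  ri (fun t => Num.min (u t + n%:R) 0) @[n --> \oo] --> (0 : R).
Proof.
move=> iu; have mu1 := mea_integr iu.
have [] := @ri_dct _ (fun n t => Num.min (u t + n%:R) 0) (fun=> 0) (fun t => `|u t|).
- by move=> n; apply: mea_min; [apply: meaD => //; exact: mea_cst|exact: mea_cst].
- exact: mea_cst.
- exact: integr_abs.
- apply: aeW => t _; apply/cvgrPdist_le => e e0.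
  exists (Num.truncn `|u t|).+1 => // n /= hn.
  have : `|u t| <= n%:R.
    by apply: le_trans (ltW (truncnS_gt _)) _; rewrite ler_nat.
  move=> h; have := ler_norm (- u t); rewrite normrN => h2.
  have h3 : 0 <= u t + n%:R by lra.
  by rewrite (min_idPr h3) subrr normr0 ltW.
- apply: aeW => t _ n; have := ler0n R n; have := ler_norm (- u t); rewrite normrN => h2 h3.
  have [h|h] := leP (u t + n%:R) 0; last by rewrite normr0.
  by rewrite ler0_norm//; lra.
by rewrite ri_cst.
Qed.

(* [p] times the bounded outer function of modulus [expR (- max(ln psi, -n))]
   is bounded by [1] and tends to the constant [c] in L^2: outer functions are cyclic. *)
Lemma outer_division p h q r : outer p -> inL2 h -> inH2 q -> inH2 r ->
  {ae mu, forall t, D t -> h t * p t = q t * r t} -> inH2 h.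
Proof.
move=> [hp [c [psi [c1 [mpsi [psi0 [iU pE]]]]]]] hh hq hr hpqr.
pose U t := ln (psi t).
have {pE}PE z : cnorm z < 1 -> Cau p z = c * cexpC (Her U z).
  by move=> z1; apply: (csum_unique (Cau_csum (H2_L1 hp) z1)); exact: pE.
have {iU}iU : integr U by exact: iU.
have mU := mea_integr iU.
(* [W n = A n - U] below is [- max(U, -n)]. It is at most [n], so [y n] is bounded, while [p * y n]
   extends to [c * cexpC (Her (A n))] with [A n <= 0], of modulus at most 1. *)
pose A (n : nat) t := Num.min (U t + n%:R) 0.
have mA n : mea (A n) by apply: mea_min; [apply: meaD => //; exact: mea_cst|exact: mea_cst].
have iA n : integr (A n).
  apply: (integr_le (mA n) (integr_abs iU)) => t _.
  have := ler0n R n; have := ler_norm (- U t); rewrite normrN /A => h2 h3.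
  have [h4|h4] := leP (U t + n%:R) 0; last by rewrite normr0.
  by rewrite ler0_norm//; lra.
pose W n t := A n t - U t.
have iW n : integr (W n) by exact: integrB.
have WE n t : W n t <= n%:R.
  have : A n t <= U t + n%:R by rewrite ge_min lexx.
  by rewrite /W; lra.
have /choice[y hy] : forall n, exists y, [/\ inH2 y,
    forall z, cnorm z < 1 -> Cau y z = cexpC (Her (W n) z) &
    {ae mu, forall t, D t -> cnorm (y t) <= expR n%:R}].
  move=> n; apply: H2_bdd_of_inA; first exact: inA_expHer.
  move=> z z1; rewrite cnorm_cexpC ler_expR.
  by apply: Re_Her_le => //; apply: aeW => t _; exact: WE.
have H2y f n : inH2 f -> inH2 (fun t => f t * y n t).
  move=> hf; have [y1 _ y3] := hy n; apply: H2M => //.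
  apply: (@eq_L2 _ (fun t => y n t * f t)) => [t _|]; first by rewrite mulrC.
  by apply: L2Mb y3 (H2_L2 hf); exact: L2_cmeas (H2_L2 y1).
have Cpy n z : cnorm z < 1 -> Cau (fun t => p t * y n t) z = c * cexpC (Her (A n) z).
  move=> z1; have [y1 y2 _] := hy n.
  rewrite H2M_Cau// PE// y2// -mulrA -cexpCD -HerD//; congr (_ * cexpC _).
  by apply: eq_cint => t _; rewrite /W addrC subrK.
have py1 n : {ae mu, forall t, D t -> cnorm (p t * y n t) <= 1}.
  apply: H2_bound; first exact: H2y.
  move=> z z1; rewrite Cpy// cnormM c1 mul1r cnorm_cexpC -expR0 ler_expR.
  by apply: Re_Her_le => //; apply: aeW => t _; rewrite ge_min lexx orbT.
have cv : L2cvg (fun n t => p t * y n t) (fun=> c).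
  split; first by move=> n; apply: H2_L2; exact: H2y.
  split; first exact: L2_cst.
  (* Expand the square: both squared norms are at most 1, and the mean of [p * y n], its extension
     at 0, is [c * expR (ri (A n))]. *)
  have nb n : nsq (fun t => p t * y n t - c) <= 2 - 2 * expR (ri (A n)).
    have hpy := H2y p n hp; have [y1 y2 _] := hy n.
    rewrite nsqB; [|exact: H2_L2|exact: L2_cst].
    have -> : nsq (fun=> c) = 1 by rewrite /nsq ri_cst -cnorm_sq c1 expr1n.
    have -> : cint (fun t => p t * y n t * conjc c) = (expR (ri (A n)))%:C.
      rewrite (eq_cint (g := fun t => conjc c * (p t * y n t))); last by move=> t _; rewrite mulrC.
      rewrite cintZ; last exact: H2_L1.
      have -> : cint (fun t => p t * y n t) = Cau (fun t => p t * y n t) 0.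
        by apply: eq_cint => t _; rewrite ck0 mulr1.
      rewrite Cpy ?cnorm0_lt1// Her0// cexpC_real mulrA [conjc c * c]mulrC mulJ.
      by rewrite -cnorm_sq c1 expr1n mul1r.
    have : nsq (fun t => p t * y n t) <= 1.
      rewrite -[leRHS]ri_cst; apply: ri_le_ae.
      - by apply: L2_csq; exact: H2_L2.
      - exact: integr_cst.
      - by apply: ae1 (py1 n) => t _ h1; rewrite -cnorm_sq expr_le1.
    by rewrite /=; lra.
  move=> e e0.
  have cl : 2 - 2 * expR (ri (A n)) @[n --> \oo] --> (0 : R).
    have e1 : 2 - 2 * expR 0 = 0 :> R by rewrite expR0 mulr1 subrr.
    rewrite -[X in _ --> X]e1; apply: cvgB; first exact: cvg_cst.
    apply: cvgMr; apply: (continuous_cvg _ _ (ri_min0 iU)).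
    exact: continuous_expR.
  move/cvgrPdist_le : cl => /(_ _ e0)[N _ hN]; exists N => n Nn.
  apply: le_trans (nb n) _; have := hN n Nn; rewrite sub0r normrN.
  exact: le_trans (ler_norm _).
apply/H2P; split => // m m0.
have hzm := L2_zeta m hh.
(* It is the limit of the coefficients of index [- m] of [h * p * y n = q * (r * y n)], which vanish
   because both factors are in H^2. *)
have z0 : cint (fun t => c * (h t * zeta t ^+ m)) = 0.
  apply: (L1cvg_cint_eq (L2cvgM cv (L2cvg_cst hzm))) => e e0; exists 0%N => n _.
  rewrite (ae_cint (g := fun t => (q t * (r t * y n t)) * zeta t ^+ m)).
  - by rewrite -fcoef_neg H2M_neg ?subrr ?cnorm0 ?(ltW e0)//; exact: H2y.
  - by apply: cmeasM; apply: L2_cmeas => //; apply: H2_L2; exact: H2y.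
  - apply: cmeasM; last exact: cmeas_zetaX.
    by apply: cmeasM; apply: L2_cmeas; apply: H2_L2 => //; exact: H2y.
  - apply: ae1 hpqr => t _ e1.
    have -> : p t * y n t * (h t * zeta t ^+ m) = (h t * p t) * y n t * zeta t ^+ m by ring.
    by rewrite e1; ring.
move: z0; rewrite cintZ; last exact: L2_L1.
move/eqP; rewrite mulf_eq0 => /orP[/eqP c0|/eqP]; last by rewrite -fcoef_neg.
by move: c1; rewrite c0 cnorm0 => /eqP; rewrite eq_sym oner_eq0.
Qed.

(** Integrate against the probability density [pk z] the tangent inequality of the exponential at
    the mean [a] of [u]. *)
Lemma jensen_pk (u w : R -> R) z : integr u -> integr w -> cnorm z < 1 ->
  {ae mu, forall t, D t -> expR (u t) = w t} ->
  expR (ri (fun t => pk z t * u t)) <= ri (fun t => pk z t * w t).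
Proof.
move=> iu iw z1 uw; set a := ri _.
have i1 := integr_pk z1 (integr_cst 1).
have i2 := integr_pk z1 iu; have i3 := integr_pk z1 iw.
have e1 : ri (fun t => pk z t * 1) = 1.
  by rewrite (eq_ri (g := pk z)) ?ri_pk// => t _; rewrite mulr1.
have -> : expR a = ri (fun t => expR a * ((1 - a) * (pk z t * 1) + pk z t * u t)).
  rewrite riZ; last by apply: integrD => //; exact: integrZ.
  by rewrite riD//; [rewrite riZ// e1 -/a; ring|exact: integrZ].
apply: ri_le_ae => //; first by apply: integrZ; apply: integrD => //; exact: integrZ.
apply: ae1 uw => t _ e; have p0 := pk_ge0 t z1.
have h := expR_ge1Dx (u t - a).
have e2 : w t = expR a * expR (u t - a) by rewrite -expRD -e; congr expR; ring.
have -> : expR a * ((1 - a) * (pk z t * 1) + pk z t * u t) = pk z t * (expR a * (1 + (u t - a))) by ring.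
by rewrite e2; apply: ler_wpM2l => //; apply: ler_wpM2l => //; exact: expR_ge0.
Qed.

(* [cexpC (Her (ln |p|))] dominates the extension of [p] on the disc by Jensen's
   inequality, while its norm is at most that of [p]: hence the quotient [tau] is inner. *)
Theorem inner_outer p : inH2 p -> ~ aezero p ->
  exists tau ot, [/\ inH2 tau, inH2 ot, {ae mu, forall t, D t -> cnorm (tau t) = 1},
    {ae mu, forall t, D t -> p t = tau t * ot t} &
    forall z, cnorm z < 1 ->
      Cau p z = Cau tau z * cexpC (Her (fun t => ln (cnorm (p t))) z)].
Proof.
move=> hp np; have [pn0 il jen] := H2_log hp np.
have hL := H2_L2 hp; have mp := L2_cmeas hL.
pose L t := ln (cnorm (p t)).
have lE : {ae mu, forall t, D t -> ln (csq (p t)) = 2 * L t}.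
  by apply: ae1 pn0 => t _ pt; rewrite -cnorm_sq lnXn ?cnorm_gt0// -[LHS]mulr_natl.
have mL : mea L by apply: mea_ln; exact: mea_cnorm.
have iL : integr L.
  apply: (integr_le_ae mL (integr_abs il)); apply: ae1 lE => t _ ->.
  by rewrite normrM ger0_norm//; have := normr_ge0 (L t); lra.
have ReL z : cnorm z < 1 -> 2 * Re (Her L z) = ri (fun t => pk z t * ln (csq (p t))).
  move=> z1; rewrite Re_Her -riZ; last exact: integr_pk.
  apply: ae_ri.
  - by apply: mea_integr; apply: integrZ; exact: integr_pk.
  - by apply: mea_integr; exact: integr_pk.
  - by apply: ae1 lE => t _ ->; ring.
have csqO z : cnorm z < 1 -> csq (cexpC (Her L z)) = expR (ri (fun t => pk z t * ln (csq (p t)))).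
  by move=> z1; rewrite -cnorm_sq cnorm_cexpC -ReL// -expRM_natl.
have hO := inA_expHer iL.
have ic := L2_csq hL.
(* Jensen bounds the squared modulus by the Poisson integral of [csq p], whose mean over each circle
   is [nsq p]. *)
have nO j : nsq (circ (fun z => cexpC (Her L z)) (rj R j)) <= nsq p.
  have r0 := rj_ge0 R j; have r1 := rj_lt1 R j.
  rewrite [leRHS]/nsq -(ri_circ_Her ic r0 r1); apply: ri_le.
  - by apply: L2_csq; exact: inA_L2.
  - exact: cL1_Re (inA_L1 (inA_Her ic) r0 r1).
  move=> t _; have z1 := circ_lt1 j t; rewrite /circ csqO// Re_Her.
  apply: jensen_pk => //; apply: ae1 pn0 => s _ ps; rewrite lnK// posrE -cnorm_sq exprn_gt0//.
  exact: cnorm_gt0.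
have [ot [ho oO]] := H2_of_inA hO nO.
have iNL : integr (fun t => -1 * L t) by exact: integrZ.
pose th z := Cau p z * cexpC (Her (fun t => -1 * L t) z).
have hth : inA th by apply: inAM; [exact: inA_Cau (H2_L1 hp)|exact: inA_expHer].
have thO z : cnorm z < 1 -> th z * cexpC (Her L z) = Cau p z.
  move=> z1; rewrite /th -mulrA -cexpCD -HerD//.
  have -> : Her (fun t => -1 * L t + L t) z = 0.
    rewrite -[RHS](cint_cst 0); apply: eq_cint => t _.
    by rewrite mulN1r addNr cplx0 mulr0.
  by rewrite cexpC0 mulr1.
have th1 z : cnorm z < 1 -> cnorm (th z) <= 1.
  move=> z1; have := jen z z1; rewrite -csqO// -thO// csqM.
  have O0 : 0 < csq (cexpC (Her L z)) by rewrite csqO// expR_gt0.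
  by rewrite ger_pMl// -cnorm_sq expr_le1.
have [tau [htau tauth tau1]] := H2_bdd_of_inA hth th1.
have hto : inH2 (fun t => tau t * ot t).
  by apply: H2M => //; apply: L2Mb tau1 (H2_L2 ho); exact: L2_cmeas (H2_L2 htau).
have pto : {ae mu, forall t, D t -> p t = tau t * ot t}.
  apply: H2_Cau_unique => // z z1; rewrite H2M_Cau// tauth// oO//.
  by rewrite thO.
exists tau, ot; split => //; last by move=> z z1; rewrite tauth// thO.
(* Since [cnorm tau <= 1], also [csq p <= csq ot] almost everywhere. The integrals force equality,
   so [tau] is unimodular wherever [p] is nonzero, that is, almost everywhere. *)
have no : nsq ot <= nsq p.
  apply: (L2cvg_nsq_le (H2_radial ho)) => j; apply: le_trans (nO j).
  rewrite le_eqVlt; apply/orP; left; apply/eqP; apply: eq_nsq => t _.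
  by rewrite /circ oO ?circ_lt1.
have io := L2_csq (H2_L2 ho).
have dif : {ae mu, forall t, D t -> csq (ot t) - csq (p t) = 0}.
  apply: ri_eq0; first exact: integrB.
    apply: ae2 pto tau1 => t _ -> h; rewrite subr_ge0 csqM ler_piMl// -cnorm_sq expr_le1//.
  by rewrite riB// subr_le0.
have dif2 : {ae mu, forall t, D t -> p t != 0 /\ p t = tau t * ot t}.
  by apply: ae2 pn0 pto => t _.
apply: ae2 dif dif2 => t _ e [pt e2].
have o0 : csq (ot t) != 0.
  by apply: contra_neq pt => /csq_eq0 h; rewrite e2 h mulr0.
have : csq (tau t) = 1.
  apply: (mulIf o0); rewrite mul1r -csqM -e2; lra.
by move=> h; rewrite cnormE h sqrtr1.
Qed.

End Factorization.

(** * Toeplitz kernels *)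

Section ToeplitzKernels.
Variable R : realType.
Local Notation C := R[i].
Implicit Types (f g h k p q w : R -> C) (z : C).

Local Notation mu := (@leb R).
Local Notation D := (@I01 R).

Lemma Linf_L2 g f : inLinf g -> inL2 f -> inL2 (fun t => g t * f t).
Proof. by move=> [mg [M gM]]; exact: L2Mb gM. Qed.

Lemma kerTP g f : inLinf g -> kerT g f <-> inH2 f /\ inH2 (refl (fun t => g t * f t)).
Proof.
move=> hg; split=> [[hf /H20barP[_ h]]|[hf h]]; split => //.
by apply/H20barP; split => //; apply: Linf_L2 => //; exact: H2_L2.
Qed.

Lemma H2_ae_neq0 f : inH2 f -> ~ aezero f -> {ae mu, forall t, D t -> f t != 0}.
Proof. by move=> hf nf; have [] := H2_log hf nf. Qed.

Lemma refl_eq0 h t : refl h t = 0 -> h t = 0.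
Proof. by move=> e; rewrite (reflE h) e cJ0 mulr0. Qed.

(** Zeros of [g] are zeros of the H^2 function [refl (g * f)]. This function is not a.e. zero, since
    [f] is nonzero a.e. and [g] is not a.e. zero; hence it is itself nonzero a.e. *)
Lemma kerT_symbol_neq0 g f : inLinf g -> ~ aezero g -> kerT g f -> ~ aezero f ->
  {ae mu, forall t, D t -> g t != 0}.
Proof.
move=> hg ng /(kerTP _ hg)[hf hq] nf; have fn0 := H2_ae_neq0 hf nf.
have nq : ~ aezero (refl (fun t => g t * f t)).
  move=> q0; apply: ng; apply: ae2 q0 fn0 => t _ /refl_eq0 /eqP.
  by rewrite mulf_eq0 => /orP[/eqP//|/eqP ->]; rewrite eqxx.
have := H2_ae_neq0 hq nq; apply: ae1 => t _; apply: contra_neq => g0.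
by rewrite /refl g0 mul0r mulr0 cJ0.
Qed.

(** Such an [f] is orthogonal to itself; it follows that the kernel with symbol 1 is trivial. *)
Lemma inH20bar_H2_eq0 f : inH20bar f -> inH2 f -> aezero f.
Proof.
move=> [hL h] hf; apply: nsq_eq0 => //.
have := congr1 (@complex.Re R) (h f hf); rewrite /cip /= => e.
rewrite (_ : nsq f = 0)// -[RHS]e; apply: eq_ri => t _.
by rewrite mulJ.
Qed.

Lemma Linf_cst (c : C) : inLinf (fun=> c).
Proof. by split; [exact: cmeas_cst|exists (cnorm c); exact: aeW]. Qed.

Lemma LinfM g h : inLinf g -> inLinf h -> inLinf (fun t => g t * h t).
Proof.
move=> [mg [M gM]] [mh [N hN]]; split; first exact: cmeasM.
exists (M * N); apply: ae2 gM hN => t _ h1 h2; rewrite cnormM.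
exact: ler_pM.
Qed.

(** Kernels are sets of functions rather than of classes, so a representative of zero needs its own
    membership argument. *)
Lemma kerT_aezero w k : inLinf w -> inH2 k -> aezero k -> kerT w k.
Proof.
move=> hw hk k0; apply/kerTP => //; split => //.
have h0 := H2_0 R.
apply: ae_H2 h0.
  by apply: cmeas_refl; apply: cmeasM; [case: hw|exact: L2_cmeas (H2_L2 hk)].
by apply: ae1 k0 => t _ e; rewrite /refl e !mulr0 cJ0.
Qed.

Lemma outer_maximal g k p : inLinf g -> {ae mu, forall t, D t -> g t != 0} -> inH2 k -> outer p ->
  {ae mu, forall t, D t -> k t = (g t)^-1 * conjc (zeta t) * conjc (p t)} -> maximal_vector g k.
Proof.
move=> hg gn0 hk op kE; have hp : inH2 p by case: op.
have gk : {ae mu, forall t, D t -> p t = refl (fun t => g t * k t) t}.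
  apply: ae2 gn0 kE => t _ g0 e; rewrite /refl e.
  have -> : zeta t * (g t * ((g t)^-1 * conjc (zeta t) * conjc (p t))) =
      (zeta t * conjc (zeta t)) * (g t / g t) * conjc (p t) by ring.
  by rewrite zetaJ divff// !mul1r conjcK.
have mk := L2_cmeas (H2_L2 hk); have mg : cmeas g by case: hg.
split; first by exists g.
split.
  apply/kerTP => //; split => //; apply: ae_H2 gk hp.
  by apply: cmeas_refl; exact: cmeasM.
move=> w hw /(kerTP _ hw)[_ hq] f /(kerTP _ hg)[hf hr].
apply/kerTP => //; split => //.
(* Both [refl (w * f) * refl (g * k)] and [refl (w * k) * refl (g * f)] are the conjugate of
   [zeta ^+ 2 * w * f * g * k]. *)
apply: (outer_division op _ hq hr); first by apply: L2_refl; apply: Linf_L2 => //; exact: H2_L2.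
by apply: ae1 gk => t _ ->; rewrite /refl -!cJM; congr conjc; ring.
Qed.

(** On the disc [p] is the n-th power of [tau] times the quotient [pn n]. The L^1 bound keeps the
    quotients bounded at [z], while the powers tend to 0. *)
Lemma inner_power_zero tau p (pn : nat -> R -> C) z : inH2 tau ->
  (forall n, inH2 (pn n)) -> {ae mu, forall t, D t -> p t = pn 0%N t} -> cmeas p ->
  (forall n, {ae mu, forall t, D t -> pn n t = tau t * pn n.+1 t}) ->
  (exists K, forall n, ri (fun t => cnorm (pn n t)) <= K) ->
  cnorm z < 1 -> cnorm (Cau tau z) < 1 -> Cau p z = 0.
Proof.
move=> htau hpn p0 mp pS [K hK] z1 th1.
have mpn n := L2_cmeas (H2_L2 (hpn n)).
have mtau := L2_cmeas (H2_L2 htau).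
have S n : Cau (pn n) z = Cau tau z * Cau (pn n.+1) z.
  by rewrite -H2M_Cau//; apply: ae_Cau => //; exact: cmeasM.
have X n : Cau p z = Cau tau z ^+ n * Cau (pn n) z.
  elim: n => [|n ->]; first by rewrite expr0 mul1r; apply: ae_Cau.
  by rewrite S exprSr mulrA.
apply: (@cnorm_small _ _ 1) => e e0; rewrite mul1r.
have [N hN] := pow_small ((1 - cnorm z)^-1 * K) (cnorm_ge0 _) th1 e0.
rewrite (X N) cnormM cnormX; apply: le_trans _ (hN N (leqnn _)).
apply: ler_wpM2l; first by rewrite exprn_ge0.
apply: le_trans (Cau_bound (H2_L1 (hpn N)) z1) _; apply: ler_wpM2l (hK N).
by rewrite invr_ge0 subr_ge0 ltW.
Qed.

Lemma Cau_zero_near0 p (rho : R) : inH2 p -> 0 < rho -> rho < 1 ->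
  (forall z, cnorm z <= rho -> Cau p z = 0) -> aezero p.
Proof.
move=> hp r0 r1 h; have hA := inA_Cau (H2_L1 hp).
have h0 := H2_0 R.
apply: (H2_coef_unique hp h0) => n.
rewrite -tc_Cau; last exact: H2_L1.
have e := inA_coef n hA (ltW r0) r1.
have e2 : cint (fun t => circ (Cau p) rho t * conjc (zeta t) ^+ n) = 0.
  rewrite -[RHS](cint_cst 0); apply: eq_cint => t _.
  by rewrite /circ h ?mul0r// cnorm_circ// ltW.
rewrite e2 in e; have -> : fcoef (fun=> 0 : C) n = 0.
  by rewrite fcoef_nat -[RHS](cint_cst 0); apply: eq_cint => t _; rewrite mul0r.
move/esym/eqP : e; rewrite mulf_eq0 => /orP[/eqP//|].
rewrite expf_eq0 => /andP[_ /eqP /(congr1 (@complex.Re R)) /= e].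
by rewrite e ltxx in r0.
Qed.

(** The squared norm is at most 1, so by Bessel a zeroth coefficient of modulus at least 1 leaves
    nothing for the others. *)
Lemma inner_const tau : inH2 tau -> {ae mu, forall t, D t -> cnorm (tau t) = 1} ->
  1 <= cnorm (fcoef tau 0) ->
  cnorm (fcoef tau 0) = 1 /\ forall z, cnorm z < 1 -> Cau tau z = fcoef tau 0.
Proof.
move=> htau tau1 h1.
have ntau : nsq tau <= 1.
  rewrite -[leRHS]ri_cst; apply: ri_le_ae.
  - exact: L2_csq (H2_L2 htau).
  - exact: integr_cst.
  - by apply: ae1 tau1 => t _ e; rewrite -cnorm_sq e expr1n.
have bes N := le_trans (bessel N (H2_L2 htau)) ntau.
have h2 : 1 <= csq (fcoef tau 0) by rewrite -cnorm_sq expr_ge1.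
have s1 := bes 1%N; rewrite big_ord_recl big_ord0 addr0 in s1.
split.
  apply/eqP; rewrite eq_le h1 andbT -(@expr_le1 _ 2)// cnorm_sq //.
have cn n : fcoef tau n.+1 = 0.
  apply: csq_eq0; apply/eqP; rewrite eq_le csq_ge0 andbT.
  have := bes n.+2; rewrite big_ord_recr big_ord_recl /=.
  have : 0 <= \sum_(i < n) csq (fcoef tau (bump 0 i)) by rewrite sumr_ge0.
  by move: h2; lra.
move=> z z1; apply: (csum_unique (Cau_csum (H2_L1 htau) z1)) => e e0; exists 1%N => -[//|m] _.
rewrite big_ord_recl big1; first by rewrite expr0 mulr1 addr0 subrr cnorm0.
by move=> i _; rewrite cn mul0r.
Qed.

Lemma maximal_outer g k : inLinf g -> {ae mu, forall t, D t -> g t != 0} ->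
  (exists f, kerT g f /\ ~ aezero f) -> maximal_vector g k -> outer (refl (fun t => g t * k t)).
Proof.
move=> hg gn0 [f [kf nf]] [_ [kk kmin]]; have [mg _] := hg.
set p := refl _; have [hk hp] : inH2 k /\ inH2 p by exact/kerTP.
have mk := L2_cmeas (H2_L2 hk); have mp := L2_cmeas (H2_L2 hp).
(* Otherwise [k] would lie in the kernel with symbol 1, and minimality would put the nonzero [f]
   into that trivial kernel. *)
have nk : ~ aezero k.
  move=> k0; have [hf h] := kmin _ (Linf_cst 1) (kerT_aezero (Linf_cst 1) hk k0) _ kf.
  apply: nf; apply: inH20bar_H2_eq0 => //.
  by move: h; under eq_fun do rewrite mul1r.
have np : ~ aezero p.
  move=> p0; apply: nk; apply: ae2 p0 gn0 => t _ /refl_eq0 /eqP.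
  by rewrite mulf_eq0 => /orP[/eqP ->|/eqP//]; rewrite eqxx.
have [tau [ot [htau ho tau1 pto PE]]] := inner_outer hp np.
have mtau := L2_cmeas (H2_L2 htau).
have Ltau : inLinf tau.
  by split => //; exists 1; apply: ae1 tau1 => t _ ->.
have hw := LinfM hg Ltau.
(* Multiplying the symbol by [tau] multiplies the reflection by [conjc tau], which cancels the inner
   factor of [p] and leaves [ot]. *)
have kw : kerT (fun t => g t * tau t) k.
  apply/kerTP => //; split => //; apply: ae_H2 ho.
    by apply: cmeas_refl; do 2 apply: cmeasM => //.
  apply: ae2 pto tau1 => t _ e1 e2.
  have -> : refl (fun t => g t * tau t * k t) t = conjc (tau t) * p t.
    by rewrite /p /refl -cJM; congr conjc; ring.
  rewrite e1 mulrA [conjc _ * _]mulrC mulJ -cnorm_sq e2 expr1n.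
  by rewrite mul1r.
have sub := kmin _ hw kw.
pose kn n t := tau t ^+ n * k t.
have hkn n : kerT g (kn n).
  elim: n => [|n ih].
    by rewrite (_ : kn 0%N = k)//; apply/funext => t; rewrite /kn expr0 mul1r.
  have [hkn h1] := sub _ ih; split; last first.
    move: h1; congr inH20bar; apply/funext => t; rewrite /kn exprS; ring.
  rewrite (_ : kn n.+1 = fun t => tau t * kn n t); last first.
    by apply/funext => t; rewrite /kn exprS mulrA.
  by apply: H2M => //; apply: Linf_L2 => //; exact: H2_L2.
pose pn n := refl (fun t => g t * kn n t).
have pnE n t : pn n t = conjc (tau t) ^+ n * p t.
  by rewrite /pn /p /refl /kn -cJX -cJM; congr conjc; ring.
have hpn n : inH2 (pn n) by have /(kerTP _ hg)[] := hkn n.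
have Pz z : cnorm z < 1 -> cnorm (Cau tau z) < 1 -> Cau p z = 0.
  apply: (inner_power_zero htau hpn) => //.
  - by apply: aeW => t _; rewrite pnE expr0 mul1r.
  - move=> n; apply: ae1 tau1 => t _ e; rewrite !pnE exprS !mulrA mulJ -cnorm_sq e expr1n.
    by rewrite mul1r.
  - exists (ri (fun t => cnorm (p t))) => n; rewrite le_eqVlt; apply/orP; left; apply/eqP.
    apply: ae_ri; [exact: mea_cnorm (L2_cmeas (H2_L2 (hpn n)))|exact: mea_cnorm|].
    by apply: ae1 tau1 => t _ e; rewrite pnE cnormM cnormX cnormJ e expr1n mul1r.
have t0 : 1 <= cnorm (fcoef tau 0).
  rewrite leNgt; apply/negP => t0; apply: np.
  (* By [Cau_approx] with one term, the extension of [tau] moves by at most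
     [rho / (1 - rho) < 1 - c] on the disc of radius [rho], so its modulus stays below 1 there. *)
  set c := cnorm (fcoef tau 0) in t0; pose rho := (1 - c) / 4.
  have c0 : 0 <= c by exact: cnorm_ge0.
  have r0 : 0 < rho by rewrite /rho; lra.
  have r1 : rho < 1 by rewrite /rho; lra.
  apply: (Cau_zero_near0 hp r0 r1) => z hz.
  apply: Pz; first exact: le_lt_trans hz r1.
  have := Cau_approx 1 (H2_L1 htau) r1 hz.
  rewrite horner_poly big_ord_recl big_ord0 addr0 expr0 mulr1 expr1.
  have -> : ri (fun t => cnorm (tau t)) = 1.
    rewrite -[RHS]ri_cst; apply: ae_ri; [exact: mea_cnorm|exact: mea_cst|].
    by apply: ae1 tau1 => t _ ->.
  rewrite mulr1 => h.
  have := cnormBD (Cau tau z) (fcoef tau 0); rewrite -/c.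
  have : rho * (1 - rho)^-1 < 1 - c.
    rewrite ltr_pdivrMr ?subr_gt0// /rho; nra.
  move: h; rewrite /=; lra.
have [c1 thc] := inner_const htau tau1 t0.
have [pn0 il _] := H2_log hp np.
(* The unimodular constant is the constant value of [tau], and the density is [|p|], as in the
   factorization just used. *)
split => //; exists (fcoef tau 0), (fun t => cnorm (p t)); split => //; split.
  exact: mea_cnorm.
split; first by apply: ae1 pn0 => t _; exact: cnorm_gt0.
split.
  apply: (integr_le_ae _ (integr_abs il)); first by apply: mea_ln; exact: mea_cnorm.
  by apply: ae1 pn0 => t _ pt; rewrite -cnorm_sq lnXn ?cnorm_gt0// normrMn mulr2n lerDl.
move=> z z1; rewrite -/(Her (fun t => ln (cnorm (p t))) z) -(thc z z1) -PE//.
exact: Cau_csum (H2_L1 hp) z1.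
Qed.

End ToeplitzKernels.

Theorem mainTheorem2 (R : realType) (g : R -> R[i]) :
  inLinf g -> ~ aezero g -> (exists f, kerT g f /\ ~ aezero f) ->
  {ae @leb R, forall t, I01 t -> g t <> 0} /\
  forall k : R -> R[i],
    maximal_vector g k <->
    (inH2 k /\ exists p : R -> R[i], outer p /\
       {ae @leb R, forall t, I01 t ->
          k t = (g t)^-1 * conjc (zeta t) * conjc (p t)}).
Proof.
move=> hg ng hf; have [f [kf nf]] := hf.
have gn0 := kerT_symbol_neq0 hg ng kf nf.
split; first by apply: ae1 gn0 => t _ /eqP.
move=> k; split=> [hk|[hk [p [op kE]]]]; last exact: outer_maximal op kE.
split; first by have [_ [[]]] := hk.
exists (refl (fun t => g t * k t)); split; first exact: maximal_outer.
apply: ae1 gn0 => t _ g0; rewrite -mulrA -(reflE (fun t => g t * k t)).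
by rewrite mulKf.
Qed.
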